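(* Let $K_\nu$ be a completion (archimedean or not) of a number field, $\chi$ a unitary character of $K_\nu^\times$, and $s\in\mathbb{C}$ with $0<\mathrm{Re}(s)<1$. Then, as an identity of distributions on $K_\nu$, $$H\bigl(\chi(x)^{-1}|x|^{-s}\bigr)=\left(\frac{\partial}{\partial s}\log\Gamma(\chi,s)\right)\chi(x)^{-1}|x|^{-s},$$ where the distribution $H(\chi(x)^{-1}|x|^{-s})$ is defined by $\alpha\mapsto\int_{K_\nu}H(\alpha)(x)\,\chi(x)^{-1}|x|^{-s}\,dx$ (an absolutely convergent integral) for Schwartz-Bruhat functions $\alpha$ on $K_\nu$.
   Context: $\lambda$ is the additive character of $K_\nu$ given by $\lambda(x)=\exp(2\pi i\{\mathrm{Tr}(x)\})$ for $\nu$ finite ($\mathrm{Tr}$ the trace to $\mathbb{Q}_p$, $\{a\}$ the polar part of $a\in\mathbb{Q}_p$) and $\lambda(x)=\exp(-2\pi i\,\mathrm{Tr}(x))$ for $\nu$ archimedean ($\mathrm{Tr}$ the trace to $\mathbb{R}$). $dx$ is the self-dual Haar measure for $\lambda$, and $\mathcal{F}(\varphi)(y)=\int_{K_\nu}\varphi(x)\lambda(-xy)\,dx$. $|t|$ is the module: $d(tx)=|t|\,dx$ (so $|z|=z\bar z$ on $\mathbb{C}$). The conductor operator acts on Schwartz-Bruhat functions by $H(\varphi)(x)=\log(|x|)\varphi(x)+\mathcal{F}(\log(|y|)\,\mathcal{F}^{-1}(\varphi)(y))(x)$. For $0<\mathrm{Re}(s)<1$ the Tate-Gel'fand-Graev Gamma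 function $\Gamma(\chi,s)$ is defined by the identity of tempered distributions $\mathcal{F}(\chi(x)|x|^{s-1})=\Gamma(\chi,s)\,\chi^{-1}(y)|y|^{-s}$; it is analytic and non-vanishing in this strip, and $\frac{\partial}{\partial s}\log\Gamma(\chi,s)$ is its logarithmic derivative. *)

(* Defs.v *)
From HB Require Import structures.
From mathcomp Require Import all_boot all_order all_algebra all_field.
From mathcomp Require Import all_classical all_reals all_analysis.
From mathcomp Require Import complex.

Set Implicit Arguments.
Unset Strict Implicit.
Unset Printing Implicit Defensive.

Import Order.TTheory GRing.Theory Num.Theory.
Import numFieldNormedType.Exports.

Local Open Scope classical_set_scope.
Local Open Scope ring_scope.
Local Open Scope complex_scope.

(* the usual topology of the complex numbers *)
HB.instance Definition _ (R : rcfType) := NormedModule.copy R[i] (R[i])^o.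

(* The library's normed Z-modules require `|x *+ n| = `|x| *+ n, which rules
   out ultrametric absolute values; hence this separate interface. *)
HB.mixin Record isCompleteValued (R : realType) K
    of GRing.Field K & Uniform K := {
  absv : K -> R;
  absv_eq0 : forall x : K, (absv x == 0) = (x == 0);
  absvM : forall x y : K, absv (x * y) = absv x * absv y;
  absvD_le : forall x y : K, absv (x + y) <= absv x + absv y;
  entourage_absv : forall A : set (K * K), entourage A <->
    exists2 e : R, 0 < e & [set xy | absv (xy.1 - xy.2) < e] `<=` A;
  absv_complete : forall F : set_system K, ProperFilter F -> cauchy F ->
    exists l : K, F --> l
}.

#[short(type="completeValuedFieldType")]
HB.structure Definition CompleteValuedField (R : realType) :=
  {K of GRing.Field K & Uniform K & isCompleteValued R K}.

#[non_forgetful_inheritance]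
HB.instance Definition _ (R : realType) (K : completeValuedFieldType R) :=
  isPointed.Build (CompleteValuedField.sort K) 0.

(* K is the completion of the number field F at the place given by the
   restriction of absv along iota; the trivial absolute value is not a place. *)
Definition is_completion (R : realType) (F : fieldExtType rat)
    (K : completeValuedFieldType R) (iota : {rmorphism F -> K}) : Prop :=
  dense (range iota) /\ (exists x : K, x != 0 /\ absv x != 1).

Section ComplexFunctions.
Context {R : realType}.

Definition expi (t : R) : R[i] := cos t +i* sin t.

(* r ^ z for r > 0; only used almost everywhere, so the value at r = 0 is
   irrelevant *)
Definition cpow (r : R) (z : R[i]) : R[i] :=
  (expR (complex.Re z * ln r))%:C * expi (complex.Im z * ln r).

Context {d : measure_display} {T : measurableType d}.
Variable mu : {measure set T -> \bar R}.

Definition cintegrable (f : T -> R[i]) : Prop :=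
  mu.-integrable setT (EFin \o (fun x => complex.Re (f x))) /\
  mu.-integrable setT (EFin \o (fun x => complex.Im (f x))).

Definition cintegral (f : T -> R[i]) : R[i] :=
  Rintegral mu setT (fun x => complex.Re (f x))
  +i* Rintegral mu setT (fun x => complex.Im (f x)).

End ComplexFunctions.

(* K with its Borel sigma-algebra *)
Notation borel K := (g_sigma_algebraType (@open K)).

Section LocalField.
Context {R : realType}.
Variable K : completeValuedFieldType R.

Definition archimedean : Prop := exists n : nat, 1 < absv (n%:R : K).

(* the completion of the rationals inside K: a copy of the reals if K is
   archimedean, of Q_p otherwise *)
Definition Qclosure : set K := closure (range (ratr : rat -> K)).

Definition Qbasis (n : nat) (b : 'I_n -> K) : Prop :=
  forall y : K, exists! c : 'rV[K]_n,
    (forall j, Qclosure (c 0 j)) /\ y = \sum_(j < n) c 0 j * b j.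

(* the trace of K over Qclosure, as an element of K *)
Definition is_trace (x t : K) : Prop :=
  exists (n : nat) (b : 'I_n -> K) (A : 'M[K]_n),
    [/\ Qbasis b,
        forall i j, Qclosure (A i j),
        forall i, x * b i = \sum_(j < n) A i j * b j
      & t = \tr A].

Definition trace (x : K) : K := xget 0 [set t | is_trace x t].

(* For K archimedean, the graph of the isomorphism of topological fields
   between Qclosure and R, obtained from the identity of the rationals. *)
Definition real_graph : set (K * R) :=
  closure (range (fun q : rat => (ratr q : K, ratr q : R))).

Definition real_of (t : K) : R := xget 0 [set r | real_graph (t, r)].
Definition of_real (r : R) : K := xget 0 [set t | real_graph (t, r)].

(* For K non-archimedean over Q_p and a in Q_p: the sum of the terms of
   negative degree of the p-adic expansion of a, that is, the m / p ^ n with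
   0 <= m < p ^ n from which a differs by a p-adic integer. *)
Definition polar_part (a : K) : rat := xget 0 [set r |
  exists p n m : nat,
    [/\ prime p, absv (p%:R : K) < 1, (m < p ^ n)%N,
        r = m%:R / (p ^ n)%:R & absv (a - ratr r) <= 1]].

(* the additive character lambda *)
Definition addchar (x : K) : R[i] :=
  if `[< archimedean >] then expi (- (2 * pi * real_of (trace x)))
  else expi (2 * pi * ratr (polar_part (trace x))).

Definition diff_quot (f : K -> R[i]) (h x : K) (t : R) : R[i] :=
  (t^-1)%:C * (f (x + of_real t * h) - f x).

Definition dir_derive (h : K) (f : K -> R[i]) : K -> R[i] :=
  fun x => lim (diff_quot f h x t @[t --> 0^']).

(* for K archimedean; absv is a power of the usual norm of the real vector
   space K, so polynomial decay may be measured with absv *)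
Definition schwartz (f : K -> R[i]) : Prop :=
  forall hs : seq K, let g := foldr dir_derive f hs in
    [/\ continuous g,
        forall h x, cvg (diff_quot g h x t @[t --> 0^'])
      & forall n : nat, exists M : R,
          forall x, (absv x ^+ n)%:C * `|g x| <= M%:C].

Definition locally_constant (f : K -> R[i]) : Prop :=
  forall x, \forall y \near x, f y = f x.

Definition schwartz_bruhat (f : K -> R[i]) : Prop :=
  if `[< archimedean >] then schwartz f
  else locally_constant f /\ compact (closure [set x | f x != 0]).

(* values at 0 are irrelevant *)
Definition unitary_character (chi : K -> R[i]) : Prop :=
  [/\ forall x y, x != 0 -> y != 0 -> chi (x * y) = chi x * chi y,
      forall x, x != 0 -> `|chi x| = 1
    & forall x, x != 0 -> {for x, continuous chi}].

Section Fourier.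
Variable mu : {measure set (borel K) -> \bar R}.

Definition haar : Prop :=
  [/\ forall (a : K) (A : set K), measurable (A : set (borel K)) ->
        mu [set a + x | x in A] = mu A,
      forall C : set K, compact C -> (mu C < +oo)%E
    & forall U : set K, open U -> U !=set0 -> (0 < mu U)%E].

Definition fourier (f : K -> R[i]) (y : K) : R[i] :=
  cintegral mu (fun x : borel K => f x * addchar (- ((x : K) * y))).

Definition inv_fourier (f : K -> R[i]) (y : K) : R[i] :=
  cintegral mu (fun x : borel K => f x * addchar ((x : K) * y)).

Definition self_dual_haar : Prop :=
  haar /\ forall f, schwartz_bruhat f -> inv_fourier (fourier f) = f.

(* d(tx) = |t| dx *)
Definition is_module (md : K -> R) : Prop :=
  forall (t : K) (A : set K), measurable (A : set (borel K)) ->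
    mu [set t * x | x in A] = ((md t)%:E * mu A)%E.

Variable md : K -> R.

Definition conductor (f : K -> R[i]) (x : K) : R[i] :=
  (ln (md x))%:C * f x
  + fourier (fun y => (ln (md y))%:C * inv_fourier f y) x.

(* chi(x) |x|^(s-1) *)
Definition quasichar (chi : K -> R[i]) (s : R[i]) (x : K) : R[i] :=
  chi x * cpow (md x) (s - 1).

(* chi^-1(x) |x|^-s *)
Definition dual_quasichar (chi : K -> R[i]) (s : R[i]) (x : K) : R[i] :=
  (chi x)^-1 * cpow (md x) (- s).

(* The distribution attached to a function g is f |-> \int f g dx, and the
   Fourier transform of a distribution D is f |-> D (fourier f). *)
Definition is_gamma (chi : K -> R[i]) (s c : R[i]) : Prop :=
  forall f, schwartz_bruhat f ->
    cintegral mu (fun x : borel K => fourier f x * quasichar chi s x) =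
    c * cintegral mu (fun y : borel K => f y * dual_quasichar chi s y).

Definition Gamma (chi : K -> R[i]) (s : R[i]) : R[i] :=
  xget 0 [set c | is_gamma chi s c].

Definition dlog_Gamma (chi : K -> R[i]) (s : R[i]) : R[i] :=
  derive1 (Gamma chi) s / Gamma chi s.

End Fourier.
End LocalField.

(* Main.v *)
From HB Require Import structures.
Require Import Defs.
From mathcomp Require Import all_boot all_order all_algebra all_field.
From mathcomp Require Import all_classical all_reals all_analysis.
From mathcomp Require Import complex.
From mathcomp Require Import measurable_realfun.
From mathcomp Require Import ring lra.
Set Implicit Arguments.
Unset Strict Implicit.
Unset Printing Implicit Defensive.
Import Order.TTheory GRing.Theory Num.Theory.
Import numFieldNormedType.Exports.
Local Open Scope classical_set_scope.
Local Open Scope ring_scope.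
Local Open Scope complex_scope.

(** Fubini's theorem gives Tate's local functional equation: the ratio of
   [\int (F f)(x) chi(x) |x|^(s-1) dx] and [\int f(x) chi^-1(x) |x|^-s dx] does
   not depend on [f]. Hence [A(s) = Gamma(s) B(s)] with both integrals
   differentiable in [s], differentiation multiplying the integrand by
   [ln |x|] up to sign. The conductor operator puts this logarithm on both
   sides of the Fourier transform, so the identity is the logarithmic derivative
   of the functional equation, provided the latter also holds for the test
   function [f = F (ln |y| F^-1 alpha)], which is not Schwartz-Bruhat. This
   reduces to the decay [f = O(|x|^-1)] at infinity.

   For the decay, fix [eta] with integral [1] and Fourier transform [om]. The
   integral over [t] of [(1_{|t| <= 1} - om(y t)) / |t|] is [k ln |y| + c] with
   [k > 0]; taking the Fourier transform under this integral expresses [f] by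
   averages of [alpha] over the scale [|t|], which are close to [alpha] for small
   [t] and of size [1 / |t|] and spread over [|x| ~ |t|] for large [t].

   The local fields are not classified: all that is used is that the module is
   a power of the absolute value, that the additive character is continuous and
   nontrivial, and that iterated differences of Schwartz-Bruhat functions are
   small and decay rapidly. *)

Section ComplexNorm.
Variable R : realType.
Implicit Types (z w : R[i]) (a b t : R).

Definition cn z : R := Normc.normc z.

Lemma normE z : `|z| = (cn z)%:C. Proof. by []. Qed.

Lemma cn_inj z a : `|z| = a%:C -> cn z = a.
Proof. by rewrite normE => /complexI. Qed.

Lemma cn_ge0 z : 0 <= cn z. Proof. by rewrite -ler0c -normE. Qed.
Hint Resolve cn_ge0 : core.

Lemma cn0 : cn 0 = 0. Proof. exact: Normc.normc0. Qed.
Lemma cn1 : cn 1 = 1. Proof. exact: Normc.normc1. Qed.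
Lemma cnM z w : cn (z * w) = cn z * cn w. Proof. exact: Normc.normcM. Qed.
Lemma cnD z w : cn (z + w) <= cn z + cn w. Proof. exact: le_normcD. Qed.
Lemma cnN z : cn (- z) = cn z. Proof. exact: normcN. Qed.
Lemma cnB z w : cn (z - w) <= cn z + cn w.
Proof. by rewrite -(cnN w) cnD. Qed.
Lemma cnC z w : cn (z - w) = cn (w - z). Proof. by rewrite -cnN opprB. Qed.
Lemma cnV z : cn z^-1 = (cn z)^-1. Proof. exact: Normc.normcV. Qed.
Lemma cn_eq0 z : (cn z == 0) = (z == 0).
Proof.
apply/eqP/eqP => [/Normc.eq0_normc//|->]; exact: cn0.
Qed.
Lemma cn_gt0 z : (0 < cn z) = (z != 0).
Proof. by rewrite lt_def cn_eq0 cn_ge0 andbT. Qed.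
Lemma cnX z n : cn (z ^+ n) = cn z ^+ n.
Proof. by elim: n => [|n ih]; rewrite ?expr0 ?cn1// !exprS cnM ih. Qed.
Lemma cn_real a : cn a%:C = `|a|.
Proof. by rewrite /cn /Normc.normc/= expr0n addr0 sqrtr_sqr. Qed.
Lemma cnJ z : cn z^*%C = cn z.
Proof. by case: z => a b; rewrite /cn /Normc.normc/= sqrrN. Qed.

Lemma cn_Re z : `|complex.Re z| <= cn z.
Proof. by rewrite -lecR -normE normc_ge_Re. Qed.
Lemma cn_Im z : `|complex.Im z| <= cn z.
Proof.
case: z => a b; rewrite /cn /Normc.normc/= -sqrtr_sqr.
by rewrite ler_wsqrtr// lerDr sqr_ge0.
Qed.
Lemma cn_le z : cn z <= `|complex.Re z| + `|complex.Im z|.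
Proof.
case: z => a b; rewrite /cn /Normc.normc/=.
rewrite -[leRHS]ger0_norm ?addr_ge0// -sqrtr_sqr ler_wsqrtr//.
rewrite sqrrD !real_normK ?num_real//.
by rewrite -addrA lerD2l lerDr mulrn_wge0 ?mulr_ge0.
Qed.

Lemma expiD a b : expi (a + b) = expi a * expi b.
Proof.
rewrite /expi; apply/eqP; rewrite eq_complex/= cosD sinD; apply/andP; split=> //.
by rewrite [X in _ == X]addrC.
Qed.
Lemma expi0 : expi 0 = 1 :> R[i].
Proof. by rewrite /expi cos0 sin0. Qed.
Lemma cn_expi a : cn (expi a) = 1.
Proof. by rewrite /cn /Normc.normc/= cos2Dsin2 sqrtr1. Qed.
Lemma expi_neq0 a : expi a != 0.
Proof. by rewrite -cn_eq0 cn_expi oner_neq0. Qed.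
Lemma expiN a : expi (- a) = (expi a)^-1.
Proof.
by apply: (mulfI (expi_neq0 a)); rewrite -expiD subrr expi0 divff// expi_neq0.
Qed.
Lemma expi2pi : expi (2 * pi) = 1 :> R[i].
Proof. by rewrite /expi (mulrC 2) mulr_natr cos2pi sin2pi. Qed.
Lemma expi2pi_int (m : int) : expi (2 * pi * m%:~R) = 1 :> R[i].
Proof.
have H (n : nat) : expi (2 * pi * n%:R) = 1 :> R[i].
  elim: n => [|n ih]; first by rewrite mulr0 expi0.
  by rewrite -[n.+1%:R]natr1 mulrDr mulr1 expiD ih expi2pi mulr1.
case: m => n; first exact: H.
by rewrite NegzE rmorphN/= mulrN expiN H invr1.
Qed.

Lemma sin_le_norm t : `|sin t| <= `|t|.
Proof.
have P (x : R) : 0 < x -> `|sin x| <= x.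
  move=> x0; have [c _] := @MVT R (@sin R) (@cos R) 0 x x0
    (fun y _ => is_derive_sin y) (continuous_subspaceT (@continuous_sin R)).
  rewrite sin0 !subr0 => ->; rewrite normrM (gtr0_norm x0) ler_piMl//; first exact: ltW.
  by rewrite ler_norml cos_geN1 cos_le1.
have [t0|t0|->] := ltrgtP t 0; last by rewrite sin0 normr0.
  by have := P (- t); rewrite oppr_gt0 sinN normrN => /(_ t0); rewrite (ltr0_norm t0).
by rewrite (gtr0_norm t0) P.
Qed.

Lemma cosB1 t : 1 - cos t = 2 * sin (t / 2) ^+ 2.
Proof.
have := cos_mulr2n (t / 2); have -> : (t / 2) *+ 2 = t by rewrite -mulr_natr; field.
by move=> ->; rewrite cos2sin2; ring.
Qed.

Lemma cosB1_le t : `|cos t - 1| <= `|t| ^+ 2.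
Proof.
rewrite distrC cosB1 normrM normrX ger0_norm//.
have := sin_le_norm (t / 2); rewrite normrM normfV (normr_nat R 2) => h.
by have := normr_ge0 (sin (t / 2)); nra.
Qed.

Lemma cosB1_le1 t : `|cos t - 1| <= `|t|.
Proof.
have [t1|t1] := leP `|t| 1.
  by apply: (le_trans (cosB1_le t)); rewrite expr2 ler_piMl.
have [t2|t2] := leP 2 `|t|.
  apply: le_trans t2; apply: (le_trans (ler_normB _ _)).
  by rewrite normr1 -[2]/(1 + 1) lerD2r ler_norml cos_geN1 cos_le1.
have := sin_le_norm (t / 2); rewrite normrM normfV (normr_nat R 2) => h.
rewrite distrC cosB1 normrM normrX ger0_norm//.
by have := normr_ge0 (sin (t / 2)); nra.
Qed.

Lemma expiB1_le t : cn (expi t - 1) <= 2 * `|t|.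
Proof.
apply: (le_trans (cn_le _)); rewrite /= subr0 mulr_natl mulr2n.
by rewrite lerD ?sin_le_norm ?cosB1_le1.
Qed.

Lemma sinB_le t : `|sin t - t| <= `|t| ^+ 2.
Proof.
have P (x : R) : 0 < x -> `|sin x - x| <= x ^+ 2.
  move=> x0; have [c cI] := @MVT R (@sin R) (@cos R) 0 x x0
    (fun y _ => is_derive_sin y) (continuous_subspaceT (@continuous_sin R)).
  rewrite sin0 !subr0 => ->; rewrite -{2}(mul1r x) -mulrBl normrM (gtr0_norm x0).
  rewrite expr2 ler_pM2r//; apply: (le_trans (cosB1_le1 c)).
  by move: cI; rewrite in_itv/= => /andP[c0 cx]; rewrite gtr0_norm ?ltW.
have [t0|t0|->] := ltrgtP t 0; last by rewrite sin0 subr0 normr0 expr0n.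
  by have := P (- t); rewrite oppr_gt0 sinN -opprD normrN (ltr0_norm t0); apply.
by rewrite (gtr0_norm t0) P.
Qed.

Lemma expRB1_le t : `|expR t - 1| <= `|t| * expR `|t|.
Proof.
have h1 := expR_ge1Dx t; have h2 := expR_ge1Dx (- t); rewrite expRN in h2.
have e0 := expR_gt0 t.
have h3 : expR t - 1 <= t * expR t.
  have : expR t * (1 + - t) <= expR t * (expR t)^-1 by rewrite ler_pM2l.
  by rewrite divff ?gt_eqF//; nra.
have e1 : expR t <= expR `|t| by rewrite ler_expR ler_norm.
have e2 : 1 <= expR `|t| by have := expR_ge1Dx `|t|; have := normr_ge0 t; lra.
have [t0|t0] := leP 0 t.
  by rewrite (ger0_norm t0) ger0_norm; nra.
by rewrite (ltr0_norm t0) in e1 e2 *; rewrite ler_norml; apply/andP; split; nra.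
Qed.

Lemma expRB1B_le t : `|expR t - 1 - t| <= t ^+ 2 * expR `|t|.
Proof.
have h1 := expR_ge1Dx t; have h2 := expR_ge1Dx (- t); rewrite expRN in h2.
have e0 := expR_gt0 t.
have h3 : expR t - 1 <= t * expR t.
  have : expR t * (1 + - t) <= expR t * (expR t)^-1 by rewrite ler_pM2l.
  by rewrite divff ?gt_eqF//; nra.
have h4 : expR t - 1 - t <= t * (expR t - 1) by nra.
rewrite ger0_norm; last by lra.
apply: (le_trans h4); apply: (le_trans (ler_norm _)); rewrite normrM.
rewrite -[t ^+ 2]real_normK ?num_real// expr2 -mulrA ler_wpM2l//.
exact: expRB1_le.
Qed.

Definition cexp w : R[i] := (expR (complex.Re w))%:C * expi (complex.Im w).

Lemma cexpD z w : cexp (z + w) = cexp z * cexp w.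
Proof.
by case: z => a b; case: w => a' b'; rewrite /cexp/= expRD expiD rmorphM/=; ring.
Qed.

Lemma cexp0 : cexp 0 = 1.
Proof. by rewrite /cexp/= expR0 expi0 mulr1. Qed.

Lemma cn_cexp z : cn (cexp z) = expR (complex.Re z).
Proof. by rewrite /cexp cnM cn_expi mulr1 cn_real gtr0_norm ?expR_gt0. Qed.

Lemma cexpB1B_le w : cn (cexp w - 1 - w) <= 6 * cn w ^+ 2 * expR (cn w).
Proof.
have hr := cn_Re w; have hi := cn_Im w; apply: (le_trans (cn_le _)).
move: hr hi; set c := cn w; have c0 : 0 <= c := cn_ge0 w.
clearbody c; case: w c0 => a b /= c0.
rewrite !(mul0r, subr0, mulr0, addr0, add0r) => ha hb.
set Ea := expR a; set Ec := expR c.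
have Ec1 : 1 <= Ec by have := expR_ge1Dx c; rewrite -/Ec; lra.
have EaEc : expR `|a| <= Ec by rewrite ler_expR.
have Ea0 : 0 < Ea := expR_gt0 a.
have EaE : Ea <= Ec by apply: le_trans EaEc; rewrite ler_expR ler_norm.
have sq (x : R) : `|x| <= c -> `|x| ^+ 2 <= c ^+ 2.
  by move=> xc; rewrite lerXn2r ?nnegrE.
have h1 : `|Ea * cos b - 1 - a| <= 2 * (c ^+ 2 * Ec).
  have -> : Ea * cos b - 1 - a = (Ea - 1 - a) + Ea * (cos b - 1) by ring.
  apply: (le_trans (ler_normD _ _)); rewrite mulr_natl mulr2n lerD//.
    apply: (le_trans (expRB1B_le a)); rewrite ler_pM ?sqr_ge0 ?expR_ge0//.
    by rewrite -real_normK ?num_real// sq.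
  rewrite normrM (gtr0_norm Ea0) mulrC ler_pM// ?(ltW Ea0)//.
  by apply: (le_trans (cosB1_le b)); exact: sq.
have h2 : `|Ea * sin b - b| <= 2 * (c ^+ 2 * Ec).
  have -> : Ea * sin b - b = (Ea - 1) * sin b + (sin b - b) by ring.
  apply: (le_trans (ler_normD _ _)); rewrite mulr_natl mulr2n lerD//.
    have h : `|Ea - 1| <= c * Ec.
      by apply: (le_trans (expRB1_le a)); rewrite ler_pM ?expR_ge0.
    rewrite normrM expr2 mulrAC ler_pM// (le_trans (sin_le_norm b))//.
  apply: (le_trans (sinB_le b)); apply: (le_trans (sq _ hb)).
  by rewrite ler_peMr ?sqr_ge0.
have : 0 <= c ^+ 2 * Ec by rewrite mulr_ge0 ?sqr_ge0 ?expR_ge0.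
by move: h1 h2; lra.
Qed.

End ComplexNorm.
#[global] Hint Extern 0 (is_true (_ <= cn _)) => solve [exact: cn_ge0] : core.

Section PowerBounds.
Variable R : realType.

(* Bernoulli applied to [(a / b) ^ k], then squared, beats any linear bound in [k]. *)
Lemma le_of_expn_le (a b A B : R) : 0 <= a -> 0 <= b ->
  (forall k : nat, a ^+ k <= (A * k%:R + B) * b ^+ k) -> a <= b.
Proof.
move=> a0 b0 H; rewrite leNgt; apply/negP => ba.
have [b00|b1] := eqVneq b 0.
  by have := H 1%N; rewrite !expr1 b00 mulr0; rewrite b00 in ba; lra.
have bp : 0 < b by rewrite lt_def b1.
set r := a / b; have r1 : 1 < r by rewrite /r ltr_pdivlMr ?mul1r.
have Hr k : r ^+ k <= A * k%:R + B.
  by rewrite /r expr_div_n ler_pdivrMr ?exprn_gt0.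
set d := r - 1; have d0 : 0 < d by rewrite /d; lra.
have ber k : 1 + k%:R * d <= r ^+ k.
  elim: k => [|k ih]; first by rewrite mul0r addr0 expr0.
  rewrite exprS -natr1; have k0 : 0 <= k%:R :> R by [].
  have -> : r = 1 + d by rewrite /d; ring.
  move: ih; have -> : r = 1 + d by rewrite /d; ring.
  move=> ih; have := ler_wpM2l (_ : 0 <= 1 + d) ih; rewrite (addr_ge0 _ (ltW d0))// => /(_ isT).
  by have := mulr_ge0 (mulr_ge0 k0 (ltW d0)) (ltW d0); nra.
set X := (2 * `|A| + `|B|) / d ^+ 2 + 1.
have X0 : 0 <= X by rewrite addr_ge0// divr_ge0 ?sqr_ge0 ?addr_ge0 ?mulr_ge0.
have := archi_boundP X0; set k := Num.bound X => kX.
have k1 : 1 < k%:R :> R.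
  apply: le_lt_trans kX; rewrite lerDr divr_ge0 ?sqr_ge0 ?addr_ge0 ?mulr_ge0//.
have kk : (2 * `|A| + `|B|) < d ^+ 2 * k%:R.
  have : X - 1 < k%:R by lra.
  by rewrite /X addrK ltr_pdivrMr ?exprn_gt0// [_ * d ^+ 2]mulrC.
have := Hr (2 * k)%N; rewrite mulnC exprM natrM => h.
have h2 : (k%:R * d) ^+ 2 <= (r ^+ k) ^+ 2.
  have h3 := ber k; rewrite lerXn2r ?nnegrE//.
  - by rewrite mulr_ge0 ?ltW.
  - by rewrite exprn_ge0// ltW// (lt_trans _ r1).
  - by apply: le_trans h3; rewrite lerDr.
have : k%:R * (2 * `|A| + `|B|) < k%:R * (d ^+ 2 * k%:R).
  by rewrite ltr_pM2l// (lt_trans _ k1).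
have hA := ler_norm A; have hB := ler_norm B.
have : B <= k%:R * `|B|.
  by apply: (le_trans hB); rewrite ler_peMl// ltW.
have : A * (k%:R * 2) <= k%:R * (2 * `|A|).
  by have : 0 < k%:R :> R by []; nra.
have e : (k%:R * d) ^+ 2 = k%:R * (d ^+ 2 * k%:R) by ring.
by rewrite e in h2; rewrite !mulrDr; lra.
Qed.

Lemma monotone_hom_powR (K : fieldType) (u v : K -> R) :
  (forall x : K, x != 0 -> 0 < u x) -> (forall x : K, x != 0 -> 0 < v x) ->
  (forall x y : K, x != 0 -> y != 0 -> u (x * y) = u x * u y) ->
  (forall x y : K, x != 0 -> y != 0 -> v (x * y) = v x * v y) ->
  (forall x : K, x != 0 -> u x <= 1 -> v x <= 1) ->
  (exists2 x : K, x != 0 & u x != 1) ->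
  exists2 c, 0 <= c & forall x : K, x != 0 -> v x = u x `^ c.
Proof.
move=> u0 v0 uM vM uv [x1 x10 ux1].
have hom1 (w : K -> R) : (forall x : K, x != 0 -> 0 < w x) ->
    (forall x y : K, x != 0 -> y != 0 -> w (x * y) = w x * w y) -> w 1 = 1.
  move=> w0 wM; have := wM 1 1 (oner_neq0 _) (oner_neq0 _); rewrite mulr1 => /eqP.
  rewrite -subr_eq0 -{1}[w 1]mulr1 -mulrBr mulf_eq0 gt_eqF ?w0 ?oner_neq0//=.
  by rewrite subr_eq0 => /eqP <-.
have homV (w : K -> R) : (forall x : K, x != 0 -> 0 < w x) ->
    (forall x y : K, x != 0 -> y != 0 -> w (x * y) = w x * w y) ->
    forall x : K, x != 0 -> w x^-1 = (w x)^-1.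
  move=> w0 wM x x0; apply: (mulfI (lt0r_neq0 (w0 _ x0))).
  by rewrite -wM ?invr_eq0// !divff ?(hom1 w)// lt0r_neq0 ?w0.
have homX (w : K -> R) : (forall x : K, x != 0 -> 0 < w x) ->
    (forall x y : K, x != 0 -> y != 0 -> w (x * y) = w x * w y) ->
    forall (x : K) (m : int), x != 0 -> ln (w (x ^ m)) = m%:~R * ln (w x).
  move=> w0 wM x m x0.
  have H n : ln (w (x ^+ n)) = n%:R * ln (w x).
    elim: n => [|n ih]; first by rewrite expr0 (hom1 w)// ln1 mul0r.
    rewrite exprS wM ?expf_neq0// lnM ?posrE ?w0 ?expf_neq0// ih -natr1; ring.
  case: m => n; first exact: H.
  rewrite NegzE -exprnN homV ?expf_neq0// lnV ?posrE ?w0 ?expf_neq0// H.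
  by rewrite rmorphN/= mulNr.
have [x0 x00 ux0] : exists2 x : K, x != 0 & 1 < u x.
  have [h|h|h] := ltrgtP (u x1) 1; last by rewrite h eqxx in ux1.
    exists x1^-1; first by rewrite invr_eq0.
    by rewrite homV// invf_gt1// u0.
  by exists x1.
have U0 : 0 < ln (u x0) by rewrite ln_gt0.
have V0 : 0 <= ln (v x0).
  have := uv x0^-1; rewrite invr_eq0 => /(_ x00); rewrite !homV//.
  rewrite invf_le1 ?u0// => /(_ (ltW ux0)); rewrite invf_le1 ?v0//.
  exact: ln_ge0.
have uvB x y : x != 0 -> y != 0 -> ln (u x) <= ln (u y) -> ln (v x) <= ln (v y).
  move=> xn yn; rewrite !ler_ln ?posrE ?u0 ?v0// => h.
  have := uv (x / y) (mulf_neq0 xn _); rewrite invr_eq0 => /(_ yn).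
  rewrite uM ?vM ?invr_eq0// !homV// !ler_pdivrMr ?u0 ?v0// !mul1r; exact.
exists (ln (v x0) / ln (u x0)); first by rewrite divr_ge0// ltW.
move=> x xn; apply: ln_inj; rewrite ?posrE ?v0 ?powR_gt0 ?u0// ln_powR.
set c := _ / _; set D := ln (v x) - c * ln (u x).
have key (n : nat) : n%:R * `|D| <= ln (v x0).
  set m := Num.floor (n%:R * ln (u x) / ln (u x0)).
  have /andP[m1 m2] := floor_itv (n%:R * ln (u x) / ln (u x0)).
  rewrite -/m in m1 m2; rewrite ler_pdivlMr// in m1; rewrite ltr_pdivrMr// in m2.
  have e1 : ln (v (x0 ^ m)) <= ln (v (x ^ n)).
    by apply: uvB; rewrite ?expfz_neq0// !homX.
  have e2 : ln (v (x ^ n)) <= ln (v (x0 ^ (m + 1))).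
    by apply: uvB; rewrite ?expfz_neq0// !homX// ltW.
  rewrite !homX// in e1 e2.
  have cU : c * ln (u x0) = ln (v x0) by rewrite /c divfK ?gt_eqF.
  have c0 : 0 <= c by rewrite /c divr_ge0// ltW.
  have f1 : m%:~R * ln (v x0) <= c * (n%:R * ln (u x)).
    by rewrite -cU mulrCA ler_wpM2l.
  have f2 : c * (n%:R * ln (u x)) <= (m + 1)%:~R * ln (v x0).
    by rewrite -cU [_ * (c * _)]mulrCA ler_wpM2l// ltW.
  have -> : n%:R * `|D| = `|n%:R * D| by rewrite normrM normr_nat.
  rewrite intrD mulrDl mul1r in f2; rewrite intrD mulrDl mul1r in e2.
  rewrite -[Posz n]/(n%:Z) /= -pmulrn in e1 e2.
  rewrite ler_norml /D mulrBr [n%:R * (c * _)]mulrCA; apply/andP; split; lra.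
apply/eqP; rewrite -subr_eq0 -/D -normr_eq0; apply/negPn/negP => D0.
have Dp : 0 < `|D| by rewrite lt_def D0/=.
have := archi_boundP (divr_ge0 V0 (ltW Dp)); rewrite ltr_pdivrMr// => h.
by have := key (Num.bound (ln (v x0) / `|D|)); rewrite leNgt h.
Qed.

End PowerBounds.

(** * Valued fields, the trace and the additive character *)

Section Valued.
Variables (R : realType) (K : completeValuedFieldType R).
Implicit Types (x y : K) (e : R).

Lemma absv0 : absv (0 : K) = 0. Proof. by apply/eqP; rewrite absv_eq0. Qed.

Lemma absv1 : absv (1 : K) = 1.
Proof.
have := absvM (1 : K) 1; rewrite mulr1 => /eqP.
rewrite -subr_eq0 -{1}[absv 1]mulr1 -mulrBr mulf_eq0 absv_eq0 oner_eq0/=.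
by rewrite subr_eq0 => /eqP <-.
Qed.

Lemma absvN x : absv (- x) = absv x.
Proof.
have sqN1 : absv (-1 : K) ^+ 2 = 1 by rewrite expr2 -absvM mulrNN mulr1 absv1.
have : absv (-1 : K) = 1.
  move/eqP: sqN1; rewrite sqrf_eq1 => /orP[/eqP//|/eqP N1].
  have : entourage [set xy : K * K | absv (xy.1 - xy.2) < 1].
    by apply/entourage_absv; exists 1.
  move=> /entourage_inv/entourage_absv[e e0 /(_ (- 1 - 1, 0))] /=.
  have h := absvD_le (-1 : K) (-1); rewrite N1 in h.
  rewrite subr0 sub0r => H; exfalso.
  have e1 : absv (- (-1 - 1) : K) = -1 * absv (-1 - 1 : K).
    by rewrite -[- (-1 - 1)]mulN1r absvM N1.
  rewrite e1 in H.
  have : absv (-1 - 1 : K) < e by lra.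
  by move=> /H; lra.
by move=> N1; rewrite -[- x]mulN1r absvM N1 mul1r.
Qed.

Lemma absv_ge0 x : 0 <= absv x.
Proof. by have := absvD_le x (- x); rewrite subrr absv0 absvN; lra. Qed.
Hint Resolve absv_ge0 : core.

Lemma absv_gt0 x : (0 < absv x) = (x != 0).
Proof. by rewrite lt_def absv_eq0 absv_ge0 andbT. Qed.

Lemma absvV x : absv x^-1 = (absv x)^-1.
Proof.
have [->|x0] := eqVneq x 0; first by rewrite invr0 absv0 invr0.
have ax0 : absv x != 0 by rewrite absv_eq0.
by apply: (mulfI ax0); rewrite -absvM !divff ?absv1// absv_eq0.
Qed.

Lemma absvX x n : absv (x ^+ n) = absv x ^+ n.
Proof. by elim: n => [|n ih]; rewrite ?expr0 ?absv1// !exprS absvM ih. Qed.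

Lemma absvB_le x y : absv (x - y) <= absv x + absv y.
Proof. by rewrite -(absvN y) absvD_le. Qed.

Lemma absvC x y : absv (x - y) = absv (y - x).
Proof. by rewrite -absvN opprB. Qed.

Lemma absv_dist x y : `|absv x - absv y| <= absv (x - y).
Proof.
have h1 := absvD_le (x - y) y; have h2 := absvD_le (y - x) x.
rewrite !subrK (absvC y) in h1 h2; rewrite ler_norml; apply/andP; split; lra.
Qed.

Lemma absv_sum (I : Type) (r : seq I) (P : pred I) (F : I -> K) :
  absv (\sum_(i <- r | P i) F i) <= \sum_(i <- r | P i) absv (F i).
Proof.
elim/big_ind2 : _ => [|x1 a1 x2 a2 h1 h2|//]; first by rewrite absv0.
by rewrite (le_trans (absvD_le _ _))// lerD.
Qed.

Lemma absv_nat (n : nat) : absv (n%:R : K) <= n%:R.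
Proof.
elim: n => [|n ih]; first by rewrite absv0.
by rewrite -!natr1 (le_trans (absvD_le _ _))// absv1 lerD2r.
Qed.

Lemma nbhs_absvP x (A : set K) :
  nbhs x A <-> exists2 e, 0 < e & forall y, absv (y - x) < e -> A y.
Proof.
rewrite -nbhs_entourageE; split=> [[E /entourage_absv[e e0 eE] EA]|[e e0 eA]].
  by exists e => // y yx; apply: EA; rewrite /xsection/= inE; apply: eE; rewrite /= absvC.
exists [set xy : K * K | absv (xy.1 - xy.2) < e]; first by apply/entourage_absv; exists e.
by move=> y; rewrite /xsection/= inE /= absvC => /eA.
Qed.

Lemma near_absv x (e : R) : 0 < e -> \forall y \near x, absv (y - x) < e.
Proof. by move=> e0; apply/nbhs_absvP; exists e. Qed.

Lemma closure_absvP (A : set K) x :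
  closure A x <-> forall e, 0 < e -> exists2 y, A y & absv (y - x) < e.
Proof.
split=> [cA e e0|H B /nbhs_absvP[e e0 eB]].
  by have [y [Ay yx]] := cA _ (near_absv x e0); exists y.
by have [y Ay yx] := H e e0; exists y; split=> //; exact: eB.
Qed.

Lemma cvg_absvP (T : Type) (F : set_system T) (f : T -> K) l : Filter F ->
  (f @ F --> l) <-> forall e, 0 < e -> \forall t \near F, absv (f t - l) < e.
Proof.
move=> FF; split=> [fl e e0|H A /nbhs_absvP[e e0 eA]].
  exact: (fl _ (near_absv l e0)).
by apply: filterS (H e e0) => t /eA.
Qed.

Lemma cvg_cnP (T : Type) (F : set_system T) (f : T -> R[i]) l : Filter F ->
  (f @ F --> l) <-> forall e, 0 < e -> \forall t \near F, cn (f t - l) < e.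
Proof.
move=> FF; rewrite (_ : (f @ F --> l) <-> _); last first.
  by split=> [/cvgrPdist_lt H|H]; [exact: H|apply/cvgrPdist_lt; exact: H].
split=> [H e e0|H e e0].
  have : 0 < e%:C by rewrite ltcR.
  by move=> /H; apply: filterS => t; rewrite normE ltcR cnC.
have : e \is Num.real by rewrite realE ltW.
move=> /complex_realP[a ea]; move: e0; rewrite ea ltcR => /H.
by apply: filterS => t; rewrite normE ltcR cnC.
Qed.

Lemma continuous_cnP (f : K -> R[i]) x : {for x, continuous f} <->
  forall e, 0 < e -> exists2 d, 0 < d &
    forall y, absv (y - x) < d -> cn (f y - f x) < e.
Proof.
split=> [/cvg_cnP H e /H /nbhs_absvP//|H].
by apply/cvg_cnP => e /H ?; apply/nbhs_absvP.
Qed.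

Lemma continuous_normP (f : K -> R) x : {for x, continuous f} <->
  forall e, 0 < e -> exists2 d, 0 < d &
    forall y, absv (y - x) < d -> `|f y - f x| < e.
Proof.
split=> [/cvgrPdist_lt H e /H /nbhs_absvP[d d0 dH]|H].
  by exists d => // y /dH; rewrite distrC.
apply/cvgrPdist_lt => e /H[d d0 dH]; apply/nbhs_absvP.
by exists d => // y /dH; rewrite distrC.
Qed.

Lemma cauchy_seq_absv (u : nat -> K) :
  (forall e, 0 < e -> exists N, forall m n, (N <= m)%N -> (N <= n)%N ->
     absv (u m - u n) < e) ->
  exists l, forall e, 0 < e -> exists N, forall n, (N <= n)%N -> absv (u n - l) < e.
Proof.
move=> uC; have [l ul] : exists l : K, u @ \oo --> l.
  apply: absv_complete => A /entourage_absv[e e0 eA].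
  have [N HN] := uC e e0.
  exists ([set u n | n in [set n | (N <= n)%N]], [set u n | n in [set n | (N <= n)%N]]).
    by split; exists N => // n Nn; exists n.
  by case=> _ _ [/= [m Nm <-] [n Nn <-]]; apply: eA; exact: HN.
exists l => e e0; move/cvg_absvP : ul => /(_ e e0)[N _ HN]; exists N => n Nn.
exact: HN.
Qed.

Lemma open_absv_lt x e : open [set y : K | absv (y - x) < e].
Proof.
rewrite openE => y /= yx; apply/nbhs_absvP; exists (e - absv (y - x)).
  by rewrite subr_gt0.
move=> z zy /=; have := absvD_le (z - y) (y - x).
by rewrite addrA subrK; lra.
Qed.

Lemma open_absvP (A : set K) : open A <->
  forall x, A x -> exists2 e, 0 < e & forall y, absv (y - x) < e -> A y.
Proof.
rewrite openE; split=> [H x /H /nbhs_absvP//|H x /H ?]; exact/nbhs_absvP.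
Qed.

Lemma compact_absv_bounded (A : set K) : compact A -> exists M : R, forall x, A x -> absv x <= M.
Proof.
move=> /compact_near_coveringP cA.
have : \forall M \near +oo%R, A `<=` (fun x => absv x <= M).
  apply: (cA R (+oo%R) (fun M x => absv x <= M)) => x Ax.
  exists ([set y | absv (y - x) < 1], [set M | absv x + 1 <= M]).
    by split; [exact: near_absv|by apply: nbhs_pinfty_ge; rewrite num_real].
  case=> y M /= [yx xM]; have := absvD_le (y - x) x; rewrite subrK; lra.
by case=> M [_ HM]; exists (M + 1) => x Ax; apply: (HM (M + 1)) => //; rewrite ltrDl.
Qed.

End Valued.
#[global] Hint Extern 0 (is_true (_ <= absv _)) => solve [exact: absv_ge0] : core.

Section RationalSubfield.
Variables (R : realType) (K : completeValuedFieldType R).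
Variable phi : {rmorphism rat -> K}.
Implicit Types (x y : K) (e : R).

Lemma ratr_rmorph q : ratr q = phi q.
Proof.
rewrite /ratr -[in RHS](divq_num_den q) fmorph_div !rmorph_int; congr (_ / _).
Qed.

Lemma natr_neq0 (n : nat) : (n%:R == 0 :> K) = (n == 0%N).
Proof. by rewrite -(rmorph_nat phi) fmorph_eq0 pnatr_eq0. Qed.

Lemma absv_intr (m : int) : absv (m%:~R : K) = absv (`|m|%N%:R : K).
Proof.
case: m => n; first by rewrite absz_nat.
by rewrite NegzE rmorphN absvN abszN absz_nat.
Qed.

Lemma absv_ratr q : absv (phi q) = absv (`|numq q|%N%:R : K) / absv (`|denq q|%N%:R : K).
Proof. by rewrite -ratr_rmorph /ratr absvM absvV !absv_intr. Qed.

(* By the base-[n] expansion of [m]. Applied to powers of [m], the factor linear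
   in [k] disappears by [le_of_expn_le]: this is Ostrowski's argument. *)
Lemma absv_digits (n k m : nat) : (1 < n)%N -> (m < n ^ k)%N ->
  absv (m%:R : K) <= k%:R * n%:R * Num.max 1 (absv (n%:R : K)) ^+ k.
Proof.
move=> n1; set M := Num.max _ _.
have M1 : 1 <= M by rewrite /M le_max lexx.
elim: k m => [|k ih] m; first by rewrite expn0 ltnS leqn0 => /eqP->; rewrite absv0 !mul0r.
move=> mn; have n0 : (0 < n)%N by apply: ltn_trans n1.
have /ih h : (m %/ n < n ^ k)%N by rewrite ltn_divLR// -expnSr.
rewrite (divn_eq m n) natrD natrM; apply: (le_trans (absvD_le _ _)); rewrite absvM.
have nM : absv (n%:R : K) <= M by rewrite /M le_max lexx orbT.
have h1 : absv ((m %/ n)%:R : K) * absv (n%:R : K) <= k%:R * n%:R * M ^+ k * M.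
  by apply: ler_pM.
have h2 : absv ((m %% n)%:R : K) <= n%:R * M ^+ k.+1.
  apply: (le_trans (absv_nat _ _)); rewrite (@le_trans _ _ n%:R)//.
    by rewrite ler_nat ltnW// ltn_pmod.
  by rewrite ler_peMr// exprn_ege1.
apply: (le_trans (lerD h1 h2)); rewrite -natr1 exprSr.
by rewrite le_eqVlt; apply/orP; left; apply/eqP; ring.
Qed.

Lemma absv_nat_le_expn (n m L : nat) : (1 < n)%N -> (m <= n ^ L)%N ->
  absv (m%:R : K) <= Num.max 1 (absv (n%:R : K)) ^+ L.
Proof.
move=> n1 mn; set M := Num.max _ _.
have M1 : 1 <= M by rewrite /M le_max lexx.
have M0 : 0 <= M by apply: le_trans M1.
apply: (@le_of_expn_le _ _ _ (L%:R * n%:R * M) (n%:R * M)) => [//||k].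
  exact: exprn_ge0.
have : (m ^ k < n ^ (L * k).+1)%N.
  apply: (@leq_ltn_trans (n ^ (L * k))); last by rewrite ltn_exp2l.
  by rewrite expnM; case: k => [//|k]; rewrite leq_exp2r.
move=> /(absv_digits n1); rewrite natrX absvX => h; apply: (le_trans h).
rewrite -natr1 natrM -/M exprS exprM.
by rewrite le_eqVlt; apply/orP; left; apply/eqP; ring.
Qed.

Section Archimedean.
Hypothesis arch : archimedean K.

Lemma absv_nat_gt1 (n : nat) : (1 < n)%N -> 1 < absv (n%:R : K).
Proof.
move=> n1; rewrite ltNge; apply/negP => h; have [m m1] := arch.
have : (m <= n ^ m)%N by rewrite ltnW// ltn_expl.
move=> /(absv_nat_le_expn n1); rewrite max_l// expr1n leNgt; exact/negP/negPn.
Qed.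

Lemma absv_ratr_le1 q : `|q| <= 1 -> absv (phi q) <= 1.
Proof.
have [->|q0] := eqVneq q 0; first by rewrite rmorph0 absv0.
rewrite -[q in `|q|]divq_num_den normf_div ler_pdivrMr; last first.
  by rewrite normr_gt0 intr_eq0 denq_neq0.
rewrite mul1r -!intr_norm ler_int -!abszE lez_nat absv_ratr => h.
have dn0 : (0 < `|denq q|)%N by rewrite absz_gt0 denq_neq0.
have [d1|d1] := leqP `|denq q| 1.
  have nn0 : (0 < `|numq q|)%N by rewrite absz_gt0 numq_eq0.
  have -> : `|denq q|%N = 1%N by apply/eqP; rewrite eqn_leq d1.
  have -> : `|numq q|%N = 1%N by apply/eqP; rewrite eqn_leq nn0 (leq_trans h).
  by rewrite absv1 divr1.
have d2 := absv_nat_gt1 d1.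
rewrite ler_pdivrMr ?mul1r; last by apply: lt_trans d2.
have := @absv_nat_le_expn _ `|numq q| 1 d1; rewrite expn1 expr1 => /(_ h).
by rewrite max_r// ltW.
Qed.

Lemma absv_ratr_powR : exists2 a : R, 0 < a &
  forall q, absv (phi q) = `|ratr q| `^ a.
Proof.
have [] := @monotone_hom_powR R rat (fun q => `|ratr q : R|)
   (fun q => absv (phi q)).
- by move=> q q0; rewrite normr_gt0 fmorph_eq0.
- by move=> q q0; rewrite absv_gt0 fmorph_eq0.
- by move=> x y _ _; rewrite rmorphM normrM.
- by move=> x y _ _; rewrite rmorphM absvM.
- by move=> q q0 q1; apply: absv_ratr_le1; rewrite -(ler_rat R) ratr_norm rmorph1.
- by exists 2%:R => //; rewrite ratr_nat normr_nat gt_eqF// ltr1n.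
move=> c c0 H; have cp : 0 < c.
  rewrite lt_def c0 andbT; apply/eqP => cE.
  have [m m1] := arch; have m0 : (m%:R : rat) != 0.
    by apply/eqP => m0; rewrite -(rmorph_nat phi) m0 rmorph0 absv0 ltr10 in m1.
  by have := H _ m0; rewrite rmorph_nat cE powRr0 => e; rewrite e ltxx in m1.
exists c => // q; have [->|q0] := eqVneq q 0; last exact: H.
by rewrite !rmorph0 absv0 normr0 powR0 ?gt_eqF.
Qed.

End Archimedean.

Lemma absv_ultrametric : ~ archimedean K ->
  forall x y, absv (x + y) <= Num.max (absv x) (absv y).
Proof.
move=> narch x y; set M := Num.max _ _.
have M0 : 0 <= M by rewrite /M le_max absv_ge0.
apply: (@le_of_expn_le _ _ _ 1 1) => // k.
rewrite -absvX exprDn; apply: (le_trans (absv_sum _ _ _)).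
apply: (@le_trans _ _ (\sum_(i < k.+1) M ^+ k)); last first.
  by rewrite sumr_const card_ord -[M ^+ k *+ _]mulr_natl mul1r natr1.
apply: ler_sum => i _; rewrite -mulr_natl absvM -[leRHS]mul1r ler_pM//.
  by rewrite leNgt; apply/negP => h; apply: narch; eexists; exact: h.
have -> : M ^+ k = M ^+ (k - i) * M ^+ i by rewrite -exprD subnK// -ltnS.
rewrite absvM !absvX.
by rewrite ler_pM ?exprn_ge0// lerXn2r ?nnegrE// /M le_max lexx ?orbT.
Qed.

Let k : set K := @Qclosure R K.

Lemma Qclosure_ratr q : Qclosure (phi q).
Proof. by apply: subset_closure; exists q => //; rewrite ratr_rmorph. Qed.

Lemma QclosureP x : Qclosure x <-> forall e, 0 < e -> exists q, absv (phi q - x) < e.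
Proof.
split=> [/closure_absvP H e /H[_ [q _ <-] qx]|H].
  by exists q; rewrite -ratr_rmorph.
by apply/closure_absvP => e /H[q qx]; exists (ratr q); [exists q|rewrite ratr_rmorph].
Qed.

Lemma Qclosure_closed x :
  (forall e, 0 < e -> exists2 y, Qclosure y & absv (y - x) < e) -> Qclosure x.
Proof.
move=> H; apply/QclosureP => e e0; have e2 : 0 < e / 2 by rewrite divr_gt0.
have [y /QclosureP/(_ _ e2)[q qy] yx] := H _ e2; exists q.
have := absvD_le (phi q - y) (y - x); rewrite addrA subrK; lra.
Qed.

Lemma QclosureD x y : Qclosure x -> Qclosure y -> Qclosure (x + y).
Proof.
move=> /QclosureP Hx /QclosureP Hy; apply/QclosureP => e e0.
have e2 : 0 < e / 2 by rewrite divr_gt0.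
have [q qx] := Hx _ e2; have [r ry] := Hy _ e2; exists (q + r).
rewrite rmorphD; have := absvD_le (phi q - x) (phi r - y).
rewrite (_ : phi q - x + _ = phi q + phi r - (x + y)); first by lra.
by rewrite opprD addrACA.
Qed.

Lemma QclosureM x y : Qclosure x -> Qclosure y -> Qclosure (x * y).
Proof.
move=> /QclosureP Hx /QclosureP Hy; apply/QclosureP => e e0.
set A := absv x + absv y + 1; have A1 : 1 <= A by rewrite /A lerDr addr_ge0.
have A0 : 0 < A by apply: lt_le_trans A1.
set d := Num.min 1 (e / (2 * A)).
have d0 : 0 < d by rewrite /d lt_min ltr01/= divr_gt0// mulr_gt0.
have d1 : d <= 1 by rewrite /d ge_min lexx.
have dA : d * (2 * A) <= e by rewrite -ler_pdivlMr ?mulr_gt0// /d ge_min lexx orbT.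
have [q qx] := Hx _ d0; have [r ry] := Hy _ d0; exists (q * r).
rewrite rmorphM.
have -> : phi q * phi r - x * y =
  (phi q - x) * (phi r - y) + ((phi q - x) * y + x * (phi r - y)) by ring.
apply: (le_lt_trans (absvD_le _ _)); rewrite absvM.
have := absvD_le ((phi q - x) * y) (x * (phi r - y)); rewrite !absvM.
have := absv_ge0 x; have := absv_ge0 y; have := absv_ge0 (phi q - x).
have := absv_ge0 (phi r - y); rewrite /A in dA; move: qx ry.
set X := absv (phi q - x); set Y := absv (phi r - y).
by move=> qx ry Y0 X0 y0 x0; nra.
Qed.

Lemma Qclosure0 : Qclosure (0 : K).
Proof. by rewrite -(rmorph0 phi); exact: Qclosure_ratr. Qed.

Lemma Qclosure1 : Qclosure (1 : K).
Proof. by rewrite -(rmorph1 phi); exact: Qclosure_ratr. Qed.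

Lemma QclosureN x : Qclosure x -> Qclosure (- x).
Proof.
move=> /QclosureP H; apply/QclosureP => e /H[q qx]; exists (- q).
by rewrite rmorphN -opprD absvN.
Qed.

Lemma QclosureB x y : Qclosure x -> Qclosure y -> Qclosure (x - y).
Proof. by move=> hx hy; apply: QclosureD => //; exact: QclosureN. Qed.

Lemma QclosureV x : Qclosure x -> Qclosure x^-1.
Proof.
have [->|x0 /QclosureP H] := eqVneq x 0; first by rewrite invr0.
apply/QclosureP => e e0.
have ax0 : 0 < absv x by rewrite absv_gt0.
set d := Num.min (absv x / 2) (e * absv x ^+ 2 / 2).
have d0 : 0 < d by rewrite /d lt_min !divr_gt0// mulr_gt0// exprn_gt0.
have [q qx] := H _ d0; exists q^-1.
have d1 : d <= absv x / 2 by rewrite /d ge_min lexx.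
have d2 : d <= e * absv x ^+ 2 / 2 by rewrite /d ge_min lexx orbT.
have hq : absv x / 2 < absv (phi q).
  by have := absvB_le (phi q) (phi q - x); rewrite opprB addrCA subrr addr0; lra.
have q0 : phi q != 0 by rewrite -absv_gt0; lra.
rewrite fmorphV.
have -> : (phi q)^-1 - x^-1 = (x - phi q) / (phi q * x) by field; apply/andP.
rewrite absvM absvV absvM absvC ltr_pdivrMr; last by rewrite mulr_gt0// absv_gt0.
apply: (lt_le_trans qx); apply: (le_trans d2).
rewrite expr2 -!mulrA ler_pM2l// [leRHS]mulrC ler_pM2l//; exact: ltW.
Qed.

Lemma Qclosure_sum (I : Type) (r : seq I) (P : pred I) (F : I -> K) :
  (forall i, P i -> Qclosure (F i)) -> Qclosure (\sum_(i <- r | P i) F i).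
Proof. by move=> H; elim/big_ind : _ => //; [exact: Qclosure0|exact: QclosureD]. Qed.

Lemma coord_bound n (b : 'I_n -> K) :
  (forall c : 'I_n -> K, (forall j, Qclosure (c j)) ->
     \sum_j c j * b j = 0 -> forall j, c j = 0) ->
  exists2 C : R, 0 <= C & forall c : 'I_n -> K, (forall j, Qclosure (c j)) ->
     forall j, absv (c j) <= C * absv (\sum_j c j * b j).
Proof.
elim: n b => [|n ih] b indep.
  by exists 0 => // c _ [].
set b' := fun j => b (lift ord0 j).
have [c ck|C C0 HC] := ih b'.
  move=> s0 j; have := indep (fun i => oapp c 0 (unlift ord0 i)) _ _ (lift ord0 j).
  rewrite liftK; apply.
    move=> i; case: unliftP => [i' _|_] /=; [exact: ck|exact: Qclosure0].
  rewrite big_ord_recl unlift_none/= mul0r add0r -[RHS]s0.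
  by apply: eq_bigr => i _; rewrite liftK.
set S := fun c : 'I_n -> K => \sum_j c j * b' j.
have [d d0 Hd] : exists2 d : R, 0 < d & forall c : 'I_n -> K,
    (forall j, Qclosure (c j)) -> d <= absv (b ord0 + S c).
  apply: contrapT => H.
  have {}H (m : nat) : exists c : 'I_n -> K, (forall j, Qclosure (c j)) /\
      absv (b ord0 + S c) < m.+1%:R^-1.
    apply: contrapT => H2; apply: H; exists m.+1%:R^-1; first by rewrite invr_gt0.
    by move=> c ck; rewrite leNgt; apply/negP => h; apply: H2; exists c.
  have [c Hc] := choice H.
  have small e : 0 < e -> exists N, forall m, (N <= m)%N -> m.+1%:R^-1 < e.
    move=> e0; exists (Num.bound e^-1) => m Nm; rewrite -[e]invrK ltf_pV2 ?posrE//.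
      by apply: (lt_le_trans (archi_boundP (ltW _))); rewrite ?invr_gt0// ler_nat leqW.
    by rewrite invr_gt0.
  have cC j e : 0 < e -> exists N, forall m p, (N <= m)%N -> (N <= p)%N ->
      absv (c m j - c p j) < e.
    move=> e0; have [//|N HN] := small (e / (2 * (C + 1))).
      by rewrite divr_gt0// mulr_gt0// ltr_wpDl.
    exists N => m p Nm Np.
    have := HC (fun j => c m j - c p j) _ j.
    move=> /(_ (fun i => QclosureB ((Hc m).1 i) ((Hc p).1 i))) h.
    apply: (le_lt_trans h).
    have -> : \sum_j (c m j - c p j) * b' j = (b ord0 + S (c m)) - (b ord0 + S (c p)).
      rewrite opprD addrACA subrr add0r /S -sumrB.
      by apply: eq_bigr => i _; rewrite mulrBl.
    have h1 := (Hc m).2; have h2 := (Hc p).2; have h3 := HN _ Nm; have h4 := HN _ Np.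
    have h5 := absvB_le (b ord0 + S (c m)) (b ord0 + S (c p)).
    have : (C + 1) * absv (b ord0 + S (c m) - (b ord0 + S (c p))) < e.
      rewrite mulrC -ltr_pdivlMr ?ltr_wpDl//.
      have -> : e / (C + 1) = e / (2 * (C + 1)) + e / (2 * (C + 1)).
        by field; rewrite gt_eqF// ltr_wpDl.
      by apply: (le_lt_trans h5); rewrite ltrD// (lt_trans h1, lt_trans h2).
    by have := absv_ge0 (b ord0 + S (c m) - (b ord0 + S (c p))); nra.
  have [l Hl] := choice (fun j => cauchy_seq_absv (cC j)).
  have lk j : Qclosure (l j).
    apply: Qclosure_closed => e e0; have [N HN] := Hl j e e0.
    by exists (c N j); [exact: (Hc N).1|exact: HN].
  have l0 : b ord0 + S l = 0.
    apply/eqP; rewrite -absv_eq0 eq_le absv_ge0 andbT leNgt; apply/negP => e0.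
    set e := absv (b ord0 + S l) in e0 *.
    set B := \sum_j absv (b' j); have B0 : 0 <= B by apply: sumr_ge0.
    have [|N1 HN1] := small (e / 2); first by rewrite divr_gt0.
    have dd : 0 < e / (2 * (B + 1)) by rewrite divr_gt0// mulr_gt0// ltr_wpDl.
    have [N2 HN2] := choice (fun j => Hl j _ dd).
    set m := maxn N1 (\max_j N2 j).
    have h1 := lt_trans (Hc m).2 (HN1 _ (leq_maxl _ _)).
    have h2 : absv (S l - S (c m)) <= e / (2 * (B + 1)) * B.
      rewrite /S -sumrB mulr_sumr; apply: (le_trans (absv_sum _ _ _)); apply: ler_sum => i _.
      rewrite -mulrBl absvM ler_wpM2r// ltW// absvC HN2// /m.
      by rewrite (leq_trans _ (leq_maxr _ _))// (bigmaxD1 i)// leq_maxl.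
    have h3 : e / (2 * (B + 1)) * B < e / 2.
      rewrite mulrAC ltr_pdivrMr ?mulr_gt0 ?ltr_wpDl// mulrA divfK//.
      by rewrite ltr_pM2l// ltrDl.
    have := absvD_le (b ord0 + S (c m)) (S l - S (c m)).
    rewrite -addrA (addrC (S (c m))) subrK -/e; lra.
  have k1 i : Qclosure (oapp l 1 (unlift (@ord0 n) i)).
    by case: unliftP => [i' _|_] /=; [exact: lk|exact: Qclosure1].
  have s1 : \sum_i oapp l 1 (unlift ord0 i) * b i = 0.
    rewrite big_ord_recl unlift_none/= mul1r -[RHS]l0; congr (_ + _).
    by apply: eq_bigr => i _; rewrite liftK.
  by have := indep _ k1 s1 ord0; rewrite unlift_none/= => /eqP; rewrite oner_eq0.
have c0B (c : 'I_n.+1 -> K) : (forall j, Qclosure (c j)) ->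
    absv (c ord0) <= d^-1 * absv (\sum_j c j * b j).
  move=> ck; have [c0|c0] := eqVneq (c ord0) 0.
    by rewrite c0 absv0 mulr_ge0// invr_ge0 ltW.
  have := Hd (fun j => c (lift ord0 j) / c ord0) (fun j => QclosureM (ck _) (QclosureV (ck _))).
  rewrite mulrC ler_pdivlMr// => h.
  rewrite big_ord_recl.
  have -> : c ord0 * b ord0 + \sum_(i < n) c (lift ord0 i) * b (lift ord0 i) =
     c ord0 * (b ord0 + S (fun j => c (lift ord0 j) / c ord0)).
    rewrite mulrDr /S mulr_sumr; congr (_ + _); apply: eq_bigr => i _.
    by rewrite mulrA mulrCA divff// mulr1.
  by rewrite absvM ler_wpM2l.
exists (d^-1 + C * (1 + d^-1 * absv (b ord0))).
  have di0 : 0 <= d^-1 by rewrite invr_ge0 ltW.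
  by rewrite addr_ge0// mulr_ge0// addr_ge0// mulr_ge0.
move=> c ck j; have h0 := c0B c ck; move: h0; set s := absv (\sum_j _ * _) => h0.
have s0 : 0 <= s := absv_ge0 _.
have di0 : 0 <= d^-1 by rewrite invr_ge0 ltW.
case: (unliftP ord0 j) => [i ->|->]; last first.
  by apply: (le_trans h0); rewrite ler_wpM2r// lerDl mulr_ge0 ?addr_ge0 ?mulr_ge0.
have h := HC (fun j => c (lift ord0 j)) (fun j => ck _) i.
apply: (le_trans h).
have -> : \sum_j0 c (lift ord0 j0) * b' j0 = \sum_j c j * b j - c ord0 * b ord0.
  by rewrite [X in _ = X - _]big_ord_recl addrAC subrr add0r.
have := absvB_le (\sum_j c j * b j) (c ord0 * b ord0); rewrite absvM -/s => h2.
have h3 : absv (c ord0) * absv (b ord0) <= d^-1 * s * absv (b ord0) by rewrite ler_wpM2r.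
have h4 := ler_wpM2l C0 (le_trans h2 (lerD (lexx s) h3)).
apply: (le_trans h4); rewrite mulrDl.
have -> : C * (s + d^-1 * s * absv (b ord0)) = C * (1 + d^-1 * absv (b ord0)) * s by ring.
by rewrite lerDr mulr_ge0.
Qed.

End RationalSubfield.

Section Trace.
Variables (R : realType) (K : completeValuedFieldType R).
Variable phi : {rmorphism rat -> K}.
Implicit Types (x y t : K) (e : R).

Definition Qmx m n (A : 'M[K]_(m, n)) := forall i j, Qclosure (A i j).

Lemma Qmx_mul m n p (A : 'M[K]_(m, n)) (B : 'M[K]_(n, p)) :
  Qmx A -> Qmx B -> Qmx (A *m B).
Proof.
move=> HA HB i j; rewrite mxE; apply: (Qclosure_sum phi) => k _.
exact: (QclosureM phi).
Qed.

Lemma Qmx1 n : Qmx (1%:M : 'M[K]_n).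
Proof.
by move=> i j; rewrite mxE; case: (i == j); [exact: Qclosure1 phi|exact: Qclosure0 phi].
Qed.

Lemma Qbasis_mx_inj n (b : 'I_n -> K) m (A B : 'M[K]_(m, n)) :
  Qbasis b -> Qmx A -> Qmx B ->
  (forall i, \sum_j A i j * b j = \sum_j B i j * b j) -> A = B.
Proof.
move=> bb HA HB AB; apply/row_matrixP => i.
have [c [_ cu]] := bb (\sum_j A i j * b j).
transitivity c; [symmetry|]; apply: cu; split.
- by move=> j; rewrite mxE.
- by apply: eq_bigr => j _; rewrite mxE.
- by move=> j; rewrite mxE.
- by rewrite AB; apply: eq_bigr => j _; rewrite mxE.
Qed.

Lemma Qbasis_mx n (b : 'I_n -> K) m (v : 'I_m -> K) : Qbasis b ->
  exists2 A : 'M[K]_(m, n), Qmx A & forall i, v i = \sum_j A i j * b j.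
Proof.
move=> bb; have /choice[c Hc] i : exists c : 'rV[K]_n,
    (forall j, Qclosure (c 0 j)) /\ v i = \sum_(j < n) c 0 j * b j.
  by have [c [? _]] := bb (v i); exists c.
exists (\matrix_(i, j) c i 0 j) => [i j|i]; first by rewrite mxE; exact: (Hc i).1.
by rewrite {1}(Hc i).2; apply: eq_bigr => j _; rewrite mxE.
Qed.

Lemma mulmx_basis m n p (A : 'M[K]_(m, n)) (B : 'M[K]_(n, p)) (b : 'I_p -> K) i :
  \sum_j (A *m B) i j * b j = \sum_k A i k * (\sum_j B k j * b j).
Proof.
under eq_bigr do rewrite mxE mulr_suml.
rewrite exchange_big/=; apply: eq_bigr => k _; rewrite mulr_sumr.
by apply: eq_bigr => j _; rewrite mulrA.
Qed.

Lemma is_trace_uniq x t t' : is_trace x t -> is_trace x t' -> t = t'.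
Proof.
move=> [n [b [A [bb HA Ab ->]]]] [n' [b' [A' [bb' HA' Ab' ->]]]].
have [P HP Pb] := Qbasis_mx b bb'; have [Q HQ Qb] := Qbasis_mx b' bb.
have PQ : P *m Q = 1%:M.
  apply: (Qbasis_mx_inj bb); [exact: Qmx_mul|exact: Qmx1|move=> i].
  rewrite mulmx_basis; under eq_bigr do rewrite -Qb; rewrite -Pb.
  rewrite (bigD1 i)//= mxE eqxx mul1r big1 ?addr0// => j ji.
  by rewrite mxE eq_sym (negbTE ji) mul0r.
have -> : A' = Q *m A *m P.
  apply: (Qbasis_mx_inj bb') => // [|i]; first by do 2 apply: Qmx_mul => //.
  rewrite -Ab' mulmx_basis; under [RHS]eq_bigr do rewrite -Pb.
  by rewrite mulmx_basis; under [RHS]eq_bigr do rewrite -Ab mulrCA; rewrite -mulr_sumr -Qb.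
by rewrite -mulmxA mxtrace_mulC -mulmxA PQ mulmx1.
Qed.

Lemma traceE n (b : 'I_n -> K) (A : 'M[K]_n) x : Qbasis b -> Qmx A ->
  (forall i, x * b i = \sum_j A i j * b j) -> trace x = \tr A.
Proof.
move=> bb HA Ab; have xA : is_trace x (\tr A) by exists n, b, A.
by apply: (is_trace_uniq _ xA); apply: (@xgetPex _ 0 [set t | is_trace x t]); exists (\tr A).
Qed.

Lemma trace_no_basis x : ~ (exists n (b : 'I_n -> K), Qbasis b) -> trace x = 0.
Proof.
by move=> H; rewrite /trace; case: xgetP => [t _ [n [b [A [bb _ _ _]]]]|//]; case: H; exists n, b.
Qed.

Lemma traceD x y : trace (x + y) = trace x + trace y.
Proof.
have [[n [b bb]]|nb] := pselect (exists n (b : 'I_n -> K), Qbasis b); last first.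
  by rewrite !trace_no_basis// addr0.
have [A HA Ab] := Qbasis_mx (fun i => x * b i) bb.
have [B HB Bb] := Qbasis_mx (fun i => y * b i) bb.
rewrite (traceE bb HA Ab) (traceE bb HB Bb) -mxtraceD.
apply: (traceE bb) => [i j|i]; first by rewrite mxE; exact: (QclosureD phi).
by rewrite mulrDl Ab Bb -big_split/=; apply: eq_bigr => j _; rewrite mxE mulrDl.
Qed.

Lemma trace_Qclosure x : Qclosure (trace x).
Proof.
have [[n [b bb]]|nb] := pselect (exists n (b : 'I_n -> K), Qbasis b); last first.
  by rewrite trace_no_basis//; exact: Qclosure0.
have [A HA Ab] := Qbasis_mx (fun i => x * b i) bb.
by rewrite (traceE bb HA Ab); apply: (Qclosure_sum phi).
Qed.

Lemma Qbasis_coord_bound n (b : 'I_n -> K) : Qbasis b ->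
  exists2 C : R, 0 <= C & forall c : 'I_n -> K, (forall j, Qclosure (c j)) ->
     forall j, absv (c j) <= C * absv (\sum_j c j * b j).
Proof.
move=> bb; apply: (coord_bound phi) => c ck c0 j.
have : (\row_i c i) = 0 :> 'rV_n.
  apply: (Qbasis_mx_inj bb) => [i k|i k|i]; rewrite ?mxE//; first exact: Qclosure0.
  rewrite [RHS]big1 => [|k _]; last by rewrite mxE mul0r.
  by rewrite -[RHS]c0; apply: eq_bigr => k _; rewrite mxE.
by move=> /rowP/(_ j); rewrite !mxE.
Qed.

Lemma trace_bound : exists2 C : R, 0 <= C & forall x, absv (trace x) <= C * absv x.
Proof.
have [[n [b bb]]|nb] := pselect (exists n (b : 'I_n -> K), Qbasis b); last first.
  by exists 0 => // x; rewrite trace_no_basis// absv0 mul0r.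
have [C C0 HC] := Qbasis_coord_bound bb.
exists (\sum_i C * absv (b i)) => [|x]; first by apply: sumr_ge0 => i _; rewrite mulr_ge0.
have [A HA Ab] := Qbasis_mx (fun i => x * b i) bb.
rewrite (traceE bb HA Ab); apply: (le_trans (absv_sum _ _ _)).
rewrite mulr_suml; apply: ler_sum => i _; apply: (le_trans (HC (A i) (HA i) i)).
by rewrite -Ab absvM [absv x * _]mulrC mulrA.
Qed.

End Trace.

Section RealGraph.
Variables (R : realType) (K : completeValuedFieldType R).
Variable phi : {rmorphism rat -> K}.
Hypothesis arch : archimedean K.
Implicit Types (t : K) (r e : R) (q : rat).

Lemma absv_ratr_lt e : 0 < e -> exists2 d, 0 < d &
  forall q, `|ratr q : R| < d -> absv (phi q) < e.
Proof.
move=> e0; have [a a0 Ha] := absv_ratr_powR phi arch.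
exists (e `^ a^-1) => [|q qd]; first exact: powR_gt0.
rewrite Ha -[e]powRr1 ?(ltW e0)// -[1](mulVf (lt0r_neq0 a0)) powRrM.
by apply: gt0_ltr_powR; rewrite ?nnegrE ?powR_ge0.
Qed.

Lemma ratr_le_absv q : absv (phi q) <= 1 -> `|ratr q : R| <= absv (phi q).
Proof.
have [a a0 Ha] := absv_ratr_powR phi arch.
have a1 : a <= 1.
  have := absv_nat K 2; rewrite -(rmorph_nat phi) Ha ratr_nat normr_nat -{2}(@powRr1 _ 2%:R)//.
  rewrite leNgt => h; rewrite leNgt; apply: contra h => h.
  by rewrite /powR pnatr_eq0/= ltr_expR ltr_pM2r// ln_gt0// ltr1n.
have [->|q0] := eqVneq q 0; first by rewrite !rmorph0 absv0 normr0.
have r0 : 0 < `|ratr q : R| by rewrite normr_gt0 fmorph_eq0.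
rewrite Ha => h; have [r1|r1] := leP `|ratr q : R| 1.
  by apply: ger1_powR => //; rewrite r0.
by have := gt0_ltr_powR a0 _ _ r1; rewrite powR1 ltNge h !nnegrE ler01 (ltW r0) => /(_ isT isT).
Qed.

Lemma real_graphP t r : real_graph (t, r) <->
  forall e, 0 < e -> exists q, absv (phi q - t) < e /\ `|ratr q - r| < e.
Proof.
split=> [H e e0|H B].
  have [|_ [[q _ <-] /= [h1 h2]]] := H ([set y | absv (y - t) < e] `*` [set s | `|s - r| < e]).
    exists ([set y | absv (y - t) < e], [set s | `|s - r| < e]) => //.
    split; first exact: near_absv.
    by apply/nbhs_ballP; exists e => //= s; rewrite /ball/= distrC.
  by exists q; rewrite -(ratr_rmorph phi).
move=> [[A1 A2] /= [/nbhs_absvP[e1 e10 H1] /nbhs_ballP[e2 e20 H2]] AB].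
have e0 : 0 < Num.min e1 e2 by rewrite lt_min e10.
have [q []] := H _ e0; rewrite !lt_min => /andP[h1 _] /andP[_ h2].
exists (ratr q : K, ratr q : R); split; first by exists q.
apply: AB; split => /=; first by apply: H1; rewrite (ratr_rmorph phi).
by apply: H2; rewrite /ball/= distrC.
Qed.

Lemma real_graphD t r t' r' : real_graph (t, r) -> real_graph (t', r') ->
  real_graph (t + t', r + r').
Proof.
move=> /real_graphP H /real_graphP H'; apply/real_graphP => e e0.
have e2 : 0 < e / 2 by rewrite divr_gt0.
have [q [h1 h2]] := H _ e2; have [q' [h3 h4]] := H' _ e2; exists (q + q').
rewrite !rmorphD.
have -> : phi q + phi q' - (t + t') = (phi q - t) + (phi q' - t') by ring.
have -> : ratr q + ratr q' - (r + r') = (ratr q - r) + (ratr q' - r') :> R by ring.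
split.
  by apply: (le_lt_trans (absvD_le _ _)); lra.
by apply: (le_lt_trans (ler_normD _ _)); lra.
Qed.

Lemma real_graphN t r : real_graph (t, r) -> real_graph (- t, - r).
Proof.
move=> /real_graphP H; apply/real_graphP => e /H[q [h1 h2]]; exists (- q).
by rewrite !rmorphN -!opprD absvN normrN.
Qed.

Lemma real_graph_le t r : real_graph (t, r) -> absv t < 1 -> `|r| <= absv t.
Proof.
move=> /real_graphP H t1; apply/ler_addgt0Pr => e e0.
set d := Num.min (1 - absv t) (e / 2).
have d0 : 0 < d by rewrite /d lt_min subr_gt0 t1 divr_gt0.
have d1 : d <= 1 - absv t by rewrite /d ge_min lexx.
have d2 : d <= e / 2 by rewrite /d ge_min lexx orbT.
have [q [h1 h2]] := H _ d0.
have := absvD_le (phi q - t) t; rewrite subrK => h3.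
have : absv (phi q) <= 1 by lra.
move=> /ratr_le_absv h4; have := ler_normB (ratr q) (ratr q - r).
by rewrite opprB addrCA subrr addr0; lra.
Qed.

Lemma real_graph_le1 t r : real_graph (t, r) -> `|r| < 1 -> absv t <= 1.
Proof.
move=> /real_graphP H r1; apply/ler_addgt0Pr => e e0.
set d := Num.min (1 - `|r|) e.
have d0 : 0 < d by rewrite /d lt_min subr_gt0 r1.
have d1 : d <= 1 - `|r| by rewrite /d ge_min lexx.
have d2 : d <= e by rewrite /d ge_min lexx orbT.
have [q [h1 h2]] := H _ d0.
have := ler_normD (ratr q - r) r; rewrite subrK => h3.
have : `|q| <= 1 by rewrite -(ler_rat R) ratr_norm rmorph1; lra.
move=> /(absv_ratr_le1 phi arch) h4; have := absvB_le (phi q) (phi q - t).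
by rewrite opprB addrCA subrr addr0; lra.
Qed.

Lemma real_graph_inj t r r' : real_graph (t, r) -> real_graph (t, r') -> r = r'.
Proof.
move=> h /real_graphN/(real_graphD h) H; apply/eqP; rewrite -subr_eq0 -normr_eq0.
rewrite subrr in H; have := real_graph_le H; rewrite absv0 ltr01 => /(_ isT).
by rewrite normr_le0 normr_eq0.
Qed.

Lemma real_graph_fun t t' r : real_graph (t, r) -> real_graph (t', r) -> t = t'.
Proof.
move=> h /real_graphN/(real_graphD h)/real_graphP H; apply/eqP.
rewrite -subr_eq0 -absv_eq0; apply/negPn/negP => t0.
have e0 : 0 < absv (t - t') / 2 by rewrite divr_gt0// lt_def t0/=.
have [d d0 Hd] := absv_ratr_lt e0.
have m0 : 0 < Num.min d (absv (t - t') / 2) by rewrite lt_min d0.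
have [q [h1 h2]] := H _ m0; rewrite subrr subr0 lt_min in h2.
move: h1; rewrite lt_min => /andP[_ h1].
have {h2} /andP[/Hd h2 _] := h2.
by have := absvB_le (phi q) (phi q - (t - t')); rewrite opprB addrCA subrr addr0; lra.
Qed.

Lemma inv_small e : 0 < e -> exists N, forall m, (N <= m)%N -> m.+1%:R^-1 < e.
Proof.
move=> e0; exists (Num.bound e^-1) => m Nm; rewrite -[e]invrK ltf_pV2 ?posrE ?invr_gt0//.
by apply: (lt_le_trans (archi_boundP (ltW _))); rewrite ?invr_gt0// ler_nat leqW.
Qed.

Lemma cauchy_seq_real (u : nat -> R) :
  (forall e, 0 < e -> exists N, forall m n, (N <= m)%N -> (N <= n)%N ->
     `|u m - u n| < e) ->
  exists l, forall e, 0 < e -> exists N, forall n, (N <= n)%N -> `|u n - l| < e.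
Proof.
move=> uC; have : cvg (u @ \oo).
  apply: cauchy_cvg; apply/cauchyP => e e0; have [N HN] := uC e e0.
  exists (u N); exists N => // n Nn; rewrite /= /ball/=; exact: HN.
move=> ul; exists (lim (u @ \oo)) => e e0.
move/cvgrPdist_lt : ul => /(_ e e0)[N _ HN]; exists N => n Nn.
by rewrite distrC; exact: HN.
Qed.

Lemma real_graph_of_Qclosure t : Qclosure t -> exists r, real_graph (t, r).
Proof.
move=> /(QclosureP phi) H.
have /choice[q Hq] (n : nat) : exists q, absv (phi q - t) < n.+1%:R^-1.
  by apply: H; rewrite invr_gt0.
have [|r Hr] := @cauchy_seq_real (fun n => ratr (q n)).
  move=> e e0; set d := Num.min 1 (e / 2).
  have d0 : 0 < d / 2 by rewrite divr_gt0// lt_min ltr01 divr_gt0.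
  have d1 : d <= 1 by rewrite /d ge_min lexx.
  have d2 : d <= e / 2 by rewrite /d ge_min lexx orbT.
  have [N HN] := inv_small d0; exists N => m n Nm Nn; rewrite -rmorphB.
  have h : absv (phi (q m - q n)) < d.
    rewrite rmorphB; have := absvB_le (phi (q m) - t) (phi (q n) - t).
    rewrite opprB addrA subrK => h; apply: (le_lt_trans h).
    rewrite [d]splitr ltrD//; first exact: lt_trans (Hq m) (HN _ Nm).
    exact: lt_trans (Hq n) (HN _ Nn).
  have := ratr_le_absv (ltW (lt_le_trans h d1)) => h2.
  by apply: (le_lt_trans h2); lra.
exists r; apply/real_graphP => e e0.
have [N1 HN1] := Hr _ e0; have [N2 HN2] := inv_small e0.
exists (q (maxn N1 N2)); split; last by apply: HN1; exact: leq_maxl.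
by apply: (lt_trans (Hq _)); apply: HN2; exact: leq_maxr.
Qed.

Lemma real_graph_total r : exists t, real_graph (t, r).
Proof.
have /choice[q Hq] (n : nat) : exists q, `|ratr q - r| < n.+1%:R^-1.
  have n0 : 0 < n.+1%:R^-1 :> R by rewrite invr_gt0.
  move: n0; set d := _^-1 => n0.
  have [|q] := @rat_in_itvoo R (r - d) (r + d); first by lra.
  by rewrite in_itv/= => /andP[h1 h2]; exists q; rewrite ltr_norml; apply/andP; split; lra.
have [|t Ht] := @cauchy_seq_absv _ K (fun n => phi (q n)).
  move=> e /absv_ratr_lt[d d0 Hd].
  have [|N HN] := @inv_small (d / 2); first by rewrite divr_gt0.
  exists N => m n Nm Nn; rewrite -rmorphB; apply: Hd; rewrite rmorphB.
  have := ler_normB (ratr (q m) - r) (ratr (q n) - r); rewrite opprB addrA subrK => h.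
  apply: (le_lt_trans h).
  rewrite [d]splitr ltrD//; first exact: lt_trans (Hq m) (HN _ Nm).
  exact: lt_trans (Hq n) (HN _ Nn).
exists t; apply/real_graphP => e e0.
have [N1 HN1] := Ht _ e0; have [N2 HN2] := inv_small e0.
exists (q (maxn N1 N2)); split; first by apply: HN1; exact: leq_maxl.
by apply: (lt_trans (Hq _)); apply: HN2; exact: leq_maxr.
Qed.

Lemma real_graph_real_of t : Qclosure t -> real_graph (t, real_of t).
Proof.
by move=> /real_graph_of_Qclosure; apply: (@xgetPex _ 0 [set r | real_graph (t, r)]).
Qed.

Lemma real_graph_of_real r : real_graph (of_real K r, r).
Proof. exact: (@xgetPex _ 0 [set t | real_graph (t, r)] (real_graph_total r)). Qed.

Lemma real_ofD t t' : Qclosure t -> Qclosure t' ->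
  real_of (t + t') = real_of t + real_of t'.
Proof.
move=> ht ht'; apply: (@real_graph_inj (t + t')).
  by apply: real_graph_real_of; exact: (QclosureD phi).
by apply: real_graphD; exact: real_graph_real_of.
Qed.

Lemma of_realD r r' : of_real K (r + r') = of_real K r + of_real K r'.
Proof.
apply: (@real_graph_fun _ _ (r + r')); first exact: real_graph_of_real.
by apply: real_graphD; exact: real_graph_of_real.
Qed.

Lemma of_real0 : of_real K 0 = 0.
Proof. by apply: (addrI (of_real K 0)); rewrite -of_realD !addr0. Qed.

Lemma real_ofK t : Qclosure t -> of_real K (real_of t) = t.
Proof.
by move=> ht; apply: (@real_graph_fun _ _ (real_of t)); [exact: real_graph_of_real|exact: real_graph_real_of].
Qed.

Lemma real_of_le t : Qclosure t -> absv t < 1 -> `|real_of t| <= absv t.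
Proof. by move=> ht; apply: real_graph_le; exact: real_graph_real_of. Qed.

Lemma of_real_le1 r : `|r| < 1 -> absv (of_real K r) <= 1.
Proof. by apply: real_graph_le1; exact: real_graph_of_real. Qed.

End RealGraph.

Section PolarPart.
Variables (R : realType) (K : completeValuedFieldType R).
Variable phi : {rmorphism rat -> K}.
Hypothesis narch : ~ archimedean K.
Implicit Types (a x y t : K) (e : R) (q r : rat).

Lemma absv_int_le1 (m : int) : absv (m%:~R : K) <= 1.
Proof.
rewrite absv_intr leNgt; apply/negP => h; apply: narch; eexists; exact: h.
Qed.

Lemma absv_nat_le1 (m : nat) : absv (m%:R : K) <= 1.
Proof. exact: (absv_int_le1 m). Qed.

Definition polar_spec a r := exists p n m : nat,
  [/\ prime p, absv (p%:R : K) < 1, (m < p ^ n)%N,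
      r = m%:R / (p ^ n)%:R & absv (a - ratr r) <= 1].

Lemma polar_partE a : polar_part a = xget 0 [set r | polar_spec a r].
Proof. by []. Qed.

Lemma absv_coprime (p m : nat) : (0 < p)%N -> absv (p%:R : K) < 1 -> coprime p m ->
  absv (m%:R : K) = 1.
Proof.
move=> p0 p1 /eqP pm; apply/eqP; rewrite eq_le absv_nat_le1 leNgt; apply/negP => m1.
have [a _] := Bezoutl m p0; rewrite pm => /dvdnP[b ab].
have : (1 : K) = b%:R * p%:R - a%:R * m%:R.
  by rewrite -!natrM -ab natrD addrK.
move=> /(congr1 absv); rewrite absv1 => e1.
have := absv_ultrametric narch (b%:R * p%:R) (- (a%:R * m%:R)).
rewrite -e1 absvN !absvM le_max => /orP[]; rewrite leNgt => /negP; apply.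
  by apply: le_lt_trans p1; rewrite ler_piMl// absv_nat_le1.
by apply: le_lt_trans m1; rewrite ler_piMl// absv_nat_le1.
Qed.

Lemma prime_absv_uniq p p' : prime p -> prime p' ->
  absv (p%:R : K) < 1 -> absv (p'%:R : K) < 1 -> p = p'.
Proof.
move=> pp pp' p1 p1'; apply/eqP/negPn/negP => ne.
have : coprime p p' by rewrite prime_coprime// dvdn_prime2.
by move=> /(absv_coprime (prime_gt0 pp) p1) => e; rewrite e ltxx in p1'.
Qed.

Lemma padic_integer (p k : nat) (M : int) : prime p -> absv (p%:R : K) < 1 ->
  absv (M%:~R / (p ^ k)%:R : K) <= 1 -> exists z : int, M = z * (p ^ k)%N%:Z.
Proof.
move=> pp p1; rewrite absvM absv_intr absvV natrX absvX => h.
have p0 : 0 < absv (p%:R : K) by rewrite absv_gt0 (natr_neq0 phi) -lt0n prime_gt0.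
have [M0|M0] := posnP `|M|%N.
  by exists 0; rewrite mul0r; apply/eqP; rewrite -absz_eq0 M0.
have [m' cm Mm'] := pfactor_coprime pp M0; set j := logn p _ in Mm'.
suff kj : (k <= j)%N.
  have /dvdnP[z Mz] : (p ^ k %| `|M|)%N.
    by rewrite Mm' dvdn_mull// dvdn_exp2l.
  exists ((-1) ^+ (M < 0)%R * z%:Z); rewrite -mulrA -PoszM -Mz; exact: intEsign.
rewrite leqNgt; apply/negP => jk; move: h; rewrite Mm' natrM natrX absvM absvX.
rewrite (absv_coprime (prime_gt0 pp) p1 cm) mul1r ler_pdivrMr ?exprn_gt0// mul1r.
by rewrite leNgt => /negP; apply; rewrite ltr_iXn2l.
Qed.

Lemma padic_rat_int (p k : nat) (M : int) : prime p -> absv (p%:R : K) < 1 ->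
  absv (phi (M%:~R / (p ^ k)%:R)) <= 1 -> exists z : int, M%:~R / (p ^ k)%:R = z%:~R :> rat.
Proof.
move=> pp p1; rewrite fmorph_div rmorph_int rmorph_nat => /(padic_integer pp p1)[z ->].
exists z; rewrite intrM mulfK// -[_%:~R]/((p ^ k)%:R) pnatr_eq0 -lt0n expn_gt0.
by rewrite prime_gt0.
Qed.

Lemma polar_spec_add a b r1 r2 r3 : polar_spec a r1 -> polar_spec b r2 ->
  polar_spec (a + b) r3 -> exists z : int, r3 - r1 - r2 = z%:~R.
Proof.
move=> [p [n1 [m1 [pp p1 _ e1 h1]]]] [p2 [n2 [m2 [pp2 pl2 _ e2 h2]]]].
move=> [p3 [n3 [m3 [pp3 pl3 _ e3 h3]]]].
have ? := prime_absv_uniq pp2 pp pl2 p1; have ? := prime_absv_uniq pp3 pp pl3 p1; subst p2 p3.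
have pn0 n : (p ^ n)%:R != 0 :> rat by rewrite pnatr_eq0 -lt0n expn_gt0 prime_gt0.
set M : int := (m3 * p ^ n1 * p ^ n2)%N%:Z - (m1 * p ^ n3 * p ^ n2)%N%:Z - (m2 * p ^ n3 * p ^ n1)%N%:Z.
have e : r3 - r1 - r2 = M%:~R / (p ^ (n3 + n1 + n2))%:R.
  rewrite /M !rmorphB/= -!pmulrn !natrM e1 e2 e3 !expnD !natrM; field.
  by rewrite !pn0.
rewrite e; apply: padic_rat_int => //; rewrite -e.
have -> : phi (r3 - r1 - r2) = - (a + b - ratr r3) + ((a - ratr r1) + (b - ratr r2)).
  by rewrite !rmorphB/= !(ratr_rmorph phi); ring.
apply: (le_trans (absv_ultrametric narch _ _)); rewrite ge_max absvN h3/=.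
by apply: (le_trans (absv_ultrametric narch _ _)); rewrite ge_max h1.
Qed.

Lemma polar_spec_integer a r : polar_spec a r -> absv a <= 1 -> exists z : int, r = z%:~R.
Proof.
move=> [p [n [m [pp p1 _ e h]]]] a1; rewrite e; apply: (@padic_rat_int p n m) => //.
rewrite -[_ / _]e -(ratr_rmorph phi).
have -> : ratr r = a + - (a - ratr r) by rewrite opprB addrCA subrr addr0.
by apply: (le_trans (absv_ultrametric narch _ _)); rewrite ge_max absvN a1.
Qed.

Lemma polar_spec_ex (p : nat) a : prime p -> absv (p%:R : K) < 1 -> Qclosure a ->
  exists r, polar_spec a r.
Proof.
move=> pp p1 /(QclosureP phi)/(_ 1 ltr01)[q qa].
have p0 := prime_gt0 pp.
have d0 : (0 < `|denq q|)%N by rewrite absz_gt0 denq_neq0.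
have [v cv dv] := pfactor_coprime pp d0; set n := logn p _ in dv.
have pn0 : (0 < p ^ n)%N by rewrite expn_gt0 p0.
have v1 := absv_coprime p0 p1 cv.
have [c _] := Bezoutl v pn0.
have -> : gcdn (p ^ n) v = 1%N by apply/eqP; rewrite -/(coprime _ _) coprimeXl.
move=> /dvdnP[b cvb].
set u := numq q; set w : int := modz (- (c%:Z * u)) (p ^ n)%N%:Z.
have w0 : 0 <= w by rewrite modz_ge0// eqz_nat -lt0n.
have wp : w < (p ^ n)%N%:Z by rewrite ltz_pmod// ltz_nat.
have wm : (`|w|%N%:Z = w) by rewrite gez0_abs.
exists (`|w|%N%:R / (p ^ n)%:R); exists p, n, `|w|%N; split=> //.
  by rewrite -ltz_nat wm.
have [z uz] : exists z : int, u - w * v%:Z = z * (p ^ n)%N%:Z.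
  set Q : int := divz (- (c%:Z * u)) (p ^ n)%N%:Z.
  have : - (c%:Z * u) = Q * (p ^ n)%N%:Z + w := divz_eq _ _.
  move=> hw; exists (u * b%:Z + Q * v%:Z).
  have : 1 + c%:Z * v%:Z = b%:Z * (p ^ n)%N%:Z by rewrite -!PoszM -PoszD cvb.
  have -> : w = - (c%:Z * u) - Q * (p ^ n)%N%:Z by rewrite hw; ring.
  move=> hb; transitivity (u * (1 + c%:Z * v%:Z) + Q * (p ^ n)%N%:Z * v%:Z); first by ring.
  by rewrite hb; ring.
have pnr : (p ^ n)%:R != 0 :> rat by rewrite pnatr_eq0 -lt0n.
have vr : v%:R != 0 :> rat.
  by rewrite pnatr_eq0; apply/eqP => v0; rewrite v0 absv0 in v1; move/eqP: v1; rewrite eq_sym oner_eq0.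
have qE : q - `|w|%N%:R / (p ^ n)%:R = z%:~R / v%:R.
  have dE : denq q = (v * p ^ n)%N by rewrite -dv gez0_abs// denq_ge0.
  rewrite -[q in LHS](divq_num_den q) dE -/u.
  have -> : u = z * (p ^ n)%N%:Z + w * v%:Z by rewrite -uz; ring.
  rewrite PoszM !rmorphD !rmorphM/= -!pmulrn -wm -!pmulrn; field.
  by rewrite vr.
have -> : a - ratr (`|w|%N%:R / (p ^ n)%:R) = - (phi q - a) + phi (z%:~R / v%:R).
  by rewrite -qE rmorphB (ratr_rmorph phi); ring.
apply: (le_trans (absv_ultrametric narch _ _)); rewrite ge_max absvN ltW//=.
by rewrite fmorph_div rmorph_int rmorph_nat absvM absvV v1 divr1 absv_int_le1.
Qed.

Lemma expi_polarD a b : Qclosure a -> Qclosure b ->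
  expi (2 * pi * ratr (polar_part (a + b))) =
  expi (2 * pi * ratr (polar_part a)) * expi (2 * pi * ratr (polar_part b)) :> R[i].
Proof.
move=> ha hb; have [[p [pp p1]]|np] := pselect (exists p, prime p /\ absv (p%:R : K) < 1).
  have S (c : K) : Qclosure c -> polar_spec c (polar_part c).
    by move=> /(polar_spec_ex pp p1); apply: (@xgetPex _ 0 [set r | polar_spec c r]).
  have [z ez] := polar_spec_add (S _ ha) (S _ hb) (S _ (QclosureD phi ha hb)).
  have -> : polar_part (a + b) = polar_part a + polar_part b + z%:~R.
    by rewrite -ez; ring.
  rewrite !rmorphD rmorph_int.
  by rewrite [2 * pi * (_ + _ + _)]mulrDr [2 * pi * (_ + _)]mulrDr !expiD expi2pi_int mulr1.
have S (c : K) : polar_part c = 0.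
  rewrite polar_partE; case: xgetP => [r _ [p [n [m [pp p1 _ _ _]]]]|//].
  by case: np; exists p.
by rewrite !S rmorph0 mulr0 expi0 mulr1.
Qed.

Lemma expi_polar1 a : absv a <= 1 -> expi (2 * pi * ratr (polar_part a)) = 1 :> R[i].
Proof.
move=> a1; rewrite polar_partE; case: xgetP => [r _ /polar_spec_integer/(_ a1)[z ->]|_].
  by rewrite ratr_int expi2pi_int.
by rewrite rmorph0 mulr0 expi0.
Qed.

End PolarPart.

Section Addchar.
Variables (R : realType) (K : completeValuedFieldType R).
Variable phi : {rmorphism rat -> K}.
Implicit Types (x y t : K) (e : R).

Lemma addcharD x y : addchar (x + y) = addchar x * addchar y.
Proof.
rewrite /addchar (traceD phi); have hx := @trace_Qclosure _ _ phi x; have hy := @trace_Qclosure _ _ phi y.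
case: asboolP => arch; last exact: (expi_polarD phi).
by rewrite (real_ofD phi arch hx hy) mulrDr opprD expiD.
Qed.

Lemma cn_addchar x : cn (addchar x) = 1.
Proof. by rewrite /addchar; case: asboolP => _; rewrite cn_expi. Qed.

Lemma addchar_neq0 x : addchar x != 0.
Proof. by rewrite -cn_eq0 cn_addchar oner_neq0. Qed.

Lemma addchar0 : addchar (0 : K) = 1.
Proof.
by apply: (mulfI (addchar_neq0 0)); rewrite -addcharD addr0 mulr1.
Qed.

Lemma addchar_lip : exists2 C : R, 0 < C & forall x, cn (addchar x - 1) <= C * absv x.
Proof.
have [C C0 HC] := trace_bound phi.
have pi4 : 0 < 4 * pi :> R by rewrite mulr_gt0// pi_gt0.
exists (4 * pi * C + 2 * C + 1) => [|x].
  by rewrite ltr_wpDl// addr_ge0// mulr_ge0// ltW.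
have l2 : cn (addchar x - 1) <= 2.
  by apply: (le_trans (cnB _ _)); rewrite cn_addchar cn1.
have CxE : 0 <= C * absv x by rewrite mulr_ge0.
have [Cx|Cx] := ltP (C * absv x) 1; last first.
  apply: (le_trans l2); rewrite !mulrDl -!mulrA mul1r.
  by have := mulr_ge0 (ltW pi4) CxE; have := absv_ge0 x; rewrite -!mulrA; nra.
have tx : absv (trace x) < 1 by apply: le_lt_trans (HC x) Cx.
have hx := @trace_Qclosure _ _ phi x.
rewrite /addchar; case: asboolP => arch.
  apply: (le_trans (expiB1_le _)); rewrite normrN !normrM (gtr0_norm (pi_gt0 R)) normr_nat.
  have := real_of_le phi arch hx tx => h.
  have h2 := le_trans h (HC x).
  have := ler_wpM2l (ltW pi4) h2 => h3.
  have -> : 2 * (2 * pi * `|real_of (trace x)|) = 4 * pi * `|real_of (trace x)| by ring.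
  apply: (le_trans h3); rewrite -subr_ge0.
  have -> : (4 * pi * C + 2 * C + 1) * absv x - 4 * pi * (C * absv x) =
    2 * (C * absv x) + absv x by ring.
  by rewrite addr_ge0// mulr_ge0.
rewrite (expi_polar1 phi arch (ltW tx)) subrr cn0 mulr_ge0//.
by rewrite !addr_ge0// mulr_ge0// ltW.
Qed.

Lemma addchar_dist : exists2 C : R, 0 < C &
  forall x y, cn (addchar x - addchar y) <= C * absv (x - y).
Proof.
have [C C0 HC] := addchar_lip; exists C => // x y.
have -> : addchar x - addchar y = addchar y * (addchar (x - y) - 1).
  by rewrite mulrBr -addcharD mulr1 addrCA subrr addr0.
by rewrite cnM cn_addchar mul1r.
Qed.

Lemma real_of0 : archimedean K -> real_of (0 : K) = 0.
Proof.
move=> arch; have h0 := @Qclosure0 _ _ phi.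
have := real_ofD phi arch h0 h0; rewrite addr0 => /(congr1 (fun z => z - real_of (0 : K))).
by rewrite subrr addrK => <-.
Qed.

Lemma addchar_arch_basis x : archimedean K -> addchar x != 1 ->
  exists n (b : 'I_n -> K), Qbasis b.
Proof.
move=> arch lx; apply: contrapT => nb; move: lx; rewrite /addchar; case: asboolP => // _.
by rewrite trace_no_basis// real_of0// mulr0 oppr0 expi0 eqxx.
Qed.

End Addchar.

(** * Schwartz-Bruhat functions *)

Section ComplexLimits.
Variable R : realType.
Context {T : Type} {F : set_system T} {FF : ProperFilter F}.

Lemma ccvgM (f g : T -> R[i]) (a b : R[i]) : f @ F --> a -> g @ F --> b ->
  (fun x => f x * g x) @ F --> a * b.
Proof. exact: cvgM. Qed.

Lemma ccvgD (f g : T -> R[i]) (a b : R[i]) : f @ F --> a -> g @ F --> b ->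
  (fun x => f x + g x) @ F --> a + b.
Proof. exact: cvgD. Qed.

Lemma ccvg_cst (a : R[i]) : (fun _ : T => a) @ F --> a.
Proof. exact: cvg_cst. Qed.

Lemma ccvg_lim (f : T -> R[i]) (l : R[i]) : f @ F --> l -> lim (f @ F) = l.
Proof. exact: cvg_lim. Qed.

End ComplexLimits.

Section ComplexMVT.
Variable R : realType.

Lemma cplx_mvt (g g' : R -> R[i]) (a b m : R) : a <= b ->
  (forall u, a <= u <= b -> (t^-1)%:C * (g (u + t) - g u) @[t --> 0^'] --> g' u) ->
  (forall u, a <= u <= b -> cn (g' u) <= m) ->
  cn (g b - g a) <= 2 * m * (b - a).
Proof.
move=> ab dg gm.
have main (p : R[i] -> R) (c : R) : 
    (forall z w, p (z + w) = p z + p w) -> (forall z, `|p z| <= cn z) ->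
    (forall (r : R) z, p (r%:C * z) = r * p z) ->
    `|p (g b) - p (g a)| <= m * (b - a).
  move=> pD pc pM.
  have pN z : p (- z) = - p z.
    apply: (addrI (p z)); rewrite -pD !subrr.
    by apply: (addrI (p 0)); rewrite -pD !addr0.
  have dp u : a <= u <= b -> is_derive (u : R) 1 (p \o g) (p (g' u)).
    move=> uab.
    have cv : (fun h : R => h^-1 *: ((p \o g) (h *: 1 + u) - (p \o g) u)) @ 0^' --> p (g' u).
      have /cvg_cnP H := dg u uab; apply/cvgrPdist_lt => e /H.
      apply: filterS => t /= h; rewrite distrC; apply: le_lt_trans h.
      rewrite [t *: 1](_ : _ = t); last by rewrite /GRing.scale/= mulr1.
      rewrite (addrC t u) /GRing.scale/=.
      apply: le_trans (pc _); rewrite pD pN pM pD pN//.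
    apply: DeriveDef; first by apply/cvg_ex; exists (p (g' u)).
    exact: cvg_lim cv.
  have [||c' c'ab ->] := @MVT_segment R (p \o g) (p \o g') a b ab.
  - by move=> x; rewrite in_itv/= => /andP[ax xb]; apply: dp; rewrite !ltW.
  - apply: derivable_within_continuous => x; rewrite in_itv/= => xab.
    by case: (dp x xab).
  - rewrite normrM [`|b - a|]ger0_norm ?subr_ge0// ler_wpM2r ?subr_ge0//.
    by apply: (le_trans (pc _)); apply: gm; move: c'ab; rewrite in_itv.
have h1 := main (@complex.Re R) 0 _ (@cn_Re R) _.
have h2 := main (@complex.Im R) 0 _ (@cn_Im R) _.
apply: (le_trans (cn_le _)).
rewrite -mulrA mulr_natl mulr2n lerD//.
  have -> : complex.Re (g b - g a) = complex.Re (g b) - complex.Re (g a) by case: (g b); case: (g a).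
  by apply: h1 => [[? ?] [? ?]|r [? ?]] //=; rewrite mul0r subr0.
have -> : complex.Im (g b - g a) = complex.Im (g b) - complex.Im (g a) by case: (g b); case: (g a).
by apply: h2 => [[? ?] [? ?]|r [? ?]] //=; rewrite mul0r addr0.
Qed.

End ComplexMVT.

Section SchwartzBruhat.
Variables (R : realType) (K : completeValuedFieldType R).
Variable phi : {rmorphism rat -> K}.
Implicit Types (x y h a b : K) (t e : R) (f g : K -> R[i]).

Definition Delta h f x := f (x + h) - f x.

Definition decays f := forall M : nat, exists2 C : R, 0 <= C &
  forall x, (1 + absv x) ^+ M * cn (f x) <= C.

Definition diff_decays f := forall N M : nat, exists2 C : R, 0 <= C &
  forall h x, absv h <= 1 -> (1 + absv x) ^+ M * cn (iter N (Delta h) f x) <= C * absv h ^+ N.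

Lemma absv1_ge1 x : 1 <= 1 + absv x. Proof. by rewrite lerDl. Qed.
Lemma absv1_gt0 x : 0 < 1 + absv x. Proof. exact: lt_le_trans (absv1_ge1 x). Qed.
Lemma absv1X_gt0 x M : 0 < (1 + absv x) ^+ M. Proof. by rewrite exprn_gt0// absv1_gt0. Qed.

Lemma absv1_peetre x y : 1 + absv x <= (1 + absv (x - y)) * (1 + absv y).
Proof.
have := absvD_le (x - y) y; rewrite subrK.
by have := mulr_ge0 (absv_ge0 (x - y)) (absv_ge0 y); rewrite mulrDl mul1r mulrDr mulr1; lra.
Qed.

Lemma absv1X_peetre x y M :
  (1 + absv x) ^+ M <= (1 + absv (x - y)) ^+ M * (1 + absv y) ^+ M.
Proof.
rewrite -exprMn lerXn2r ?nnegrE ?(ltW (absv1_gt0 _))// ?absv1_peetre//.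
by rewrite mulr_ge0 ?(ltW (absv1_gt0 _)).
Qed.

Lemma absv1X_shift x y (B : R) M : absv (x - y) <= B ->
  (1 + absv x) ^+ M <= (1 + B) ^+ M * (1 + absv y) ^+ M.
Proof.
move=> xyB; apply: (le_trans (absv1X_peetre x y M)).
rewrite ler_wpM2r ?(ltW (absv1X_gt0 _ _))//.
have B0 : 0 <= B by apply: le_trans xyB.
by rewrite lerXn2r ?nnegrE ?(ltW (absv1_gt0 _)) ?addr_ge0// lerD2l.
Qed.

Lemma decays_Delta f : decays f -> forall N M : nat, exists2 C : R, 0 <= C &
  forall h x, absv h <= 1 -> (1 + absv x) ^+ M * cn (iter N (Delta h) f x) <= C.
Proof.
move=> fd; elim=> [|N ih] M; first by have [C C0 HC] := fd M; exists C.
have [C C0 HC] := ih M; exists (2 ^+ M * C + C) => [|h x h1].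
  by rewrite addr_ge0// mulr_ge0// exprn_ge0.
rewrite iterS {1}/Delta; apply: le_trans (_ : (1 + absv x) ^+ M * (cn (iter N (Delta h) f (x + h)) + cn (iter N (Delta h) f x)) <= _).
  by rewrite ler_wpM2l ?cnB// ltW ?absv1X_gt0.
rewrite mulrDr lerD ?HC//.
have xh : absv (x - (x + h)) <= 1 by rewrite opprD addrA subrr sub0r absvN.
have := absv1X_shift M xh; rewrite -[1 + 1]/(2%:R) => H.
apply: le_trans (ler_wpM2r (cn_ge0 _) H) _.
by rewrite -mulrA ler_wpM2l ?exprn_ge0// HC.
Qed.

Lemma diff_decays_small f (rho : R) : 0 < rho -> decays f ->
  (forall N M : nat, exists2 C : R, 0 <= C &
  forall h x, absv h < rho -> (1 + absv x) ^+ M * cn (iter N (Delta h) f x) <= C * absv h ^+ N) ->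
  diff_decays f.
Proof.
move=> r0 fd H N M; have [C1 C10 H1] := H N M; have [C2 C20 H2] := decays_Delta fd N M.
exists (C1 + C2 / rho ^+ N) => [|h x h1]; first by rewrite addr_ge0// divr_ge0// exprn_ge0// ltW.
have C2r : 0 <= C2 / rho ^+ N by rewrite divr_ge0// exprn_ge0// ltW.
have [hr|hr] := ltP (absv h) rho.
  by apply: (le_trans (H1 h x hr)); rewrite ler_wpM2r ?exprn_ge0// lerDl.
apply: (le_trans (H2 h x h1)); rewrite mulrDl -mulrA.
rewrite ler_wpDl ?mulr_ge0 ?exprn_ge0// ler_peMr// mulrC ler_pdivlMr ?exprn_gt0// mul1r.
by rewrite lerXn2r ?nnegrE// ltW.
Qed.

Lemma compact_bounded_fun (A : set K) (g : K -> R) : compact A ->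
  (forall x, A x -> \forall y \near x, g y <= g x + 1) ->
  exists M : R, forall x, A x -> g x <= M.
Proof.
move=> /compact_near_coveringP cA gA.
have : \forall M \near +oo%R, A `<=` (fun x => g x <= M).
  apply: (cA R (+oo%R) (fun M x => g x <= M)) => x Ax.
  exists ([set y | g y <= g x + 1], [set M | g x + 1 <= M]).
    by split; [exact: gA|apply: nbhs_pinfty_ge; rewrite num_real].
  by case=> y M /= [yx xM]; exact: le_trans xM.
by case=> M [_ HM]; exists (M + 1) => x Ax; apply: (HM (M + 1)) => //; rewrite ltrDl.
Qed.

Section NonArchimedean.
Variable f : K -> R[i].
Hypotheses (lc : locally_constant f) (cf : compact (closure [set x | f x != 0])).

Lemma locally_constant_continuous : continuous f.
Proof.
move=> x; apply/cvg_cnP => e e0; apply: filterS (lc x) => y ->.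
by rewrite subrr cn0.
Qed.

Lemma locally_constant_decays : decays f.
Proof.
move=> M; pose A := closure [set x | f x != 0].
have [B HB] := compact_absv_bounded cf.
have [C HC] : exists C : R, forall x, A x -> cn (f x) <= C.
  apply: compact_bounded_fun => // x _; apply: filterS (lc x) => y ->.
  by rewrite lerDl.
exists ((1 + `|B|) ^+ M * `|C|) => [|x]; first by rewrite mulr_ge0// exprn_ge0// addr_ge0.
have [->|fx0] := eqVneq (f x) 0; first by rewrite cn0 mulr0 mulr_ge0// exprn_ge0// addr_ge0.
have Ax : A x by apply: subset_closure.
rewrite ler_pM ?(ltW (absv1X_gt0 _ _))//; last by apply: (le_trans (HC x Ax)); exact: ler_norm.
rewrite lerXn2r ?nnegrE ?(ltW (absv1_gt0 _)) ?addr_ge0// lerD2l.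
by apply: (le_trans (HB x Ax)); exact: ler_norm.
Qed.

Lemma locally_constant_uniform : exists2 d : R, 0 < d &
  forall h x, absv h < d -> f (x + h) = f x.
Proof.
pose A := closure [set x | f x != 0]; move/compact_near_coveringP : (cf) => cA.
have : \forall d \near 0^'+, A `<=` (fun x => forall h, absv h < d -> f (x + h) = f x).
  apply: (cA R (0^'+) (fun d x => forall h, absv h < d -> f (x + h) = f x)) => x Ax.
  have /nbhs_absvP[e e0 He] := lc x.
  have e2 : 0 < e / 2 by rewrite divr_gt0.
  exists ([set y | absv (y - x) < e / 2], [set d | d < e / 2]).
    by split; [exact: near_absv|exact: nbhs_right_lt].
  case=> y d /= [yx de] h hd; rewrite (He y); last by lra.
  apply: He; have := absvD_le (y - x) h; rewrite addrAC; lra.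
case=> d /= d0 Hd; have Hd2 : A `<=` (fun x => forall h, absv h < d / 2 -> f (x + h) = f x).
  apply: Hd; rewrite /= ?divr_gt0//.
  by rewrite sub0r normrN gtr0_norm ?divr_gt0// ltr_pdivrMr// ltr_pMr// ltr1n.
exists (d / 2) => [|h x hd]; first by rewrite divr_gt0.
have [fx0|fx0] := eqVneq (f x) 0; last by apply: Hd2 => //; exact: subset_closure.
rewrite fx0; apply/eqP/negPn/negP => fxh.
have Axh : A (x + h) by apply: subset_closure.
have := Hd2 (x + h) Axh (- h); rewrite absvN => /(_ hd).
by rewrite addrK fx0 => e; rewrite -e eqxx in fxh.
Qed.

Lemma locally_constant_diff_decays : diff_decays f.
Proof.
have fd := locally_constant_decays; have [d d0 Hd] := locally_constant_uniform.
apply: (@diff_decays_small f d) => // N M.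
have [C C0 HC] := fd M; exists C => // h x hd; case: N => [|N].
  by rewrite expr0 mulr1; exact: HC.
have -> : iter N.+1 (Delta h) f x = 0.
  rewrite iterSr; have -> : Delta h f = fun=> 0.
    by apply/funext => y; rewrite /Delta Hd// subrr.
  by elim: N x => [//|N ih] x; rewrite iterS /Delta !ih subrr.
by rewrite cn0 mulr0 mulr_ge0// exprn_ge0.
Qed.

End NonArchimedean.

Section Schwartz.
Hypothesis arch : archimedean K.

Definition schwartz_local g :=
  [/\ continuous g,
      forall h x, cvg (diff_quot g h x t @[t --> 0^'])
    & forall n : nat, exists M : R, forall x, (absv x ^+ n)%:C * `|g x| <= M%:C].

Lemma schwartz_coind (P : (K -> R[i]) -> Prop) :
  (forall f, P f -> schwartz_local f) -> (forall f h, P f -> P (dir_derive h f)) ->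
  forall f, P f -> schwartz f.
Proof.
move=> Pl Pd f Pf hs; have : P (foldr (@dir_derive R K) f hs) by elim: hs => //= h hs; exact: Pd.
exact: Pl.
Qed.

Lemma schwartzW f : schwartz f -> schwartz_local f.
Proof. by move=> /(_ [::]). Qed.

Lemma schwartz_dir_derive f h : schwartz f -> schwartz (dir_derive h f).
Proof. by move=> fs hs; have := fs (rcons hs h); rewrite foldr_rcons. Qed.

Lemma schwartz_decays f : schwartz f -> decays f.
Proof.
move=> /schwartzW[_ _ H] M.
have bnd n : exists C, forall x, absv x ^+ n * cn (f x) <= C.
  by have [C HC] := H n; exists C => x; have := HC x; rewrite normE -rmorphM lecR.
have [A HA] := bnd 0%N; have [B HB] := bnd M.
exists (2 ^+ M * (`|A| + `|B|)) => [|x]; first by rewrite mulr_ge0 ?exprn_ge0 ?addr_ge0.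
have hA := le_trans (HA x) (ler_norm _); have hB := le_trans (HB x) (ler_norm _).
rewrite expr0 mul1r in hA.
have k : (1 + absv x) ^+ M <= 2 ^+ M * (1 + absv x ^+ M).
  have [x1|x1] := leP (absv x) 1.
    apply: (@le_trans _ _ (2 ^+ M * 1)); last by rewrite ler_wpM2l ?exprn_ge0// lerDl exprn_ge0.
    by rewrite mulr1 lerXn2r ?nnegrE ?(ltW (absv1_gt0 _))//; lra.
  apply: (@le_trans _ _ (2 ^+ M * absv x ^+ M)); last by rewrite ler_wpM2l ?exprn_ge0// lerDr.
  by rewrite -exprMn lerXn2r ?nnegrE ?(ltW (absv1_gt0 _)) ?mulr_ge0//; lra.
apply: (le_trans (ler_wpM2r (cn_ge0 _) k)); rewrite -mulrA ler_wpM2l ?exprn_ge0//.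
by rewrite mulrDl mul1r lerD.
Qed.

Lemma diff_quot_near f h x : cvg (diff_quot f h x t @[t --> 0^']) ->
  f (x + of_real K t * h) @[t --> 0^'] --> f x.
Proof.
move=> cf.
have e : {near 0^', (fun t : R => f x + t%:C * diff_quot f h x t) =1
                    (fun t => f (x + of_real K t * h))}.
  near=> t; have t0 : t != 0 by near: t; exact: nbhs_dnbhs_neq.
  rewrite /diff_quot mulrA -rmorphM divff// mul1r addrC subrK//.
apply: cvg_trans (near_eq_cvg e) _.
set l : R[i] := lim (diff_quot f h x t @[t --> 0^']).
have h0 : (fun t : R => t%:C : R[i]) @ 0^' --> (0 : R[i]).
  apply/cvg_cnP => e' e0; near=> t.
  rewrite subr0 cn_real; near: t; exact: dnbhs0_lt.
have PF : ProperFilter (0 : R)^' by apply: Proper_dnbhs_numFieldType.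
have h1 := @ccvgM R R _ PF _ (diff_quot f h x) _ l h0 cf.
have := @ccvgD R R _ PF (fun=> f x) _ (f x) _ (@ccvg_cst R R _ PF (f x)) h1.
by rewrite mul0r addr0.
Unshelve. all: by end_near. Qed.

Lemma cvg_ex_lim (f : R -> R[i]) (l : R[i]) : f t @[t --> 0^'] --> l ->
  cvg (f t @[t --> 0^']).
Proof. by move=> ?; apply/cvg_ex; exists l. Qed.

Lemma diff_quotM f g h x : cvg (diff_quot f h x t @[t --> 0^']) ->
  cvg (diff_quot g h x t @[t --> 0^']) ->
  diff_quot (fun x => f x * g x) h x t @[t --> 0^'] -->
  dir_derive h f x * g x + f x * dir_derive h g x.
Proof.
move=> cf cg.
have -> : diff_quot (fun x => f x * g x) h x =
  fun t => diff_quot f h x t * g (x + of_real K t * h) + f x * diff_quot g h x t.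
  by apply/funext => t; rewrite /diff_quot; ring.
have PF : ProperFilter (0 : R)^' by apply: Proper_dnbhs_numFieldType.
have h1 := @ccvgM R R _ PF (diff_quot f h x) _ (dir_derive h f x) _ cf (diff_quot_near cg).
have h2 := @ccvgM R R _ PF (fun=> f x) (diff_quot g h x) _ (dir_derive h g x) (@ccvg_cst R R _ PF (f x)) cg.
exact: (ccvgD h1 h2).
Qed.

Lemma diff_quotD f g h x : cvg (diff_quot f h x t @[t --> 0^']) ->
  cvg (diff_quot g h x t @[t --> 0^']) ->
  diff_quot (fun x => f x + g x) h x t @[t --> 0^'] --> dir_derive h f x + dir_derive h g x.
Proof.
move=> cf cg.
have -> : diff_quot (fun x => f x + g x) h x = fun t => diff_quot f h x t + diff_quot g h x t.
  by apply/funext => t; rewrite /diff_quot; ring.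
exact: (ccvgD (f := diff_quot f h x) (g := diff_quot g h x)
  (a := dir_derive h f x) (b := dir_derive h g x) cf cg).
Qed.

Lemma local_of_decays f : continuous f ->
  (forall h x, cvg (diff_quot f h x t @[t --> 0^'])) -> decays f -> schwartz_local f.
Proof.
move=> cf df fd; split => // n; have [C C0 HC] := fd n; exists C => x.
rewrite normE -rmorphM lecR; apply: le_trans (HC x); rewrite ler_wpM2r//.
by rewrite lerXn2r ?nnegrE ?(ltW (absv1_gt0 _))// lerDr.
Qed.

Lemma decaysD f g : decays f -> decays g -> decays (fun x => f x + g x).
Proof.
move=> df dg M; have [A A0 HA] := df M; have [B B0 HB] := dg M.
exists (A + B) => [|x]; first exact: addr_ge0.
apply: (le_trans (ler_wpM2l (ltW (absv1X_gt0 x M)) (cnD _ _))).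
by rewrite mulrDr lerD.
Qed.

Lemma decaysM f g : decays f -> decays g -> decays (fun x => f x * g x).
Proof.
move=> df dg M; have [A A0 HA] := df M; have [B B0 HB] := dg 0%N.
exists (A * B) => [|x]; first exact: mulr_ge0.
rewrite cnM mulrA ler_pM ?mulr_ge0 ?(ltW (absv1X_gt0 _ _))//.
by have := HB x; rewrite expr0 mul1r.
Qed.

Lemma decays_trans f a : decays f -> decays (fun x => f (x + a)).
Proof.
move=> df M; have [A A0 HA] := df M.
exists ((1 + absv a) ^+ M * A) => [|x]; first by rewrite mulr_ge0// ltW// absv1X_gt0.
have xa : absv (x - (x + a)) <= absv a by rewrite opprD addrA subrr sub0r absvN.
apply: (le_trans (ler_wpM2r (cn_ge0 _) (absv1X_shift M xa))).
by rewrite -mulrA ler_wpM2l// ltW// absv1X_gt0.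
Qed.

Lemma decays_conj f : decays f -> decays (fun x => (f x)^*%C).
Proof. by move=> df M; have [A A0 HA] := df M; exists A => // x; rewrite cnJ. Qed.

Lemma continuous_absvD (a x : K) : {for x, continuous (fun y => y + a)}.
Proof.
apply/cvg_absvP => e e0; apply: filterS (near_absv x e0) => y.
by rewrite opprD addrACA subrr addr0.
Qed.

Lemma continuous_trans f a : continuous f -> continuous (fun x => f (x + a)).
Proof. by move=> cf x; apply: continuous_comp; [exact: continuous_absvD|exact: cf]. Qed.

Lemma continuous_conj f : continuous f -> continuous (fun x => (f x)^*%C).
Proof.
move=> cf x; apply/cvg_cnP => e; have /cvg_cnP H := cf x; move=> /H.
by apply: filterS => y; rewrite -rmorphB cnJ.
Qed.

Lemma schwartz_trans f a : schwartz f -> schwartz (fun x => f (x + a)).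
Proof.
move=> fs; pose P g := exists2 f, schwartz f & g = fun x => f (x + a).
have E g h x : diff_quot (fun x => g (x + a)) h x = diff_quot g h (x + a).
  by apply/funext => t; rewrite /diff_quot addrAC.
apply: (@schwartz_coind P); last by exists f.
  move=> _ [g gs ->]; have [cg dg _] := schwartzW gs.
  apply: local_of_decays; [exact: continuous_trans| |exact/decays_trans/schwartz_decays].
  by move=> h x; rewrite E.
move=> _ h [g gs ->]; exists (dir_derive h g); first exact: schwartz_dir_derive.
by apply/funext => x; rewrite /dir_derive E.
Qed.

Lemma ccvg_conj (f : R -> R[i]) (l : R[i]) : f t @[t --> 0^'] --> l ->
  (f t)^*%C @[t --> 0^'] --> l^*%C.
Proof.
move=> /cvg_cnP H; apply/cvg_cnP => e /H; apply: filterS => t.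
by rewrite -rmorphB cnJ.
Qed.

Lemma schwartz_conj f : schwartz f -> schwartz (fun x => (f x)^*%C).
Proof.
move=> fs; pose P g := exists2 f, schwartz f & g = fun x => (f x)^*%C.
have E g h x t : diff_quot (fun x => (g x)^*%C) h x t = (diff_quot g h x t)^*%C.
  by rewrite /diff_quot rmorphM rmorphB/= oppr0.
apply: (@schwartz_coind P); last by exists f.
  move=> _ [g gs ->]; have [cg dg _] := schwartzW gs.
  apply: local_of_decays; [exact: continuous_conj| |exact/decays_conj/schwartz_decays].
  move=> h x; apply: (@cvg_ex_lim _ (dir_derive h g x)^*%C); under eq_fun do rewrite E.
  by apply: ccvg_conj; exact: dg.
move=> _ h [g gs ->]; exists (dir_derive h g); first exact: schwartz_dir_derive.
apply/funext => x; rewrite {1}/dir_derive; apply: ccvg_lim; under eq_fun do rewrite E.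
by apply: ccvg_conj; have [_ dg _] := schwartzW gs; exact: dg.
Qed.

Lemma schwartzM f g : schwartz f -> schwartz g -> schwartz (fun x => f x * g x).
Proof.
move=> fs gs.
pose P k := exists s : seq ((K -> R[i]) * (K -> R[i])),
  (forall p, List.In p s -> schwartz p.1 /\ schwartz p.2) /\
  k = fun x => \sum_(p <- s) p.1 x * p.2 x.
have Pl (s : seq ((K -> R[i]) * (K -> R[i]))) :
  (forall p, List.In p s -> schwartz p.1 /\ schwartz p.2) ->
  let k := fun x => \sum_(p <- s) p.1 x * p.2 x in
  [/\ continuous k, decays k &
   forall h x, diff_quot k h x t @[t --> 0^'] -->
     \sum_(p <- s) (dir_derive h p.1 x * p.2 x + p.1 x * dir_derive h p.2 x)].
  elim: s => [_|[u v] s ih Hs] /=.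
    have -> : (fun x : K => \sum_(p <- [::]) p.1 x * p.2 x) = fun=> 0 :> R[i].
      by apply/funext => x; rewrite big_nil.
    split; first by move=> x; exact: cvg_cst.
    - by move=> M; exists 0 => // x; rewrite cn0 mulr0.
    - move=> h x; rewrite big_nil.
      rewrite [diff_quot _ h x](_ : _ = fun=> 0); first exact: ccvg_cst.
      by apply/funext => t; rewrite /diff_quot subrr mulr0.
  have [us vs] := Hs (u, v) (or_introl erefl); rewrite /= in us vs.
  have [|ck dk qk] := ih; first by move=> p ps; apply: Hs; right.
  have [cu du _] := schwartzW us; have [cv dv _] := schwartzW vs.
  set k := (fun x => \sum_(p <- s) _) in ck dk qk.
  have -> : (fun x : K => \sum_(p <- ((u, v) :: s)) p.1 x * p.2 x) =
      fun x => u x * v x + k x.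
    by apply/funext => x; rewrite big_cons.
  split.
  - by move=> x; apply: ccvgD; [apply: ccvgM; [exact: cu|exact: cv]|exact: ck].
  - by apply: decaysD => //; apply: decaysM; exact: schwartz_decays.
  - move=> h x; rewrite big_cons/=.
    have q1 := diff_quotM (du h x) (dv h x).
    have := diff_quotD (cvg_ex_lim q1) (cvg_ex_lim (qk h x)).
    by rewrite /dir_derive (ccvg_lim q1) (ccvg_lim (qk h x)).
apply: (@schwartz_coind P); last first.
  exists [:: (f, g)]; split; first by move=> p [<-|[]].
  by apply/funext => x; rewrite big_seq1.
  move=> _ h [s [Hs ->]]; have [_ _ q] := Pl s Hs.
  exists (flatten [seq [:: (dir_derive h p.1, p.2); (p.1, dir_derive h p.2)] | p <- s]); split.
    elim: s Hs {q} => [|p s ih] Hs //= q [<-|[<-|qs]] /=.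
    - by have [? ?] := Hs p (or_introl erefl); split => //; exact: schwartz_dir_derive.
    - by have [? ?] := Hs p (or_introl erefl); split => //; exact: schwartz_dir_derive.
    - by apply: ih qs => r rs; apply: Hs; right.
  apply/funext => x; rewrite {1}/dir_derive (ccvg_lim (q h x)).
  elim: s {Hs q} => [|p s ih]; first by rewrite !big_nil.
  by rewrite big_cons/= !big_cons/= ih addrA.
move=> _ [s [Hs ->]]; have [ck dk q] := Pl s Hs.
apply: local_of_decays; [exact: ck| |exact: dk] => h x.
exact: (cvg_ex_lim (q h x)).
Qed.

End Schwartz.
End SchwartzBruhat.

Section SchwartzDifferences.
Variables (R : realType) (K : completeValuedFieldType R).
Variable phi : {rmorphism rat -> K}.
Hypothesis arch : archimedean K.
Implicit Types (x y h a b : K) (t e : R) (f g : K -> R[i]).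

Lemma iter_Delta_dir_derive N f h b : (forall x, cvg (diff_quot f b x t @[t --> 0^'])) ->
  forall x, diff_quot (iter N (Delta h) f) b x t @[t --> 0^'] -->
    iter N (Delta h) (dir_derive b f) x.
Proof.
move=> cf; have PF : ProperFilter (0 : R)^' by apply: Proper_dnbhs_numFieldType.
elim: N => [|N ih] x; first exact: cf.
rewrite !iterS; set G := iter N _ f in ih *; set D := iter N _ _ in ih *.
have -> : diff_quot (Delta h G) b x = fun t => diff_quot G b (x + h) t - diff_quot G b x t.
  apply/funext => t; rewrite /diff_quot /Delta [x + h + _]addrAC; ring.
have hN : - diff_quot G b x t @[t --> 0^'] --> - D x.
  move/cvg_cnP : (ih x) => H; apply/cvg_cnP => e /H; apply: filterS => t.
  by rewrite -opprD cnN.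
exact: (@ccvgD R R _ PF _ _ _ _ (ih (x + h)) hN).
Qed.

Lemma line_bound (G D : K -> R[i]) b M (A : R) : 0 <= A ->
  (forall y, diff_quot G b y t @[t --> 0^'] --> D y) ->
  (forall y, (1 + absv y) ^+ M * cn (D y) <= A) ->
  forall y t, `|t| < 1 ->
  (1 + absv y) ^+ M * cn (G (y + of_real K t * b) - G y) <= 2 * ((1 + absv b) ^+ M * A) * `|t|.
Proof.
move=> A0 dG DA y t t1.
set m := (1 + absv b) ^+ M * A / (1 + absv y) ^+ M.
have Dm u : `|u| < 1 -> cn (D (y + of_real K u * b)) <= m.
  move=> u1; rewrite /m ler_pdivlMr ?absv1X_gt0// mulrC.
  have yb : absv (y - (y + of_real K u * b)) <= absv b.
    by rewrite opprD addrA subrr sub0r absvN absvM ler_piMl// (of_real_le1 phi).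
  apply: (le_trans (ler_wpM2r (cn_ge0 _) (absv1X_shift M yb))).
  by rewrite -mulrA ler_wpM2l// ltW// absv1X_gt0.
have dg u : (s^-1)%:C * (G (y + of_real K (u + s) * b) - G (y + of_real K u * b)) @[s --> 0^']
    --> D (y + of_real K u * b).
  have := dG (y + of_real K u * b).
  have -> : diff_quot G b (y + of_real K u * b) =
      fun s => (s^-1)%:C * (G (y + of_real K (u + s) * b) - G (y + of_real K u * b)).
    by apply/funext => s; rewrite /diff_quot (of_realD phi arch) mulrDl addrA.
  exact.
rewrite mulrC -ler_pdivlMr ?absv1X_gt0//.
have -> : 2 * ((1 + absv b) ^+ M * A) * `|t| / (1 + absv y) ^+ M = 2 * m * `|t|.
  by rewrite /m; ring.
have [t0|t0] := leP 0 t.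
  have := @cplx_mvt R (fun u => G (y + of_real K u * b)) (fun u => D (y + of_real K u * b)) 0 t m t0 (fun u _ => dg u) _.
  rewrite (of_real0 phi)// mul0r addr0 subr0 ger0_norm//; apply=> u /andP[u0 ut]; apply: Dm.
  by rewrite ger0_norm//; apply: le_lt_trans ut _; rewrite ger0_norm in t1.
have := @cplx_mvt R (fun u => G (y + of_real K u * b)) (fun u => D (y + of_real K u * b)) t 0 m (ltW t0) (fun u _ => dg u) _.
rewrite (of_real0 phi)// mul0r addr0 sub0r ltr0_norm// cnC; apply=> u /andP[ut u0]; apply: Dm.
by rewrite ler0_norm//; apply: le_lt_trans (_ : - u <= - t) _; rewrite ?lerN2// -(ltr0_norm t0).
Qed.

Lemma path_bound n (b : 'I_n -> K) (t : 'I_n -> R) (G : K -> R[i]) (D : 'I_n -> K -> R[i])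
    M (A : 'I_n -> R) (B : R) :
  (forall j, 0 <= A j) -> (forall j, `|t j| < 1) ->
  (forall j y, diff_quot G (b j) y t @[t --> 0^'] --> D j y) ->
  (forall j y, (1 + absv y) ^+ M * cn (D j y) <= A j) ->
  forall (s : seq 'I_n) x0 y, absv (x0 - y) + \sum_(j <- s) absv (b j) <= B ->
  (1 + absv x0) ^+ M * cn (G (y + \sum_(j <- s) of_real K (t j) * b j) - G y) <=
  (1 + B) ^+ M * \sum_(j <- s) 2 * ((1 + absv (b j)) ^+ M * A j) * `|t j|.
Proof.
move=> A0 t1 dG DA; elim=> [|j s ih] x0 y yB.
  by rewrite !big_nil addr0 subrr cn0 !mulr0.
rewrite !big_cons addrA; set y' := y + of_real K (t j) * b j.
have -> : G (y' + \sum_(j <- s) of_real K (t j) * b j) - G y =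
  (G y' - G y) + (G (y' + \sum_(j <- s) of_real K (t j) * b j) - G y') by ring.
apply: (le_trans (ler_wpM2l (ltW (absv1X_gt0 _ _)) (cnD _ _))); rewrite !mulrDr.
have S0 : 0 <= \sum_(j <- s) absv (b j) by apply: sumr_ge0.
rewrite big_cons in yB; apply: lerD.
  have xyB : absv (x0 - y) <= B by have := absv_ge0 (b j); lra.
  apply: (le_trans (ler_wpM2r (cn_ge0 _) (absv1X_shift M xyB))).
  rewrite -[X in X <= _]mulrA; apply: ler_wpM2l.
    by rewrite exprn_ge0// addr_ge0//; apply: le_trans xyB.
  exact: (line_bound (A0 j) (dG j) (DA j)).
apply: ih; apply: le_trans yB; rewrite addrA lerD2r /y' opprD addrA.
apply: (le_trans (absvB_le _ _)); rewrite lerD2l absvM ler_piMl//.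
exact: (of_real_le1 phi).
Qed.

Lemma schwartz_diff_decays n (b : 'I_n -> K) f : Qbasis b -> schwartz f -> diff_decays f.
Proof.
move=> bb fs; have [C0 C00 HC0] := Qbasis_coord_bound phi bb.
have r0 : 0 < (C0 + 1)^-1 by rewrite invr_gt0 ltr_wpDl.
apply: (diff_decays_small r0 (schwartz_decays fs)) => N; elim: N f fs => [|N ih] f fs M.
  by have [C C1 HC] := schwartz_decays fs M; exists C => // h x _; rewrite expr0 mulr1; exact: HC.
have /choice[A HA] j : exists A, 0 <= A /\ forall h x, absv h < (C0 + 1)^-1 ->
    (1 + absv x) ^+ M * cn (iter N (Delta h) (dir_derive (b j) f) x) <= A * absv h ^+ N.
  by have [A A0 HA] := ih _ (schwartz_dir_derive (b j) fs) M; exists A.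
set B := \sum_j absv (b j).
exists ((1 + B) ^+ M * \sum_j 2 * ((1 + absv (b j)) ^+ M * A j) * C0) => [|h x hr].
  rewrite mulr_ge0 ?exprn_ge0 ?addr_ge0 ?sumr_ge0// => j _.
  by rewrite !mulr_ge0// ?exprn_ge0 ?addr_ge0//; have [] := HA j.
rewrite iterS {1}/Delta; set G := iter N (Delta h) f.
have [c [[ck hc] _]] := bb h.
have ch j : absv (c 0 j) <= C0 * absv h by have := HC0 (fun j => c 0 j) ck j; rewrite -hc.
have c1 j : absv (c 0 j) < 1.
  apply: (le_lt_trans (ch j)); apply: (@le_lt_trans _ _ ((C0 + 1) * absv h)).
    by rewrite ler_wpM2r// lerDl.
  by rewrite -ltr_pdivlMl ?ltr_wpDl// mulr1.
pose t j := real_of (c 0 j).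
have th j : `|t j| <= C0 * absv h by apply: le_trans (ch j); apply: (real_of_le phi).
have t1 j : `|t j| < 1 by apply: le_lt_trans (c1 j); apply: (real_of_le phi).
have hE : h = \sum_j of_real K (t j) * b j.
  by rewrite {1}hc; apply: eq_bigr => j _; rewrite (real_ofK phi).
have A0 j : 0 <= A j * absv h ^+ N by rewrite mulr_ge0 ?exprn_ge0//; have [] := HA j.
have [cf df _] := schwartzW fs.
have := @path_bound n b t G (fun j => iter N (Delta h) (dir_derive (b j) f)) M
  (fun j => A j * absv h ^+ N) B A0 t1 (fun j => iter_Delta_dir_derive (df (b j)))
  (fun j y => (HA j).2 h y hr) (index_enum 'I_n) x x.
rewrite subrr absv0 add0r -hE => /(_ (lexx _)) H; apply: (le_trans H).
rewrite -mulrA ler_wpM2l ?exprn_ge0 ?addr_ge0 ?sumr_ge0// mulr_suml.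
apply: ler_sum => j _; rewrite exprS.
have -> : 2 * ((1 + absv (b j)) ^+ M * A j) * C0 * (absv h * absv h ^+ N) =
   2 * ((1 + absv (b j)) ^+ M * (A j * absv h ^+ N)) * (C0 * absv h) by ring.
apply: ler_wpM2l => //; apply: mulr_ge0 => //; apply: mulr_ge0 => //.
by apply/ltW; exact: absv1X_gt0.
Qed.

End SchwartzDifferences.

Section SchwartzBruhatProperties.
Variables (R : realType) (K : completeValuedFieldType R).
Variable phi : {rmorphism rat -> K}.
Implicit Types (x y h a b : K) (f g : K -> R[i]).

Lemma sb_continuous f : schwartz_bruhat f -> continuous f.
Proof.
rewrite /schwartz_bruhat; case: asboolP => _; first by move=> /schwartzW[].
by move=> [lc _]; exact: locally_constant_continuous.
Qed.

Lemma sb_decays f : schwartz_bruhat f -> decays f.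
Proof.
rewrite /schwartz_bruhat; case: asboolP => _; first exact: schwartz_decays.
by move=> [lc cf]; exact: locally_constant_decays.
Qed.

Lemma sb_diff_decays f : (exists x : K, addchar x != 1) -> schwartz_bruhat f -> diff_decays f.
Proof.
move=> [x lx]; rewrite /schwartz_bruhat; case: asboolP => arch.
  by have [n [b bb]] := addchar_arch_basis phi arch lx; apply: schwartz_diff_decays bb.
by move=> [lc cf]; exact: locally_constant_diff_decays.
Qed.

Lemma sb_trans f a : schwartz_bruhat f -> schwartz_bruhat (fun x => f (x + a)).
Proof.
rewrite /schwartz_bruhat; case: asboolP => arch; first exact: schwartz_trans.
move=> [lc cf]; split.
  move=> x; have := lc (x + a) => /nbhs_absvP[e e0 He]; apply/nbhs_absvP; exists e => // y yx.
  by apply: He; rewrite opprD addrACA subrr addr0.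
have cA : compact [set x + - a | x in closure [set x | f x != 0]].
  apply: continuous_compact => //; apply: continuous_subspaceT => x.
  exact: continuous_absvD.
apply: subclosed_compact cA _; first exact: closed_closure.
move=> x /closure_absvP H; exists (x + a); last by rewrite addrK.
apply/closure_absvP => e /H[y /= fy yx]; exists (y + a) => //.
by rewrite opprD addrACA subrr addr0.
Qed.

Lemma sb_conj f : schwartz_bruhat f -> schwartz_bruhat (fun x => (f x)^*%C).
Proof.
rewrite /schwartz_bruhat; case: asboolP => arch; first exact: schwartz_conj.
move=> [lc cf]; split; first by move=> x; apply: filterS (lc x) => y ->.
rewrite (_ : [set x | (f x)^*%C != 0] = [set x | f x != 0])//.
by apply/seteqP; split => x /=; rewrite -!cn_eq0 cnJ.
Qed.

Lemma sbM f g : schwartz_bruhat f -> schwartz_bruhat g -> schwartz_bruhat (fun x => f x * g x).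
Proof.
rewrite /schwartz_bruhat; case: asboolP => arch; first exact: schwartzM.
move=> [lf cf] [lg _]; split.
  by move=> x; apply: filterS2 (lf x) (lg x) => y -> ->.
apply: subclosed_compact cf _; first exact: closed_closure.
by apply: closure_subset => x /=; rewrite mulf_eq0 negb_or => /andP[].
Qed.

End SchwartzBruhatProperties.

(** * Integration and the module of a Haar measure *)

Section ComplexMeasurable.
Context {R : realType} {d : measure_display} {T : measurableType d}.
Implicit Types (f g : T -> R[i]).

Definition cmeas f := measurable_fun setT (fun x => complex.Re (f x)) /\
  measurable_fun setT (fun x => complex.Im (f x)).

Lemma cmeas_cst c : cmeas (fun=> c).
Proof. by split; exact: measurable_cst. Qed.

Lemma cmeasD f g : cmeas f -> cmeas g -> cmeas (fun x => f x + g x).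
Proof.
move=> [f1 f2] [g1 g2]; split.
  rewrite (_ : (fun x => _) = (fun x => complex.Re (f x) + complex.Re (g x))).
    exact: measurable_funD.
  by apply/funext => x; case: (f x); case: (g x).
rewrite (_ : (fun x => _) = (fun x => complex.Im (f x) + complex.Im (g x))).
  exact: measurable_funD.
by apply/funext => x; case: (f x); case: (g x).
Qed.

Lemma cmeasM f g : cmeas f -> cmeas g -> cmeas (fun x => f x * g x).
Proof.
move=> [f1 f2] [g1 g2]; split.
  rewrite (_ : (fun x => _) = (fun x => complex.Re (f x) * complex.Re (g x) -
     complex.Im (f x) * complex.Im (g x))).
    by apply: measurable_funB; exact: measurable_funM.
  by apply/funext => x; case: (f x); case: (g x).
rewrite (_ : (fun x => _) = (fun x => complex.Re (f x) * complex.Im (g x) +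
     complex.Im (f x) * complex.Re (g x))).
  by apply: measurable_funD; exact: measurable_funM.
by apply/funext => x; case: (f x); case: (g x).
Qed.

Lemma cmeasN f : cmeas f -> cmeas (fun x => - f x).
Proof.
move=> hf; rewrite (_ : (fun x => _) = (fun x => -1 * f x)).
  by apply: cmeasM => //; exact: cmeas_cst.
by apply/funext => x; rewrite mulN1r.
Qed.

Lemma cmeasB f g : cmeas f -> cmeas g -> cmeas (fun x => f x - g x).
Proof. by move=> hf hg; apply: cmeasD => //; exact: cmeasN. Qed.

Lemma cmeas_real (f : T -> R) : measurable_fun setT f -> cmeas (fun x => (f x)%:C).
Proof. by move=> hf; split => //=; exact: measurable_cst. Qed.

Lemma cmeas_cn f : cmeas f -> measurable_fun setT (fun x => cn (f x)).
Proof.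
move=> [f1 f2].
rewrite (_ : (fun x => _) = Num.sqrt \o (fun x => complex.Re (f x) ^+ 2 + complex.Im (f x) ^+ 2)).
  apply: measurableT_comp; first by apply: continuous_measurable_fun; exact: sqrt_continuous.
  by apply: measurable_funD; exact: measurable_funX.
by apply/funext => x /=; rewrite /cn; case: (f x).
Qed.

End ComplexMeasurable.

Lemma cmeas_comp {R : realType} {d1 d2 : measure_display} {T1 : measurableType d1}
  {T2 : measurableType d2} (f : T2 -> R[i]) (g : T1 -> T2) :
  cmeas f -> measurable_fun setT g -> cmeas (fun x => f (g x)).
Proof.
by move=> [f1 f2] mg; split;
  [apply: (measurableT_comp f1)|apply: (measurableT_comp f2)].
Qed.

Section ComplexIntegral.
Context {R : realType} {d : measure_display} {T : measurableType d}.
Variable mu : {measure set T -> \bar R}.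
Implicit Types (f g : T -> R[i]) (u : T -> R) (N : set T).
Local Notation int u := (mu.-integrable setT (EFin \o u)).

Lemma le_int u v : measurable_fun setT u -> int v -> (forall x, `|u x| <= v x) -> int u.
Proof.
move=> mu' iv uv; apply: le_integrable iv => //; first exact/measurable_EFinP.
move=> x _ /=; rewrite lee_fin; apply: le_trans (uv x) _; exact: ler_norm.
Qed.

Lemma int_meas u : int u -> measurable_fun setT u.
Proof. by move=> /measurable_int/measurable_EFinP. Qed.

Lemma le_int_ae u v N : measurable N -> mu N = 0%E -> measurable_fun setT u -> int v ->
  (forall x, ~ N x -> `|u x| <= v x) -> int u.
Proof.
move=> mN N0 mu' iv uv; apply/integrableP; split; first exact/measurable_EFinP.
have /integrableP[mv] := iv; apply: le_lt_trans.
apply: ae_ge0_le_integral => //.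
- by apply: measurableT_comp => //; exact/measurable_EFinP.
- exact: measurableT_comp.
exists N; split => // x /= H; apply: contrapT => nN; apply: H => _.
by rewrite lee_fin; apply: le_trans (uv x nN) _; exact: ler_norm.
Qed.

Lemma cintegrableP f : cintegrable mu f <-> cmeas f /\ int (fun x => cn (f x)).
Proof.
split=> [[h1 h2]|[[f1 f2] h]].
  have mf : cmeas f by split; exact: int_meas.
  split => //; have i1 := integrable_norm h1; have i2 := integrable_norm h2.
  have i3 : int (fun x => `|complex.Re (f x)| + `|complex.Im (f x)|).
    exact: (integrableD measurableT i1 i2).
  apply: le_int i3 _ => [|x]; first exact: cmeas_cn.
  by rewrite ger0_norm ?cn_le.
by split; apply: le_int h _ => // x; [exact: cn_Re|exact: cn_Im].
Qed.

Lemma cintegrable_meas f : cintegrable mu f -> cmeas f.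
Proof. by move=> /cintegrableP[]. Qed.

Lemma cintegrable_cn f : cintegrable mu f -> int (fun x => cn (f x)).
Proof. by move=> /cintegrableP[]. Qed.

Lemma cintegrable_ae_le f u N : measurable N -> mu N = 0%E -> cmeas f -> int u ->
  (forall x, ~ N x -> cn (f x) <= u x) -> cintegrable mu f.
Proof.
move=> mN N0 mf iu fu; apply/cintegrableP; split => //.
apply: (le_int_ae mN N0 _ iu) => [|x nx]; first exact: cmeas_cn.
by rewrite ger0_norm ?fu.
Qed.

Lemma cintegrable_le f u : cmeas f -> int u -> (forall x, cn (f x) <= u x) -> cintegrable mu f.
Proof.
by move=> mf iu fu; apply: (@cintegrable_ae_le f u set0) => //; rewrite measure0.
Qed.

Lemma intD u v : int u -> int v -> int (fun x => u x + v x).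
Proof. by move=> iu iv; exact: (integrableD measurableT iu iv). Qed.

Lemma intZ (r : R) u : int u -> int (fun x => r * u x).
Proof. by move=> iu; exact: (integrableZl measurableT r iu). Qed.

Lemma cintegrableD f g : cintegrable mu f -> cintegrable mu g ->
  cintegrable mu (fun x => f x + g x).
Proof.
move=> /cintegrableP[mf f1] /cintegrableP[mg g1].
apply: (cintegrable_le _ (intD f1 g1)) => [|x]; [exact: cmeasD|exact: cnD].
Qed.

Lemma cintegrableZ c f : cintegrable mu f -> cintegrable mu (fun x => c * f x).
Proof.
move=> /cintegrableP[mf f1]; apply: (cintegrable_le _ (intZ (cn c) f1)) => [|x].
  by apply: cmeasM => //; exact: cmeas_cst.
by rewrite cnM.
Qed.

Lemma cintegrableB f g : cintegrable mu f -> cintegrable mu g ->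
  cintegrable mu (fun x => f x - g x).
Proof.
move=> hf hg; apply: cintegrableD => //.
rewrite (_ : (fun x => - g x) = (fun x => -1 * g x)); first exact: cintegrableZ.
by apply/funext => x; rewrite mulN1r.
Qed.

Lemma cintegralD f g : cintegrable mu f -> cintegrable mu g ->
  cintegral mu (fun x => f x + g x) = cintegral mu f + cintegral mu g.
Proof.
move=> [f1 f2] [g1 g2]; rewrite /cintegral; apply/eqP; rewrite eq_complex/=.
rewrite -!RintegralD//; apply/andP; split; apply/eqP; apply: eq_Rintegral => x _;
  by case: (f x); case: (g x).
Qed.

Lemma cintegralZ c f : cintegrable mu f ->
  cintegral mu (fun x => c * f x) = c * cintegral mu f.
Proof.
case: c => a b [f1 f2]; rewrite /cintegral; apply/eqP; rewrite eq_complex/=.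
rewrite -!RintegralZl//.
have Zl (r : R) (u : T -> R) : int u -> int (fun x => r * u x) by exact: intZ.
have E1 : \int[mu]_(x in setT) complex.Re ((a +i* b) * f x) =
  \int[mu]_(x in setT) (a * complex.Re (f x)) - \int[mu]_(x in setT) (b * complex.Im (f x)).
  by rewrite -RintegralB//; [|exact: Zl|exact: Zl]; apply: eq_Rintegral => x _; case: (f x).
have E2 : \int[mu]_(x in setT) complex.Im ((a +i* b) * f x) =
  \int[mu]_(x in setT) (a * complex.Im (f x)) + \int[mu]_(x in setT) (b * complex.Re (f x)).
  by rewrite -RintegralD//; [|exact: Zl|exact: Zl]; apply: eq_Rintegral => x _; case: (f x).
by rewrite E1 E2 !eqxx.
Qed.

Lemma cintegralB f g : cintegrable mu f -> cintegrable mu g ->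
  cintegral mu (fun x => f x - g x) = cintegral mu f - cintegral mu g.
Proof.
move=> hf hg.
have -> : (fun x => f x - g x) = (fun x => f x + -1 * g x).
  by apply/funext => x; rewrite mulN1r.
by rewrite cintegralD ?cintegralZ ?mulN1r//; exact: cintegrableZ.
Qed.

Lemma cintegral_le f u : cmeas f -> int u -> (forall x, cn (f x) <= u x) ->
  cn (cintegral mu f) <= 2 * \int[mu]_(x in setT) u x.
Proof.
move=> mf iu fu; have [i1 i2] := cintegrable_le mf iu fu.
apply: (le_trans (cn_le _)); rewrite /= mulr_natl mulr2n.
by apply: lerD; apply: (le_trans (le_normr_Rintegral measurableT _)) => //;
   apply: le_Rintegral => //; try exact: integrable_norm;
   move=> x _; apply: le_trans (fu x); [exact: cn_Re|exact: cn_Im].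
Qed.

Lemma cintegral_ae_eq f g N : measurable N -> mu N = 0%E -> cmeas f -> cmeas g ->
  (forall x, ~ N x -> f x = g x) -> cintegral mu f = cintegral mu g.
Proof.
move=> mN N0 [f1 f2] [g1 g2] fg; rewrite /cintegral /Rintegral.
have E (p : R[i] -> R) : measurable_fun setT (p \o f) -> measurable_fun setT (p \o g) ->
    (\int[mu]_(x in setT) (p (f x))%:E = \int[mu]_(x in setT) (p (g x))%:E)%E.
  move=> pf pg; apply: ae_eq_integral => //; try exact/measurable_EFinP.
  by exists N; split => // x /= H; apply: contrapT => nN; apply: H => _; rewrite fg.
by rewrite (E (@complex.Re R)) ?(E (@complex.Im R)).
Qed.

Lemma cintegral_ge0_le u v : int u -> int v -> (forall x, u x <= v x) ->
  \int[mu]_(x in setT) u x <= \int[mu]_(x in setT) v x.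
Proof. by move=> iu iv uv; apply: le_Rintegral. Qed.

Lemma cintegral_real u : cintegral mu (fun x => (u x)%:C) = (\int[mu]_(x in setT) u x)%:C.
Proof. by rewrite /cintegral /Rintegral/= integral0. Qed.

Lemma cintegral0 : cintegrable mu (fun=> 0) /\ cintegral mu (fun=> 0) = 0.
Proof. by split; [split; exact: integrable0|rewrite cintegral_real /Rintegral integral0]. Qed.

End ComplexIntegral.

Section ComplexFubini.
Context {R : realType} {d1 d2 : measure_display} {T1 : measurableType d1} {T2 : measurableType d2}.
Variables (m1 : {sigma_finite_measure set T1 -> \bar R}).
Variables (m2 : {sigma_finite_measure set T2 -> \bar R}).

Lemma Rfubini_F (G : T1 * T2 -> R) : (m1 \x m2)%E.-integrable setT (EFin \o G) ->
  m1.-integrable setT (EFin \o (fun x => \int[m2]_(y in setT) G (x, y))) /\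
  (\int[m1]_(x in setT) (\int[m2]_(y in setT) G (x, y))%:E = \int[m1]_x \int[m2]_y (G (x, y))%:E)%E.
Proof.
move=> iG; have iF := integrable_fubini_F iG.
have mf : measurable_fun setT (fun x => \int[m2]_(y in setT) G (x, y)).
  rewrite (_ : (fun x => _) = fine \o fubini_F m2 (EFin \o G)).
    apply: measurableT_comp; first exact: fine_measurable.
    exact: (measurable_fubini_F iG).
  by apply/funext => x.
have E : ae_eq m1 setT (fun x => (\int[m2]_(y in setT) G (x, y))%:E) (fubini_F m2 (EFin \o G)).
  have := ae_integrable1 iG; apply: filterS => x h _.
  by rewrite /Rintegral fineK//; exact: integrable_fin_num.
split.
  have /integrableP[mF iF'] := iF; apply/integrableP; split; first exact/measurable_EFinP.
  apply: le_lt_trans iF'; apply: ae_ge0_le_integral => //.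
  - by apply: measurableT_comp => //; exact/measurable_EFinP.
  - exact: measurableT_comp.
  - by apply: filterS E => x h _; rewrite -(h I).
apply: ae_eq_integral => //; first exact/measurable_EFinP.
exact: (measurable_fubini_F iG).
Qed.

Lemma Rfubini_G (G : T1 * T2 -> R) : (m1 \x m2)%E.-integrable setT (EFin \o G) ->
  m2.-integrable setT (EFin \o (fun y => \int[m1]_(x in setT) G (x, y))) /\
  (\int[m2]_(y in setT) (\int[m1]_(x in setT) G (x, y))%:E = \int[m2]_y \int[m1]_x (G (x, y))%:E)%E.
Proof.
move=> iG; have mG : measurable_fun setT (EFin \o G) := measurable_int _ iG.
have iF : m2.-integrable setT (fubini_G m1 (EFin \o G)).
  apply/integrableP; split; first exact: (measurable_fubini_G iG).
  apply: le_lt_trans ((integrable21ltyP m1 m2 mG).1 iG).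
  apply: ge0_le_integral => //.
  - by apply: measurableT_comp => //; exact: (measurable_fubini_G iG).
  - apply: (measurable_fun_fubini_tonelli_G (m1 := m1) (abse \o (EFin \o G))).
      exact: measurableT_comp.
    by move=> z; exact: abse_ge0.
  - by move=> y _; apply: le_abse_integral => //; exact: measurableT_comp.
have mf : measurable_fun setT (fun y => \int[m1]_(x in setT) G (x, y)).
  rewrite (_ : (fun x => _) = fine \o fubini_G m1 (EFin \o G)).
    apply: measurableT_comp; first exact: fine_measurable.
    exact: (measurable_fubini_G iG).
  by apply/funext => x.
have E : ae_eq m2 setT (fun y => (\int[m1]_(x in setT) G (x, y))%:E) (fubini_G m1 (EFin \o G)).
  have := ae_integrable2 iG; apply: filterS => x h _.
  by rewrite /Rintegral fineK//; exact: integrable_fin_num.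
split.
  have /integrableP[mF iF'] := iF; apply/integrableP; split; first exact/measurable_EFinP.
  apply: le_lt_trans iF'; apply: ae_ge0_le_integral => //.
  - by apply: measurableT_comp => //; exact/measurable_EFinP.
  - exact: measurableT_comp.
  - by apply: filterS E => x h _; rewrite -(h I).
apply: ae_eq_integral => //; first exact/measurable_EFinP.
exact: (measurable_fubini_G iG).
Qed.

Lemma cfubini (F : T1 -> T2 -> R[i]) (u : T1 -> R) (N : set T1) :
  measurable N -> m1 N = 0%E ->
  cmeas (fun z : T1 * T2 => F z.1 z.2) -> m1.-integrable setT (EFin \o u) ->
  (forall x, ~ N x -> m2.-integrable setT (EFin \o (fun y => cn (F x y))) /\
     \int[m2]_(y in setT) cn (F x y) <= u x) ->
  [/\ cintegrable m1 (fun x => cintegral m2 (F x)),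
      cintegrable m2 (fun y => cintegral m1 (F^~ y)) &
      cintegral m1 (fun x => cintegral m2 (F x)) = cintegral m2 (fun y => cintegral m1 (F^~ y))].
Proof.
move=> mN N0 mF iu Fu.
have mcn : measurable_fun setT (EFin \o (fun z : T1 * T2 => cn (F z.1 z.2))).
  by apply/measurable_EFinP; exact: cmeas_cn.
have icn : (m1 \x m2)%E.-integrable setT (EFin \o (fun z : T1 * T2 => cn (F z.1 z.2))).
  apply/(integrable12ltyP m1 m2 mcn); have /integrableP[mu' iu'] := iu.
  apply: le_lt_trans iu'; apply: ae_ge0_le_integral => //.
  - by move=> x _; apply: integral_ge0.
  - apply: (measurable_fun_fubini_tonelli_F (m2 := m2) (abse \o (EFin \o (fun z : T1 * T2 => cn (F z.1 z.2))))).
      exact: measurableT_comp.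
    by move=> z; exact: abse_ge0.
  - exact: measurableT_comp.
  - exists N; split => // x /= H; apply: contrapT => nN; apply: H => _.
    have [ix Fx] := Fu x nN.
    have -> : (\int[m2]_y `|(EFin \o (fun z : T1 * T2 => cn (F z.1 z.2))) (x, y)| =
               \int[m2]_y (cn (F x y))%:E)%E.
      by apply: eq_integral => y _ /=; rewrite ger0_norm.
    rewrite -[X in (X <= _)%E]fineK; last exact: integrable_fin_num.
    by rewrite lee_fin; apply: le_trans Fx _; exact: ler_norm.
have part (p : R[i] -> R) : (forall z, `|p z| <= cn z) ->
    measurable_fun setT (fun z : T1 * T2 => p (F z.1 z.2)) ->
    [/\ m1.-integrable setT (EFin \o (fun x => \int[m2]_(y in setT) p (F x y))),
        m2.-integrable setT (EFin \o (fun y => \int[m1]_(x in setT) p (F x y))) &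
    \int[m1]_(x in setT) (\int[m2]_(y in setT) p (F x y)) =
    \int[m2]_(y in setT) (\int[m1]_(x in setT) p (F x y))].
  move=> pc mp; have ip := le_int mp icn (fun z => pc _).
  have [i1 e1] := Rfubini_F ip; have [i2 e2] := Rfubini_G ip.
  by split => //; rewrite /Rintegral in e1 e2 *; rewrite e1 e2 (Fubini ip).
have [f1 f2] := mF.
have [i1 j1 e1] := part _ (@cn_Re R) f1; have [i2 j2 e2] := part _ (@cn_Im R) f2.
by split; [split|split|rewrite /cintegral/= e1 e2].
Qed.

End ComplexFubini.

Section ScaledImage.
Context {R : realType} {d : measure_display} {T : measurableType d}.
Variable mu : {measure set T -> \bar R}.
Variables (phi : T -> T) (k : R).
Hypotheses (mphi : measurable_fun setT phi) (k0 : 0 <= k).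
Hypothesis muphi : forall A, measurable A -> mu (phi @^-1` A) = (k%:E * mu A)%E.

Lemma ge0_integral_image (g : T -> \bar R) : measurable_fun setT g -> (forall x, 0 <= g x)%E ->
  (\int[mu]_x g (phi x) = k%:E * \int[mu]_x g x)%E.
Proof.
move=> mg g0; have := ge0_integral_pushforward mphi mu measurableT mg (fun x _ => g0 x).
rewrite preimage_setT => <-.
have E : (\int[pushforward mu phi]_x g x = \int[mscale (NngNum k0) mu]_x g x)%E.
  by apply: eq_measure_integral => A mA _; rewrite /mscale/= /pushforward muphi.
by rewrite E ge0_integral_mscale.
Qed.

Lemma int_image (u : T -> R) : mu.-integrable setT (EFin \o u) ->
  mu.-integrable setT (EFin \o (fun x => u (phi x))) /\
  \int[mu]_(x in setT) u (phi x) = k * \int[mu]_(x in setT) u x.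
Proof.
move=> iu; have /integrableP[mu' fu] := iu.
have mphi' : measurable_fun setT (EFin \o (fun x => u (phi x))).
  exact: (measurableT_comp mu' mphi).
split.
  apply/integrableP; split => //.
  have := ge0_integral_image (g := fun x => `|(EFin \o u) x|%E) _ _.
  move=> -> //; last exact: measurableT_comp.
  by rewrite lte_mul_pinfty// lee_fin.
have mp : measurable_fun setT (EFin \o u)^\+%E by exact: measurable_funepos.
have mn : measurable_fun setT (EFin \o u)^\-%E by exact: measurable_funeneg.
have E0 : (\int[mu]_x (u x)%:E = \int[mu]_x (EFin \o u)^\+%E x - \int[mu]_x (EFin \o u)^\-%E x)%E.
  by rewrite integralE.
have E1 : (\int[mu]_x (u (phi x))%:E =
    k%:E * \int[mu]_x (EFin \o u)^\+%E x - k%:E * \int[mu]_x (EFin \o u)^\-%E x)%E.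
  rewrite integralE; congr (_ - _)%E.
    by rewrite -(ge0_integral_image mp (@funepos_ge0 _ _ _)) funepos.unlock.
  by rewrite -(ge0_integral_image mn (@funeneg_ge0 _ _ _)) funeneg.unlock.
have fp := integrable_pos_fin_num measurableT iu.
have fn := integrable_neg_fin_num measurableT iu.
rewrite /Rintegral E0 E1 -(fineK fp) -(fineK fn) -!EFinM -!EFinB.
by rewrite /= mulrBr.
Qed.

Lemma cint_image (f : T -> R[i]) : cintegrable mu f ->
  cintegrable mu (fun x => f (phi x)) /\
  cintegral mu (fun x => f (phi x)) = k%:C * cintegral mu f.
Proof.
move=> [f1 f2]; have [i1 e1] := int_image f1; have [i2 e2] := int_image f2.
split; first by split.
by rewrite /cintegral e1 e2; apply/eqP; rewrite eq_complex/= !mul0r subr0 addr0 !eqxx.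
Qed.

End ScaledImage.

Section BorelField.
Variables (R : realType) (K : completeValuedFieldType R).
Implicit Types (x y a b t : K) (A B : set K).

Lemma open_meas A : open A -> measurable (A : set (borel K)).
Proof. exact: sub_sigma_algebra. Qed.

Lemma closed_set1 a : closed [set a].
Proof.
move=> x /closure_absvP H; apply/eqP; rewrite -subr_eq0 -absv_eq0; apply/negPn/negP => xa.
have := H (absv (x - a)); rewrite lt_def xa absv_ge0 => /(_ isT)[y ->].
by rewrite absvC ltxx.
Qed.

Lemma closed_meas A : closed A -> measurable (A : set (borel K)).
Proof. by move=> /closed_openC/open_meas/measurableC; rewrite setCK. Qed.

Lemma meas_set1 a : measurable ([set a] : set (borel K)).
Proof. by apply: closed_meas; exact: closed_set1. Qed.

Lemma continuous_neq0_meas (f : K -> R) : (forall x, x != 0 -> {for x, continuous f}) ->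
  measurable_fun setT (f : borel K -> R).
Proof.
move=> cf; apply: (measurability _ (RGenOpens.measurableE R)) => _ [_ [a [b ->] <-]].
rewrite setTI; set A := f @^-1` _.
have -> : A = (A `&` [set~ 0]) `|` (A `&` [set 0]).
  by rewrite -setIUr setUC setUv setIT.
apply: measurableU.
  apply: open_meas; apply/open_absvP => x [Ax /eqP x0].
  have /continuous_normP H := cf x x0.
  move: Ax; rewrite /A/= in_itv/= => /andP[ax xb].
  have [|d d0 Hd] := H (Num.min (f x - a) (b - f x)); first by rewrite lt_min !subr_gt0 ax.
  exists (Num.min d (absv x)) => [|y]; first by rewrite lt_min d0 absv_gt0.
  rewrite lt_min => /andP[/Hd]; rewrite lt_min ltr_norml ltr_norml => /andP[/andP[h1 _] /andP[_ h2]] yx.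
  split; last by move=> /= y0; rewrite y0 sub0r absvN ltxx in yx.
  by rewrite /= in_itv/=; apply/andP; split; lra.
have [A0|A0] := pselect (A 0).
  have -> : A `&` [set 0] = [set 0]; last exact: meas_set1.
  by apply/seteqP; split => x [] // ->.
have -> : A `&` [set 0] = set0; last exact: measurable0.
by apply/seteqP; split => x // [Ax x0]; rewrite x0 in Ax.
Qed.

Lemma cmeas_continuous_neq0 (f : K -> R[i]) : (forall x, x != 0 -> {for x, continuous f}) ->
  cmeas (f : borel K -> R[i]).
Proof.
move=> cf; split; apply: continuous_neq0_meas => x /cf/continuous_cnP H;
  apply/continuous_normP => e /H[d d0 Hd]; exists d => // y /Hd; apply: le_lt_trans.
- apply: le_trans (cn_Re _).
  by case: (f y); case: (f x).
- apply: le_trans (cn_Im _).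
  by case: (f y); case: (f x).
Qed.

Lemma cmeas_continuous (f : K -> R[i]) : continuous f -> cmeas (f : borel K -> R[i]).
Proof. by move=> cf; apply: cmeas_continuous_neq0 => x _; exact: cf. Qed.

Lemma continuous_absv : continuous (@absv R K).
Proof.
move=> x; apply/continuous_normP => e e0; exists e => // y; apply: le_lt_trans.
exact: absv_dist.
Qed.

Lemma meas_absv : measurable_fun setT (@absv R K : borel K -> R).
Proof. by apply: continuous_neq0_meas => x _; exact: continuous_absv. Qed.

Lemma meas_map (h : K -> K) :
  (forall x e, 0 < e -> exists2 d, 0 < d & forall y, absv (y - x) < d -> absv (h y - h x) < e) ->
  measurable_fun setT (h : borel K -> borel K).
Proof.
move=> H; apply: (@measurability _ _ (borel K) (borel K) setT h (@open K) erefl) => _ [A oA <-].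
rewrite setTI; apply: open_meas; apply/open_absvP => x /= Ahx.
have /open_absvP/(_ _ Ahx)[e e0 He] := oA.
have [d d0 Hd] := H x e e0; exists d => // y /Hd; exact: He.
Qed.

Section Separable.
Variable q : nat -> K.
Hypothesis hq : forall x (e : R), 0 < e -> exists n, absv (q n - x) < e.

Lemma meas_map2 (h : K -> K -> K) :
  (forall x y (e : R), 0 < e -> exists2 d, 0 < d & forall x' y', absv (x' - x) < d ->
     absv (y' - y) < d -> absv (h x' y' - h x y) < e) ->
  measurable_fun setT (fun z : borel K * borel K => h z.1 z.2 : borel K).
Proof.
move=> H.
apply: (@measurability _ _ (borel K * borel K)%type (borel K) setT
  (fun z : borel K * borel K => h z.1 z.2) (@open K) erefl) => _ [A oA <-].
rewrite setTI.
pose rho (k : nat) : R := k.+1%:R^-1.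
pose box n m k : set (K * K) := [set z | absv (z.1 - q n) < rho k] `&` [set z | absv (z.2 - q m) < rho k].
pose good n m k := forall z, box n m k z -> A (h z.1 z.2).
have -> : (fun z : borel K * borel K => h z.1 z.2 : borel K) @^-1` A =
   \bigcup_n \bigcup_m \bigcup_(k in [set k | good n m k]) box n m k.
  apply/seteqP; split => [[x y] /= Axy|z [n _ [m _ [k gk]]]]; last exact: gk.
  have /open_absvP/(_ _ Axy)[e e0 He] := oA.
  have [d d0 Hd] := H x y e e0.
  have [k kd] : exists k, rho k < d / 2.
    have [|N HN] := @inv_small R (d / 2); first by rewrite divr_gt0.
    by exists N; exact: HN.
  have r0 : 0 < rho k by rewrite invr_gt0.
  have [n hn] := hq x r0; have [m hm] := hq y r0.
  exists n => //; exists m => //; exists k; last by split; rewrite /= absvC.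
  move=> [x' y'] [/= hx hy]; apply: He; apply: Hd.
    have := absvD_le (x' - q n) (q n - x); rewrite addrA subrK; lra.
  have := absvD_le (y' - q m) (q m - y); rewrite addrA subrK; lra.
apply: bigcupT_measurable => n; apply: bigcupT_measurable => m.
apply: bigcup_measurable => k _; apply: measurableI.
  have := @measurable_fst _ _ (borel K) (borel K) measurableT _ (open_meas (open_absv_lt (q n) (rho k))).
  by rewrite setTI.
have := @measurable_snd _ _ (borel K) (borel K) measurableT _ (open_meas (open_absv_lt (q m) (rho k))).
by rewrite setTI.
Qed.

Lemma meas_mul : measurable_fun setT (fun z : borel K * borel K => (z.1 : K) * z.2 : borel K).
Proof.
apply: (meas_map2 (h := fun x y => x * y)) => x y e e0.
set B := absv x + absv y + 1; have B1 : 1 <= B by rewrite /B lerDr addr_ge0.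
have B0 : 0 < B by apply: lt_le_trans B1.
set d := Num.min 1 (e / (2 * B)).
have d0 : 0 < d by rewrite /d lt_min ltr01 divr_gt0// mulr_gt0.
have d1 : d <= 1 by rewrite /d ge_min lexx.
have d2 : d * (2 * B) <= e by rewrite -ler_pdivlMr ?mulr_gt0// /d ge_min lexx orbT.
exists d => // x' y' hx hy.
have -> : x' * y' - x * y = (x' - x) * (y' - y) + ((x' - x) * y + x * (y' - y)) by ring.
apply: (le_lt_trans (absvD_le _ _)); rewrite absvM.
have := absvD_le ((x' - x) * y) (x * (y' - y)); rewrite !absvM.
move: hx hy (absv_ge0 (x' - x)) (absv_ge0 (y' - y)) (absv_ge0 x) (absv_ge0 y).
move: d2; rewrite /B; set X := absv (x' - x); set Y := absv (y' - y).
by move=> d2 hx hy X0 Y0 x0 y0 h; nra.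
Qed.

End Separable.

Lemma meas_mull a : measurable_fun setT (fun x : borel K => a * (x : K) : borel K).
Proof.
apply: (meas_map (h := fun x => a * x)) => x e e0.
exists (e / (absv a + 1)) => [|y]; first by rewrite divr_gt0// ltr_wpDl.
rewrite -mulrBr absvM ltr_pdivlMr ?ltr_wpDl// => h; apply: le_lt_trans h.
by rewrite mulrC ler_wpM2l// lerDl.
Qed.

Lemma meas_addr a : measurable_fun setT (fun x : borel K => (x : K) + a : borel K).
Proof.
apply: (meas_map (h := fun x => x + a)) => x e e0; exists e => // y.
by rewrite opprD addrACA subrr addr0.
Qed.

End BorelField.

Section SmallElements.
Variables (R : realType) (K : completeValuedFieldType R).
Hypothesis hnt : exists x : K, x != 0 /\ absv x != 1.

Definition oball (r : R) : set K := [set x | absv x < r].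

Lemma exists_small : exists2 p : K, p != 0 & absv p < 1.
Proof.
have [x [x0 x1]] := hnt; have [h|h|h] := ltrgtP (absv x) 1; last by rewrite h eqxx in x1.
  by exists x.
by exists x^-1; rewrite ?invr_eq0// absvV invf_lt1// absv_gt0.
Qed.

Lemma exists_absv_lt (e : R) : 0 < e -> exists2 x : K, x != 0 & absv x < e.
Proof.
move=> e0; have [p p0 p1] := exists_small.
have [n hn] : exists n, absv p ^+ n < e.
  have : (absv p ^+ n @[n --> \oo] --> 0) by apply: cvg_expr; rewrite ger0_norm.
  move=> /cvgrPdist_lt/(_ e e0)[N _ /(_ N (leqnn N))]; rewrite /= sub0r normrN.
  by rewrite ger0_norm ?exprn_ge0// => h; exists N.
by exists (p ^+ n); rewrite ?expf_neq0// absvX.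
Qed.

End SmallElements.

Record haar_data (R : realType) (K : completeValuedFieldType R)
    (mu : {measure set (borel K) -> \bar R}) (md : K -> R) := HaarData {
  hd_rat : {rmorphism rat -> K};
  hd_nt : exists x : K, x != 0 /\ absv x != 1;
  hd_seq : nat -> K;
  hd_dense : forall x (e : R), 0 < e -> exists n, absv (hd_seq n - x) < e;
  hd_haar : haar mu;
  hd_module : is_module mu md;
  hd_fin : exists2 r : R, 0 < r & (mu (@oball R K r) < +oo)%E;
  hd_char : exists x : K, addchar x != 1;
  hd_inv : forall f : K -> R[i], schwartz_bruhat f -> inv_fourier mu (fourier mu f) = f }.

Section HaarModule.
Variables (R : realType) (K : completeValuedFieldType R).
Variable mu : {measure set (borel K) -> \bar R}.
Variable md : K -> R.
Variable S : haar_data mu md.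
Local Notation hnt := (hd_nt S).
Local Notation hh := (hd_haar S).
Local Notation hmd := (hd_module S).
Local Notation hfin := (hd_fin S).
Local Notation oball := (@oball R K).
Implicit Types (x y a b t : K) (A B : set K).

Lemma open_oball r : open (oball r).
Proof.
have -> : oball r = [set x | absv (x - 0) < r]; last exact: open_absv_lt.
by apply/seteqP; split => x /=; rewrite /oball/= subr0.
Qed.

Lemma meas_oball r : measurable (oball r : set (borel K)).
Proof. by apply: open_meas; exact: open_oball. Qed.

Lemma mu_oball_gt0 r : 0 < r -> (0 < mu (oball r))%E.
Proof.
move=> r0; have [_ _ H] := hh; apply: H; first exact: open_oball.
by exists 0; rewrite /oball/= absv0.
Qed.

Lemma mu_preimage_add a A : measurable (A : set (borel K)) ->
  mu ((fun x => x + a) @^-1` A) = mu A.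
Proof.
move=> mA; have [H _ _] := hh; rewrite -(H (- a) A mA); congr (mu _).
apply/seteqP; split => [x /= Ax|_ [x Ax <-] /=]; last by rewrite addrAC addNr add0r.
by exists (x + a) => //; rewrite addrC addrK.
Qed.

Lemma mu_preimage_mul t A : t != 0 -> measurable (A : set (borel K)) ->
  mu ((fun x => t * x) @^-1` A) = ((md t^-1)%:E * mu A)%E.
Proof.
move=> t0 mA; rewrite -(hmd t^-1 mA); congr (mu _).
apply/seteqP; split => [x /= Ax|_ [x Ax <-] /=]; last by rewrite mulrA divff// mul1r.
by exists (t * x) => //; rewrite mulrA mulVf// mul1r.
Qed.

Lemma scale_oball t (r : R) : t != 0 -> [set t * x | x in oball r] = oball (absv t * r).
Proof.
move=> t0; apply/seteqP; split => [_ [x /= xr <-]|x /= xr].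
  by rewrite /oball/= absvM ltr_pM2l// absv_gt0.
exists (t^-1 * x); last by rewrite mulrA divff// mul1r.
by rewrite /oball/= absvM absvV mulrC ltr_pdivrMr ?absv_gt0// mulrC.
Qed.

Lemma mu_oball_lty r : (mu (oball r) < +oo)%E.
Proof.
have [r0 r00 fr] := hfin.
have [r1|r1] := leP r 0.
  rewrite (_ : oball r = set0) ?measure0//.
  by apply/seteqP; split => x //=; rewrite /oball/=; have := absv_ge0 x; lra.
have [x x0 xe] := @exists_absv_lt R K hnt (r0 / r) (divr_gt0 r00 r1).
pose r2 := absv x^-1 * r0.
have : (mu (oball r2) < +oo)%E.
  rewrite /r2 -scale_oball ?invr_eq0// hmd; last exact: meas_oball.
  have : (mu (oball r0) \is a fin_num) by rewrite ge0_fin_numE.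
  by move=> /fineK <-; rewrite -EFinM ltry.
apply: le_lt_trans; apply: le_measure; rewrite ?inE; try exact: meas_oball.
move=> y; rewrite /oball/= => yr; apply: lt_le_trans yr _.
rewrite /r2 absvV mulrC ler_pdivlMr ?absv_gt0// mulrC -ler_pdivlMr//; exact: ltW.
Qed.

Let r1 : (0 : R) < 1 := ltr01.
Let m1 : R := fine (mu (oball 1)).

Let m1E : mu (oball 1) = m1%:E.
Proof. by rewrite /m1 fineK// ge0_fin_numE// mu_oball_lty. Qed.

Let m1_gt0 : 0 < m1.
Proof. by rewrite -lte_fin -m1E mu_oball_gt0. Qed.

Lemma md_gt0 t : t != 0 -> 0 < md t.
Proof.
move=> t0; have := hmd t (meas_oball 1); rewrite scale_oball// mulr1 m1E => e.
have := @mu_oball_gt0 (absv t); rewrite absv_gt0 => /(_ t0).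
by rewrite e -EFinM lte_fin pmulr_lgt0.
Qed.

Lemma mdM_neq0 s t : s != 0 -> t != 0 -> md (s * t) = md s * md t.
Proof.
move=> s0 t0; have e1 := hmd t (meas_oball 1).
have := hmd s (meas_oball (absv t)); have := hmd (s * t) (meas_oball 1).
rewrite !scale_oball ?mulf_neq0// in e1 *; rewrite absvM !mulr1 in e1 * => ->.
by rewrite e1 m1E -!EFinM mulrA => -[] /(mulIf (lt0r_neq0 m1_gt0)).
Qed.

Lemma md_le1 t : t != 0 -> absv t <= 1 -> md t <= 1.
Proof.
move=> t0 t1; have e := hmd t (meas_oball 1); rewrite scale_oball// mulr1 m1E in e.
have : (mu (oball (absv t)) <= mu (oball 1))%E.
  apply: le_measure; rewrite ?inE; try exact: meas_oball.
  by move=> y; rewrite /oball/= => /lt_le_trans; exact.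
by rewrite e m1E -EFinM lee_fin ger_pMl.
Qed.

Lemma md_powR : exists2 c : R, 0 < c & forall t, t != 0 -> md t = absv t `^ c.
Proof.
have [] := @monotone_hom_powR R K (@absv R K) md.
- by move=> x; rewrite absv_gt0.
- exact: md_gt0.
- by move=> x y _ _; rewrite absvM.
- exact: mdM_neq0.
- exact: md_le1.
- by have [x [? ?]] := hnt; exists x.
move=> c c0 Hc; exists c => //; rewrite lt_def c0 andbT; apply/eqP => cE.
have mdE t : t != 0 -> md t = 1 by move=> /Hc ->; rewrite cE powRr0.
have h2 : (0 : R) < 2^-1 by rewrite invr_gt0.
have [x x0 xe] := exists_absv_lt hnt h2.
have ax0 : 0 < absv x / 2 by rewrite divr_gt0// absv_gt0.
have [y y0 ye] := exists_absv_lt hnt ax0.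
have muy : mu (oball (absv y)) = m1%:E.
  by rewrite -[absv y]mulr1 -scale_oball// hmd ?mdE// ?mul1e//; exact: meas_oball.
have [Htr _ _] := hh.
pose Bx : set K := [set x + z | z in oball (absv y)].
have mux : mu Bx = m1%:E.
  by rewrite /Bx Htr//; exact: meas_oball.
have mB : measurable (Bx : set (borel K)).
  rewrite (_ : Bx = [set z | absv (z - x) < absv y]).
    by apply: open_meas; exact: open_absv_lt.
  apply/seteqP; split => [_ [z zy <-]|z /= zy] /=; first by rewrite addrAC subrr add0r.
  by exists (z - x) => //; rewrite addrC subrK.
have : (mu (oball (absv y) `|` Bx) <= mu (oball 1))%E.
  apply: le_measure; rewrite ?inE; [|exact: meas_oball|].
    by apply: measurableU => //; exact: meas_oball.
  move=> z [|[w] wy <-]; rewrite /oball/=; first by move=> /lt_trans; apply; lra.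
  by apply: (le_lt_trans (absvD_le _ _)); move: wy; rewrite /oball/=; lra.
rewrite measureU//; last 2 first.
- exact: meas_oball.
- apply/seteqP; split => // z [zy [w wy wz]]; move: zy wy; rewrite -wz /oball/= => zy wy.
  by have := absvB_le (x + w) w; rewrite addrK; lra.
rewrite [X in (_ + X <= _)%E]mux [X in (X + _ <= _)%E]muy m1E.
rewrite -[X in (X <= _)%E]/((m1 + m1)%:E) lee_fin => h.
by have := m1_gt0; lra.
Qed.

Lemma mu_set0 : mu ([set 0] : set K) = 0%E.
Proof.
have [c c0 Hc] := md_powR.
apply/eqP; rewrite eq_le measure_ge0 andbT; apply/lee_addgt0Pr => e e0; rewrite add0e.
have : 0 < (e / m1) `^ c^-1 by rewrite powR_gt0// divr_gt0.
move=> /(exists_absv_lt hnt)[x x0 xe].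
have : (mu ([set 0%R] : set K) <= mu (oball (absv x)))%E.
  apply: le_measure; rewrite ?inE; [exact: meas_set1|exact: meas_oball|].
  by move=> _ ->; rewrite /oball/= absv0 absv_gt0.
move=> /le_trans; apply; rewrite -[absv x]mulr1 -scale_oball// hmd ?m1E; last exact: meas_oball.
rewrite -EFinM lee_fin -ler_pdivlMr// Hc//.
have -> : e / m1 = ((e / m1) `^ c^-1) `^ c.
  by rewrite -powRrM mulVf ?gt_eqF// powRr1// divr_ge0// ltW.
by apply: ge0_ler_powR; rewrite ?nnegrE ?powR_ge0 ?absv_ge0//; exact: ltW.
Qed.

Lemma md0 : md 0 = 0.
Proof.
have := hmd 0 (meas_oball 1); rewrite m1E (_ : [set _ | _ in _] = [set 0]); last first.
  apply/seteqP; split => [_ [x _ <-]|_ ->] /=; first by rewrite mul0r.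
  by exists 0; rewrite ?mul0r// /oball/= absv0.
rewrite mu_set0 -EFinM => -[/esym/eqP].
by rewrite mulf_eq0 (gt_eqF m1_gt0) orbF => /eqP.
Qed.

Lemma mdE : exists2 c : R, 0 < c & forall t, md t = absv t `^ c.
Proof.
have [c c0 Hc] := md_powR; exists c => // t; have [->|] := eqVneq t 0; last exact: Hc.
by rewrite md0 absv0 powR0// gt_eqF.
Qed.

Lemma md_ge0 t : 0 <= md t.
Proof. by have [c _ ->] := mdE; exact: powR_ge0. Qed.

Lemma mdM s t : md (s * t) = md s * md t.
Proof. by have [c _ H] := mdE; rewrite !H absvM powRM. Qed.

Lemma md1 : md 1 = 1.
Proof. by have [c _ ->] := mdE; rewrite absv1 powR1. Qed.

Lemma mdV t : md t^-1 = (md t)^-1.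
Proof.
have [->|t0] := eqVneq t 0; first by rewrite invr0 md0 invr0.
apply: (mulfI (lt0r_neq0 (md_gt0 t0))); rewrite -mdM !divff ?md1//.
by rewrite gt_eqF// md_gt0.
Qed.

Lemma mdN1 : md (- 1) = 1.
Proof. by have [c _ ->] := mdE; rewrite absvN absv1 powR1. Qed.

Lemma mdN t : md (- t) = md t.
Proof. by have [c _ H] := mdE; rewrite !H absvN. Qed.

Lemma meas_md : measurable_fun setT (md : borel K -> R).
Proof.
have [c _ H] := mdE; rewrite (_ : md = (@powR R ^~ c) \o (@absv R K)); last exact/funext.
by apply: measurableT_comp; [exact: measurable_powR|exact: meas_absv].
Qed.

Lemma sigma_finite_haar : sigma_finite setT mu.
Proof.
exists (fun n : nat => oball n%:R); last by move=> n; split; [exact: meas_oball|exact: mu_oball_lty].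
apply/seteqP; split => // x _; exists (Num.bound (absv x)) => //.
by rewrite /oball/=; exact: archi_boundP.
Qed.

Local Notation int u := (mu.-integrable setT (EFin \o (u : borel K -> R))).

Lemma Rint_add (u : K -> R) a : int u -> int (fun x => u (x + a)) /\
  \int[mu]_(x in setT) u ((x : K) + a) = \int[mu]_(x in setT) u x.
Proof.
move=> iu; have [] := @int_image R _ (borel K) mu (fun x => (x : K) + a) 1 (meas_addr a) ler01 _ u iu.
  by move=> A mA; rewrite mul1e mu_preimage_add.
by rewrite mul1r.
Qed.

Lemma Rint_mul (u : K -> R) t : t != 0 -> int u -> int (fun x => u (t * x)) /\
  \int[mu]_(x in setT) u (t * (x : K)) = (md t)^-1 * \int[mu]_(x in setT) u x.
Proof.
move=> t0 iu; apply: (@int_image R _ (borel K) mu (fun x => t * (x : K)) (md t)^-1 (meas_mull t) _ _ u iu).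
  by rewrite invr_ge0 md_ge0.
by move=> A mA; rewrite mu_preimage_mul// mdV.
Qed.

Lemma cint_add (f : K -> R[i]) a : cintegrable mu (f : borel K -> R[i]) ->
  cintegrable mu (fun x : borel K => f ((x : K) + a)) /\
  cintegral mu (fun x : borel K => f ((x : K) + a)) = cintegral mu (f : borel K -> R[i]).
Proof.
move=> iu; have [] := @cint_image R _ (borel K) mu (fun x => (x : K) + a) 1 (meas_addr a) ler01 _ f iu.
  by move=> A mA; rewrite mul1e mu_preimage_add.
by rewrite mul1r.
Qed.

Lemma cint_mul (f : K -> R[i]) t : t != 0 -> cintegrable mu (f : borel K -> R[i]) ->
  cintegrable mu (fun x : borel K => f (t * (x : K))) /\
  cintegral mu (fun x : borel K => f (t * (x : K))) = ((md t)^-1)%:C * cintegral mu (f : borel K -> R[i]).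
Proof.
move=> t0 iu; apply: (@cint_image R _ (borel K) mu (fun x => t * (x : K)) (md t)^-1 (meas_mull t) _ _ f iu).
  by rewrite invr_ge0 md_ge0.
by move=> A mA; rewrite mu_preimage_mul// mdV.
Qed.

End HaarModule.

Section CoverIntegrable.
Context {R : realType} {d : measure_display} {T : measurableType d}.
Variable mu : {measure set T -> \bar R}.

Lemma int_of_cover (u : T -> R) (w : nat -> R) (E : nat -> set T) (C r : R) (N : set T) :
  measurable_fun setT u -> (forall k, measurable (E k)) -> (forall k, 0 <= w k) ->
  (forall k, (w k)%:E * mu (E k) <= (C * r ^+ k)%:E)%E -> 0 <= C -> 0 < r < 1 ->
  measurable N -> mu N = 0%E -> (forall x, ~ N x -> u x != 0 -> exists2 k, E k x & `|u x| <= w k) ->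
  mu.-integrable setT (EFin \o u).
Proof.
move=> mu' mE w0 wE C0 /andP[r0 r1] mN N0 H.
apply/integrableP; split; first exact/measurable_EFinP.
pose g k x := ((w k)%:E * (\1_(E k) x)%:E)%E.
have g0 k x : (0 <= g k x)%E by rewrite /g mule_ge0 ?lee_fin.
have mg k : measurable_fun setT (g k).
  by apply: emeasurable_funM; [exact: measurable_cst|apply/measurable_EFinP; exact: measurable_indic].
apply: (@le_lt_trans _ _ (\int[mu]_x (\sum_(0 <= k <oo) g k x))%E).
  apply: ae_ge0_le_integral => //.
  - by apply: measurableT_comp => //; exact/measurable_EFinP.
  - by move=> x _; exact: nneseries_ge0.
  - exact: ge0_emeasurable_sum.
  exists N; split => // x /= nH; apply: contrapT => nN; apply: nH => _.
  have [->|ux] := eqVneq (u x) 0; first by rewrite normr0; exact: nneseries_ge0.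
  have [k Ekx uk] := H x nN ux.
  apply: le_trans (nneseries_lim_ge k.+1 _) => //.
  rewrite big_nat_recr//=; apply: le_trans (leeDr _ _); last exact: sume_ge0.
  by rewrite /g indicE mem_set// mule1 lee_fin.
rewrite integral_nneseries//.
apply: (@le_lt_trans _ _ (C * (1 - r)^-1)%:E); last exact: ltry.
apply: lime_le; first by apply: is_cvg_nneseries => k _ _; exact: integral_ge0.
near=> n; apply: (@le_trans _ _ (\sum_(0 <= k < n) (C * r ^+ k)%:E)%E).
  apply: lee_sum => k _; rewrite ge0_integralZl//.
  - by rewrite integral_indic// setIT.
  - by apply/measurable_EFinP; exact: measurable_indic.
  - by rewrite lee_fin.
rewrite sumEFin lee_fin; apply: geometric_le_lim => //.
by rewrite ger0_norm// ltW.
Unshelve. all: by end_near.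
Qed.

End CoverIntegrable.

Section RealPowers.
Variable R : realType.
Implicit Types (x e : R).

Lemma powR_1 e : 1 `^ e = 1 :> R. Proof. by rewrite powR1. Qed.

Lemma powR_lt1 x e : 0 < x < 1 -> 0 < e -> x `^ e < 1.
Proof.
move=> /andP[x0 x1] e0; rewrite -[ltRHS](powR_1 e).
by rewrite gt0_ltr_powR// nnegrE// ltW.
Qed.

Lemma powR_invl x e : 0 <= x -> x^-1 `^ e = x `^ (- e).
Proof. by move=> x0; rewrite -powR_inv1// -powRrM mulN1r. Qed.

Lemma powR_exprn x e n : 0 < x -> (x ^+ n) `^ e = (x `^ e) ^+ n.
Proof.
move=> x0; rewrite -(powR_mulrn n (ltW x0)) -(powR_mulrn n (powR_ge0 x e)).
by rewrite -powRrM -powRrM mulrC.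
Qed.

Lemma powR_bracket (P m : R) : 0 < P < 1 -> 0 < m <= 1 -> exists k, P ^+ k.+1 < m <= P ^+ k.
Proof.
move=> /andP[P0 P1] /andP[m0 m1].
have ex : exists n, P ^+ n < m.
  have : (P ^+ n @[n --> \oo] --> 0) by apply: cvg_expr; rewrite ger0_norm ?ltW.
  move=> /cvgrPdist_lt/(_ m m0)[n _ /(_ n (leqnn n))]; rewrite /= sub0r normrN.
  by rewrite ger0_norm ?exprn_ge0 ?ltW// => h; exists n.
case: (ex_minnP ex) => -[|n] hn hmin.
  by move: hn; rewrite expr0 ltNge m1.
exists n; rewrite hn /=; rewrite leNgt; apply/negP => /hmin.
by rewrite ltnn.
Qed.

End RealPowers.

Section Weights.
Variables (R : realType) (K : completeValuedFieldType R).
Variable mu : {measure set (borel K) -> \bar R}.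
Variable md : K -> R.
Variable S : haar_data mu md.
Implicit Types (x y a b t : K).
Local Notation int u := (mu.-integrable setT (EFin \o (u : borel K -> R))).
Definition mdball (r : R) : set K := [set x | md x <= r].

Hint Extern 0 (is_true (0 <= md _)) => exact: (md_ge0 S) : core.

Lemma meas_mdball (r : R) : measurable (mdball r : set (borel K)).
Proof.
have := (meas_md S) measurableT _ (@measurable_itv R `]-oo, r]); rewrite setTI.
by rewrite (_ : _ @^-1` _ = mdball r)//; apply/seteqP; split => x /=; rewrite in_itv.
Qed.

Lemma exists_md_lt1 : exists p : K, 0 < md p < 1.
Proof.
have [c c0 Hc] := mdE S; have [p p0 p1] := exists_small (hd_nt S).
exists p; rewrite (md_gt0 S)//= Hc -[ltRHS](powR_1 c).
by rewrite gt0_ltr_powR// nnegrE.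
Qed.

Lemma mu_mdball : exists2 V : R, 0 < V & forall t, t != 0 -> mu (mdball (md t)) = (md t * V)%:E.
Proof.
have [c c0 Hc] := mdE S.
have f1 : (mu (mdball 1) < +oo)%E.
  apply: le_lt_trans (mu_oball_lty S 2); apply: le_measure; rewrite ?inE.
  - exact: meas_mdball.
  - exact: meas_oball.
  move=> x; rewrite /mdball/oball/= Hc -[leRHS](powR_1 c) => h.
  have : absv x <= 1; last lra.
  rewrite leNgt; apply/negP => x1; move: h; apply/negP; rewrite -ltNge.
  by rewrite gt0_ltr_powR// nnegrE.
have p1 : (0 < mu (mdball 1))%E.
  apply: lt_le_trans (mu_oball_gt0 S (@ltr01 R)) _; apply: le_measure; rewrite ?inE.
  - exact: meas_oball.
  - exact: meas_mdball.
  move=> x; rewrite /mdball/oball/= Hc -[leRHS](powR_1 c) => h.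
  by rewrite ge0_ler_powR ?nnegrE// ltW.
have E1 : mu (mdball 1) = (fine (mu (mdball 1)))%:E by rewrite fineK// ge0_fin_numE.
exists (fine (mu (mdball 1))); first by rewrite fine_gt0// p1.
move=> t t0; rewrite EFinM -E1 -(hd_module S t); last exact: meas_mdball.
congr (mu _); apply/seteqP; split => [x|_ [x x1 <-]]; rewrite /mdball/=; last first.
  by rewrite (mdM S) ger_pMr// (md_gt0 S).
move=> xt; exists (t^-1 * x); last by rewrite mulrA divff// mul1r.
rewrite (mdM S) (mdV S) mulrC ler_pdivrMr ?(md_gt0 S)// mul1r//.
Qed.

Lemma meas_md_powR (a : R) : measurable_fun setT (fun x : borel K => md x `^ a).
Proof. by apply: (measurableT_comp (f := (@powR R ^~ a))) (meas_md S); exact: measurable_powR. Qed.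

Lemma meas0 : measurable ([set 0] : set (borel K)). Proof. exact: meas_set1. Qed.

Lemma mdX x n : md (x ^+ n) = md x ^+ n.
Proof. by elim: n => [|n IH]; rewrite ?expr0 ?(md1 S)// !exprS (mdM S) IH. Qed.

Lemma int_md_small (a : R) : 0 <= a < 1 -> int (fun x => if md x <= 1 then md x `^ (- a) else 0).
Proof.
move=> /andP[a0 a1]; have [p /andP[p0 p1]] := exists_md_lt1; have [V V0 HV] := mu_mdball.
have pn0 : p != 0 by apply/eqP => pE; rewrite pE (md0 S) ltxx in p0.
set P := md p in p0 p1.
apply: (@int_of_cover R _ (borel K) mu _ (fun k => (P ^+ k.+1) `^ (- a)) (fun k => mdball (P ^+ k))
  (P `^ (- a) * V) (P `^ (1 - a)) [set 0]).
- apply: measurable_fun_ifT; [|exact: meas_md_powR|exact: measurable_cst].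
  by apply: measurable_fun_ler; [exact: (meas_md S)|exact: measurable_cst].
- by move=> k; exact: meas_mdball.
- by move=> k; exact: powR_ge0.
- move=> k; rewrite -[P ^+ k](mdX p k) HV ?expf_neq0// mdX -EFinM lee_fin.
  rewrite powR_exprn// exprS (_ : P `^ (1 - a) = P * P `^ (- a)); last first.
    by rewrite powRD ?powRr1 ?(ltW p0)// (gt_eqF p0) implybT.
  rewrite exprMn -/P.
  by rewrite le_eqVlt; apply/orP; left; apply/eqP; ring.
- by rewrite mulr_ge0 ?powR_ge0// ltW.
- by rewrite powR_gt0//= powR_lt1 ?subr_gt0// p0.
- exact: meas0.
- exact: mu_set0 S.
move=> x /eqP x0; case: ifPn => x1; last by rewrite eqxx.
have [||k /andP[k1 k2] _] := @powR_bracket R P (md x); first by rewrite p0.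
  by rewrite (md_gt0 S).
exists k => //; rewrite ger0_norm ?powR_ge0//.
have e0 : 0 < P ^+ k.+1 by rewrite exprn_gt0.
rewrite !powRN lef_pV2 ?posrE ?powR_gt0 ?(md_gt0 S)//.
by apply: ge0_ler_powR; rewrite ?nnegrE//; exact: ltW.
Qed.

Lemma int_md_large (b : R) : 1 < b -> int (fun x => if md x <= 1 then 0 else md x `^ (- b)).
Proof.
move=> b1; have [p /andP[p0 p1]] := exists_md_lt1; have [V V0 HV] := mu_mdball.
have pn0 : p != 0 by apply/eqP => pE; rewrite pE (md0 S) ltxx in p0.
set P := md p in p0 p1.
apply: (@int_of_cover R _ (borel K) mu _ (fun k => (P ^+ k) `^ b) (fun k => mdball (P ^- k.+1))
  (P^-1 * V) (P `^ (b - 1)) [set 0]).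
- apply: measurable_fun_ifT; [|exact: measurable_cst|exact: meas_md_powR].
  by apply: measurable_fun_ler; [exact: (meas_md S)|exact: measurable_cst].
- by move=> k; exact: meas_mdball.
- by move=> k; exact: powR_ge0.
- move=> k; rewrite -[P ^+ k.+1](mdX p) -(mdV S) HV ?invr_eq0 ?expf_neq0// (mdV S) mdX -EFinM lee_fin.
  rewrite powR_exprn// exprS (_ : P `^ b = P `^ (b - 1) * P); last first.
    rewrite -{3}[P](powRr1 (ltW p0)) -powRD ?subrK//.
    by rewrite (gt_eqF p0) implybT.
  rewrite exprMn -/P le_eqVlt; apply/orP; left; apply/eqP; field.
  by rewrite gt_eqF//= expf_neq0// gt_eqF.
- by rewrite mulr_ge0 ?invr_ge0// ltW.
- by rewrite powR_gt0//= powR_lt1 ?subr_gt0// p0.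
- exact: meas0.
- exact: mu_set0 S.
move=> x /eqP x0; case: ifPn => x1; first by rewrite eqxx.
have m1 : 1 < md x by rewrite ltNge.
have [||k /andP[k1 k2] _] := @powR_bracket R P (md x)^-1; first by rewrite p0.
  by rewrite invr_gt0 (md_gt0 S)//= invf_le1 ?(md_gt0 S)// ltW.
exists k.
  by rewrite /mdball/= -[leLHS]invrK lef_pV2 ?posrE ?invr_gt0 ?exprn_gt0 ?(md_gt0 S)// ltW.
rewrite ger0_norm ?powR_ge0// -powR_invl//.
apply: ge0_ler_powR; rewrite ?nnegrE ?invr_ge0 ?exprn_ge0//; last exact: ltW.
by apply: ltW; apply: lt_trans b1.
Qed.

Definition wt (a b : R) x := (if md x <= 1 then md x `^ (- a) else 0) +
  (if md x <= 1 then 0 else md x `^ (- b)).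

Lemma int_wt (a b : R) : 0 <= a < 1 -> 1 < b -> int (wt a b).
Proof.
by move=> ha hb; exact: (integrableD measurableT (int_md_small ha) (int_md_large hb)).
Qed.

Lemma le_wt (a b : R) (m : R) x : x != 0 -> (md x <= 1 -> m <= md x `^ (- a)) ->
  (1 < md x -> m <= md x `^ (- b)) -> m <= wt a b x.
Proof.
by move=> x0; rewrite /wt; case: leP => h H1 H2; rewrite ?addr0 ?add0r; [exact: H1|exact: H2].
Qed.

Lemma absv1_powR : exists2 M : nat, (0 < M)%N & forall x,
  md x <= (1 + absv x) ^+ M.
Proof.
have [c c0 Hc] := mdE S; pose M := (Num.bound c).+1.
exists M => // x; rewrite Hc.
apply: (@le_trans _ _ ((1 + absv x) `^ c)).
  by apply: ge0_ler_powR; rewrite ?nnegrE ?addr_ge0 ?lerDr// ltW.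
rewrite -powR_mulrn ?addr_ge0//; apply: ler_powR; first by rewrite lerDl.
have := archi_boundP (ltW c0); rewrite /M -natr1 => h; apply: ltW; apply: lt_trans h _.
by rewrite ltrDl.
Qed.

Lemma int_absv1 : exists M : nat, forall N, (M <= N)%N -> int (fun x => (1 + absv x) ^- N).
Proof.
have [M M0 HM] := absv1_powR; exists (M + M)%N => N MN.
have iw : int (wt 0 2) by apply: int_wt; lra.
apply: le_int iw _.
  rewrite (_ : (fun x => _) = (@powR R ^~ (- N%:R)) \o (fun x : K => 1 + absv x)).
    apply: measurableT_comp; first exact: measurable_powR.
    by apply: measurable_funD; [exact: measurable_cst|exact: meas_absv].
  by apply/funext => x /=; rewrite powRN powR_mulrn// addr_ge0.
move=> x; have p0 := absv1X_gt0 x N; rewrite ger0_norm ?invr_ge0 ?(ltW p0)//.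
have [->|x0] := eqVneq x 0.
  by rewrite /wt (md0 S) ler01 addr0 oppr0 powRr0 absv0 addr0 expr1n invr1.
apply: le_wt => // h.
  by rewrite oppr0 powRr0 invf_le1// exprn_ege1// lerDl.
rewrite powRN lef_pV2 ?posrE ?powR_gt0 ?(md_gt0 S)//.
rewrite (@powR_mulrn R (md x) 2)// expr2.
apply: (@le_trans _ _ ((1 + absv x) ^+ (M + M))).
  by rewrite exprD ler_pM.
by apply: ler_weXn2l => //; rewrite lerDl.
Qed.

End Weights.

(** * Fourier transforms and the functional equation *)

Section FourierDecay.
Variables (R : realType) (K : completeValuedFieldType R).
Variable mu : {measure set (borel K) -> \bar R}.
Variable md : K -> R.
Variable S : haar_data mu md.
Implicit Types (x y a b t h : K) (f g : K -> R[i]).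
Local Notation int u := (mu.-integrable setT (EFin \o (u : borel K -> R))).
Local Notation cint f := (cintegrable mu (f : borel K -> R[i])).
Local Notation kmeas f := (cmeas (f : borel K -> R[i])).
Hint Extern 0 (is_true (0 <= md _)) => exact: (md_ge0 S) : core.

Lemma int_decays f (N : nat) (a : R) : kmeas f -> decays f -> 0 <= a < 1 ->
  int (fun x => (1 + absv x) ^+ N * cn (f x) * md x `^ (- a)).
Proof.
move=> mf df a01; have [M M0 HM] := absv1_powR S.
have [C C0 HC] := df (N + (M + M))%N.
have /andP[a0 a1] := a01.
have iw : int (wt md a 2) by apply: int_wt => //; lra.
apply: (@le_int_ae R _ _ mu _ (fun x => C * wt md a 2 x) [set 0]).
- exact: meas0.
- exact: (mu_set0 S).
- apply: measurable_funM; last exact: (meas_md_powR S).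
  apply: measurable_funM; last exact: cmeas_cn.
  apply: measurable_funX; apply: measurable_funD; [exact: measurable_cst|exact: meas_absv].
- exact: intZ.
move=> x /eqP x0; have p1 n := absv1X_gt0 x n.
rewrite ger0_norm; last by rewrite !mulr_ge0 ?powR_ge0// ltW.
have H : (1 + absv x) ^+ N * cn (f x) * (1 + absv x) ^+ (M + M) <= C.
  by rewrite mulrAC -exprD.
have H0 : 0 <= (1 + absv x) ^+ N * cn (f x) by rewrite mulr_ge0// ltW.
have P1 : 1 <= (1 + absv x) ^+ (M + M) by rewrite exprn_ege1// lerDl.
rewrite /wt; case: (leP (md x) 1) => mx; rewrite ?addr0 ?add0r.
  by rewrite ler_wpM2r ?powR_ge0//; apply: le_trans H; rewrite ler_peMr.
have a1' : md x `^ (- a) <= 1.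
  by rewrite powRN invf_le1 ?powR_gt0 ?(md_gt0 S)// -(powR_1 a) ge0_ler_powR ?nnegrE// ltW.
apply: (@le_trans _ _ ((1 + absv x) ^+ N * cn (f x))); first by rewrite ler_piMr.
rewrite powRN (@powR_mulrn R (md x) 2)// ler_pdivlMr ?exprn_gt0 ?(md_gt0 S)//.
apply: le_trans H; rewrite ler_wpM2l// expr2 exprD ler_pM//.
Qed.

Lemma cint_decays f : kmeas f -> decays f -> cint f.
Proof.
move=> mf df; have i := @int_decays f 0 0 mf df ltac:(by rewrite lexx ltr01).
apply: (cintegrable_le mf i) => x.
by rewrite oppr0 powRr0 mulr1 expr0 mul1r.
Qed.

Lemma int_absv_decays f : kmeas f -> decays f -> int (fun x => absv x * cn (f x)).
Proof.
move=> mf df; have i := @int_decays f 1 0 mf df ltac:(by rewrite lexx ltr01).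
apply: le_int i _ => [|x].
  by apply: measurable_funM; [exact: meas_absv|exact: cmeas_cn].
rewrite oppr0 powRr0 mulr1 expr1 ger0_norm ?mulr_ge0// ler_wpM2r// lerDr//.
Qed.

Lemma addchar_continuous : continuous (@addchar R K).
Proof.
move=> x; apply/continuous_cnP => e e0; have [C C0 HC] := addchar_dist (hd_rat S).
exists (e / C) => [|y]; first by rewrite divr_gt0.
by rewrite ltr_pdivlMr// mulrC; apply: le_lt_trans.
Qed.

Lemma cmeas_addchar {d} {T : measurableType d} (u : T -> borel K) :
  measurable_fun setT u -> cmeas (fun x : T => @addchar R K (u x)).
Proof.
by move=> mu'; apply: (cmeas_comp (f := (@addchar R K : borel K -> R[i]))) => //;
  apply: cmeas_continuous; exact: addchar_continuous.
Qed.

Lemma cint_addchar f y : cint f -> cint (fun x => f x * addchar (x * y)).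
Proof.
move=> cf; apply: (cintegrable_le _ (cintegrable_cn cf)) => [|x].
  apply: cmeasM; first exact: (cintegrable_meas cf).
  under eq_fun do rewrite mulrC.
  by apply: (cmeas_addchar (u := fun x : borel K => y * (x : K))); exact: meas_mull.
by rewrite cnM cn_addchar mulr1.
Qed.

Lemma cint_fourier f y : cint f -> cint (fun x => f x * addchar (- (x * y))).
Proof. by move=> cf; under eq_fun do rewrite -mulrN; exact: cint_addchar. Qed.

Lemma inv_fourierE f y : inv_fourier mu f y = fourier mu f (- y).
Proof. by rewrite /fourier; under [in RHS]eq_fun do rewrite mulrN opprK. Qed.

Lemma fourier_le f y : cint f -> cn (fourier mu f y) <= 2 * \int[mu]_(x in setT) cn (f x).
Proof.
move=> cf; apply: cintegral_le.
- exact: cintegrable_meas (cint_fourier y cf).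
- exact: cintegrable_cn.
- by move=> x; rewrite cnM cn_addchar mulr1.
Qed.

Lemma fourier_lip f : cint f -> int (fun x => absv x * cn (f x)) ->
  exists2 C : R, 0 <= C & forall y z, cn (fourier mu f y - fourier mu f z) <= C * absv (y - z).
Proof.
move=> cf xf; have [C C0 HC] := addchar_dist (hd_rat S).
set I := \int[mu]_(x in setT) (absv x * cn (f x)).
have I0 : 0 <= I by apply: Rintegral_ge0 => x _; rewrite mulr_ge0.
exists (2 * (C * I)) => [|y z]; first by rewrite !mulr_ge0// ltW.
rewrite /fourier -cintegralB; try exact: cint_fourier.
have E : 2 * (C * I) * absv (y - z) = 2 * \int[mu]_(x in setT) (C * absv (y - z) * (absv x * cn (f x))).
  by rewrite RintegralZl//; rewrite -/I; ring.
rewrite E; apply: cintegral_le.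
- by apply: cmeasB; apply: cintegrable_meas (cint_fourier _ cf).
- exact: intZ.
move=> x; rewrite -mulrBr cnM mulrC.
apply: (le_trans (ler_wpM2r (cn_ge0 _) (HC _ _))).
have -> : - ((x : K) * y) - - ((x : K) * z) = x * (z - y) by ring.
rewrite absvM [absv (z - y)]absvC le_eqVlt; apply/orP; left; apply/eqP; ring.
Qed.

Lemma lip_continuous f (C : R) : 0 <= C -> (forall y z, cn (f y - f z) <= C * absv (y - z)) ->
  continuous f.
Proof.
move=> C0 H x; apply/continuous_cnP => e e0; exists (e / (C + 1)) => [|y].
  by rewrite divr_gt0// ltr_wpDl.
rewrite ltr_pdivlMr ?ltr_wpDl// => h; apply: le_lt_trans (H _ _) _; apply: le_lt_trans h.
by rewrite mulrC ler_wpM2l// lerDl.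
Qed.

Lemma fourier_continuous f : cint f -> int (fun x => absv x * cn (f x)) -> continuous (fourier mu f).
Proof. by move=> cf xf; have [C C0] := fourier_lip cf xf; exact: lip_continuous. Qed.

Lemma fourier_shift f h y : cint f ->
  fourier mu (fun x => f (x + h)) y = addchar (h * y) * fourier mu f y.
Proof.
move=> cf; have [i e] := cint_add S h (cint_fourier y cf).
transitivity (addchar (h * y) * cintegral mu (fun x : borel K => f ((x : K) + h) * addchar (- (((x : K) + h) * y)))).
  apply: etrans (cintegralZ _ i); congr (cintegral mu _); apply/funext => x.
  rewrite mulrCA -addcharD; last exact: hd_rat S.
  by rewrite [((x : K) + h) * y]mulrDl opprD addrCA subrr addr0.
exact: (congr1 (fun z => addchar (h * y) * z) e).
Qed.

Lemma cint_Delta f h : cint f -> cint (Delta h f).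
Proof. by move=> cf; apply: cintegrableB => //; exact: (cint_add S h cf).1. Qed.

Lemma fourier_Delta f h y : cint f ->
  fourier mu (Delta h f) y = (addchar (h * y) - 1) * fourier mu f y.
Proof.
move=> cf; rewrite mulrBl mul1r -fourier_shift// /fourier -cintegralB.
- by congr cintegral; apply/funext => x; rewrite /Delta mulrBl.
- exact: (cint_fourier y (cint_add S h cf).1).
- exact: cint_fourier.
Qed.

Lemma fourier_iter_Delta N f h y : cint f -> cint (iter N (Delta h) f) /\
  fourier mu (iter N (Delta h) f) y = (addchar (h * y) - 1) ^+ N * fourier mu f y.
Proof.
move=> cf; elim: N => [|N [ih1 ih2]]; first by rewrite expr0 mul1r.
by split; [exact: cint_Delta|rewrite iterS fourier_Delta// ih2 exprS mulrA].
Qed.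

Lemma fourier_decays f : kmeas f -> decays f -> diff_decays f -> decays (fourier mu f).
Proof.
move=> mf df ddf M; have cf := cint_decays mf df.
have [h0 lh0] := hd_char S.
have h00 : h0 != 0 by apply: contraNneq lh0 => ->; rewrite addchar0//; exact: hd_rat S.
have r0 : 0 < absv h0 by rewrite absv_gt0.
have l0 : 0 < cn (addchar h0 - 1) by rewrite cn_gt0 subr_eq0.
have [M0 HM0] := int_absv1 S; have iM := HM0 M0 (leqnn _).
have [C C0 HC] := ddf M M0.
set I := \int[mu]_(x in setT) (1 + absv x) ^- M0 in iM.
have I0 : 0 <= I.
  by apply: Rintegral_ge0 => x _; rewrite invr_ge0 ltW// absv1X_gt0.
set J := \int[mu]_(x in setT) cn (f x).
have J0 : 0 <= J by exact: Rintegral_ge0.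
set A := (absv h0)^-1 + 1; have A0 : 0 <= A by rewrite addr_ge0// invr_ge0.
set D := cn (addchar h0 - 1) ^+ M in l0 *.
have D0 : 0 < D by rewrite exprn_gt0.
have P1 : 0 <= (1 + absv h0) ^+ M * (2 * J).
  by rewrite mulr_ge0 ?mulr_ge0// exprn_ge0// addr_ge0.
have P2 : 0 <= A ^+ M * (D^-1 * (2 * (C * absv h0 ^+ M * I))).
  by rewrite mulr_ge0 ?exprn_ge0// mulr_ge0 ?invr_ge0 ?(ltW D0)// !mulr_ge0// exprn_ge0.
exists ((1 + absv h0) ^+ M * (2 * J) + A ^+ M * (D^-1 * (2 * (C * absv h0 ^+ M * I)))) => [|y].
  exact: addr_ge0.
have [yr|yr] := ltP (absv y) (absv h0).
  apply: (@le_trans _ _ ((1 + absv h0) ^+ M * (2 * J))); last first.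
    by rewrite lerDl.
  rewrite ler_pM ?exprn_ge0 ?addr_ge0//; last exact: fourier_le.
  by rewrite lerXn2r ?nnegrE ?addr_ge0// lerD2l ltW.
have y0 : 0 < absv y by apply: lt_le_trans yr.
have yn0 : y != 0 by rewrite -absv_gt0.
pose h := h0 / y.
have h1 : absv h <= 1 by rewrite /h absvM absvV ler_pdivrMr// mul1r.
have [ci e] := fourier_iter_Delta M h y cf.
have H : D * cn (fourier mu f y) <= 2 * (C * absv h ^+ M * I).
  have -> : D * cn (fourier mu f y) = cn (fourier mu (iter M (Delta h) f) y).
    by rewrite e /h divfK// cnM cnX.
  rewrite -RintegralZl//; apply: cintegral_le.
  - exact: (cintegrable_meas (cint_fourier y ci)).
  - exact: intZ.
  move=> x; rewrite cnM cn_addchar mulr1 ler_pdivlMr ?absv1X_gt0// mulrC.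
  exact: HC.
apply: (@le_trans _ _ (A ^+ M * (D^-1 * (2 * (C * absv h0 ^+ M * I))))); last first.
  by rewrite lerDr ?mulr_ge0 ?exprn_ge0 ?addr_ge0.
apply: (@le_trans _ _ ((A * absv y) ^+ M * cn (fourier mu f y))).
  rewrite ler_wpM2r// lerXn2r ?nnegrE ?(mulr_ge0 A0 (absv_ge0 y)) ?addr_ge0//.
  rewrite /A mulrDl mul1r lerD2r ler_pdivlMl// mulr1 //.
rewrite [(A * _) ^+ _]exprMn -[X in X <= _]mulrA ler_wpM2l ?exprn_ge0// ler_pdivlMl//.
rewrite mulrCA; apply: (le_trans (ler_wpM2l (exprn_ge0 _ (ltW y0)) H)).
have -> : absv h0 ^+ M = absv h ^+ M * absv y ^+ M.
  by rewrite -exprMn /h absvM absvV divfK// gt_eqF.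
by rewrite le_eqVlt; apply/orP; left; apply/eqP; ring.
Qed.

Lemma cint_opp f : cint f -> cint (fun x => f (- x)) /\
  cintegral mu (fun x : borel K => f (- (x : K))) = cintegral mu (f : borel K -> R[i]).
Proof.
move=> cf; have N10 : (-1 : K) != 0 by rewrite oppr_eq0 oner_neq0.
have [] := cint_mul S N10 cf; rewrite (mdN1 S) invr1 mul1r.
have -> : (fun x : borel K => f (-1 * (x : K))) = fun x => f (- x).
  by apply/funext => x; rewrite mulN1r.
by move=> ? ?; split.
Qed.

Lemma sb_kmeas f : schwartz_bruhat f -> kmeas f.
Proof. by move=> sf; apply: cmeas_continuous; apply: sb_continuous sf. Qed.

Lemma sb_cint f : schwartz_bruhat f -> cint f.
Proof. by move=> sf; apply: cint_decays; [exact: sb_kmeas|exact: sb_decays sf]. Qed.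

Lemma sb_fourier_decays f : schwartz_bruhat f -> decays (fourier mu f).
Proof.
move=> sf; apply: fourier_decays; first exact: sb_kmeas.
  exact: sb_decays sf.
by apply: (sb_diff_decays (hd_rat S)) sf; exact: hd_char S.
Qed.

Lemma sb_fourier_continuous f : schwartz_bruhat f -> continuous (fourier mu f).
Proof.
move=> sf; apply: fourier_continuous; first exact: sb_cint.
by apply: int_absv_decays; [exact: sb_kmeas|exact: sb_decays sf].
Qed.

Lemma fourier_inv_fourier f : schwartz_bruhat f -> fourier mu (inv_fourier mu f) = f.
Proof.
move=> sf; rewrite -[RHS](hd_inv S sf); apply/funext => y.
rewrite inv_fourierE.
have -> : inv_fourier mu f = fun x => fourier mu f (- x) by apply/funext => x; exact: inv_fourierE.
have cF : cint (fourier mu f).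
  apply: cint_decays; last exact: sb_fourier_decays.
  by apply: cmeas_continuous; exact: sb_fourier_continuous.
apply: etrans (cint_opp (cint_fourier (- y) cF)).2; congr (cintegral mu _).
by apply/funext => x; rewrite mulrNN.
Qed.

End FourierDecay.

Opaque cintegral.

Section SigmaFiniteMeasure.
Context {R : realType} {d : measure_display} {T : measurableType d}.
Variable mu : {measure set T -> \bar R}.

(* [S] is a phantom argument: it lets the instances below find the proof of sigma-finiteness. *)
Definition sfmeasure (S : sigma_finite setT mu) : set T -> \bar R := mu.

Variable S : sigma_finite setT mu.
HB.instance Definition _ := Measure.copy (sfmeasure S) mu.
HB.instance Definition _ := Measure_isSigmaFinite.Build _ _ _ (sfmeasure S) S.

End SigmaFiniteMeasure.

Section FunctionalEquation.
Variables (R : realType) (K : completeValuedFieldType R).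
Variable mu : {measure set (borel K) -> \bar R}.
Variable md : K -> R.
Variable S : haar_data mu md.
Implicit Types (x y a b t h : K) (f g : K -> R[i]).
Local Notation int u := (mu.-integrable setT (EFin \o (u : borel K -> R))).
Local Notation cint f := (cintegrable mu (f : borel K -> R[i])).
Local Notation kmeas f := (cmeas (f : borel K -> R[i])).
Local Notation Int f := (cintegral mu (f : borel K -> R[i])).
Local Notation K2 := (borel K * borel K)%type.
Hint Extern 0 (is_true (0 <= md _)) => exact: (md_ge0 S) : core.

Lemma cfubini_haar (F : K -> K -> R[i]) (u : K -> R) :
  cmeas (fun z : K2 => F z.1 z.2) -> int u ->
  (forall x, x != 0 -> int (fun y => cn (F x y)) /\
     \int[mu]_(y in setT) cn (F x y) <= u x) ->
  [/\ cint (fun x => Int (F x)), cint (fun y => Int (F^~ y)) &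
      Int (fun x => Int (F x)) = Int (fun y => Int (F^~ y))].
Proof.
move=> mF iu H.
pose m := sfmeasure (sigma_finite_haar S).
apply: (@cfubini R _ _ (borel K) (borel K) m m F u [set 0]) => //.
- exact: meas0.
- exact: (mu_set0 S).
by move=> x /eqP; exact: H.
Qed.

Lemma cintegral_eq0 f g : kmeas f -> kmeas g -> (forall x, x != 0 -> f x = g x) -> Int f = Int g.
Proof.
move=> mf mg H; apply: (@cintegral_ae_eq R _ (borel K) mu _ _ [set 0]) => //.
- exact: meas0.
- exact: (mu_set0 S).
by move=> x /eqP; exact: H.
Qed.

Lemma cintegrable_le0 f (u : K -> R) : kmeas f -> int u -> (forall x, x != 0 -> cn (f x) <= u x) ->
  cint f.
Proof.
move=> mf iu H; apply: (@cintegrable_ae_le R _ (borel K) mu _ u [set 0]) => //.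
- exact: meas0.
- exact: (mu_set0 S).
by move=> x /eqP; exact: H.
Qed.

Lemma cmeas_fst f : kmeas f -> cmeas (fun z : K2 => f z.1).
Proof. by move=> mf; apply: (cmeas_comp (f := (f : borel K -> R[i]))). Qed.

Lemma cmeas_snd f : kmeas f -> cmeas (fun z : K2 => f z.2).
Proof. by move=> mf; apply: (cmeas_comp (f := (f : borel K -> R[i]))). Qed.

Lemma cmeas_mul f : kmeas f -> cmeas (fun z : K2 => f ((z.1 : K) * z.2)).
Proof.
move=> mf; apply: (cmeas_comp (f := (f : borel K -> R[i]))) => //.
exact: meas_mul (hd_dense S).
Qed.

Lemma meas_mulr a : measurable_fun setT (fun x : borel K => (x : K) * a : borel K).
Proof. by under eq_fun do rewrite mulrC; exact: meas_mull. Qed.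

Lemma meas_oppK : measurable_fun setT (fun x : borel K => - (x : K) : borel K).
Proof. by under eq_fun do rewrite -mulN1r; exact: meas_mull. Qed.

Lemma kmeas_addchar : kmeas (@addchar R K).
Proof. by apply: cmeas_continuous; exact: (addchar_continuous S). Qed.

Lemma fourier_mul_int f g t : cint f -> cint g -> kmeas (fourier mu f) ->
  cint (fun y => g y * fourier mu f (y * t)).
Proof.
move=> cf cg mF; set J := \int[mu]_(x in setT) cn (f x).
apply: (cintegrable_le _ (intZ (2 * J) (cintegrable_cn cg))) => [|y].
  apply: cmeasM; first exact: (cintegrable_meas cg).
  by apply: (cmeas_comp (f := (fourier mu f : borel K -> R[i]))) => //; exact: meas_mulr.
by rewrite cnM mulrC ler_wpM2r// (fourier_le S).
Qed.

Lemma fourier_mul_swap f g t : cint f -> cint g ->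
  Int (fun y => g y * fourier mu f (y * t)) = Int (fun y => f y * fourier mu g (y * t)).
Proof.
move=> cf cg.
pose F (y x : K) := g y * (f x * addchar (- (x * (y * t)))).
have mF : cmeas (fun z : K2 => F z.1 z.2).
  apply: cmeasM; first exact: (cmeas_fst (cintegrable_meas cg)).
  apply: cmeasM; first exact: (cmeas_snd (cintegrable_meas cf)).
  have mh : kmeas (fun x => addchar (- (x * t))).
    apply: (cmeas_comp (f := (@addchar R K : borel K -> R[i]))); first exact: kmeas_addchar.
    by apply: (measurableT_comp meas_oppK); exact: meas_mulr.
  rewrite (_ : (fun z : K2 => _) = (fun z : K2 => (fun x => addchar (- (x * t))) ((z.1 : K) * z.2))).
    exact: cmeas_mul mh.
  by apply/funext => z /=; congr (addchar (- _)); ring.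
set J := \int[mu]_(x in setT) cn (f x).
have [||_ _ e] := @cfubini_haar F (fun y => J * cn (g y)) mF.
- by apply: intZ; exact: cintegrable_cn.
- move=> y _; have -> : (fun x => cn (F y x)) = (fun x => cn (g y) * cn (f x)).
    by apply/funext => x; rewrite /F !cnM cn_addchar mulr1.
  have i := cintegrable_cn cf.
  split; first exact: intZ.
  by rewrite RintegralZl// mulrC.
transitivity (Int (fun y => Int (F y))).
  congr (cintegral mu _); apply/funext => y.
  exact: (esym (cintegralZ (g y) (cint_fourier S (y * t) cf))).
rewrite e; congr (cintegral mu _); apply/funext => x.
apply: etrans (cintegralZ (f x) (cint_fourier S (x * t) cg)).
by congr (cintegral mu _); apply/funext => y; rewrite /F mulrCA; congr (_ * (_ * addchar (- _))); ring.
Qed.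

Section Kernels.
Variables q th : K -> R[i].
Hypotheses (mq : kmeas q) (mth : kmeas th).
Hypothesis qM : forall x y, q (x * y) = q x * q y.
Hypothesis qth : forall y, y != 0 -> th y * (md y)%:C * q y = 1.

Lemma fourier_kernel_int f g : cint f -> cint g -> kmeas (fourier mu f) ->
  cint (fun y => fourier mu f y * q y) -> cint (fun y => g y * th y) ->
  Int (fun y => fourier mu f y * q y) * Int (fun y => g y * th y) =
  Int (fun t => q t * Int (fun y => g y * fourier mu f (y * t))).
Proof.
move=> cf cg mF ciq cth.
set D := Int (fun y => fourier mu f y * q y).
pose F (y t : K) := g y * (fourier mu f (y * t) * q t).
have q0 y : y != 0 -> q y != 0.
  by move=> /qth; apply: contra_eq_neq => ->; rewrite mulr0 eq_sym oner_neq0.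
have inner y : y != 0 -> (fun t => fourier mu f (y * t) * q t) =
    (fun t => (q y)^-1 * (fourier mu f (y * t) * q (y * t))).
  by move=> y0; apply/funext => t; rewrite qM; field; exact: q0.
have thE y : y != 0 -> th y = (q y)^-1 * ((md y)^-1)%:C.
  move=> y0; have m0 : (md y)%:C != 0 :> R[i] by rewrite -cn_gt0 cn_real normr_gt0 gt_eqF// (md_gt0 S).
  have mV : ((md y)^-1)%:C = ((md y)%:C)^-1 :> R[i] by rewrite fmorphV.
  apply: (mulIf (mulf_neq0 m0 (q0 y y0))); rewrite mulrA qth// mV -mulrA.
  by rewrite (mulKf m0) mulVf// q0.
have cin y : y != 0 -> cint (fun t => fourier mu f (y * t) * q t) /\
    g y * Int (fun t => fourier mu f (y * t) * q t) = g y * th y * D.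
  move=> y0; have [i e] := cint_mul S y0 ciq; rewrite inner//; split; first exact: cintegrableZ.
  by rewrite cintegralZ// e thE// !mulrA.
set J := \int[mu]_(x in setT) cn (fourier mu f x * q x).
have mF2 : cmeas (fun z : K2 => F z.1 z.2).
  apply: cmeasM; first exact: (cmeas_fst (cintegrable_meas cg)).
  by apply: cmeasM; [exact: (cmeas_mul mF)|exact: (cmeas_snd mq)].
have [||ci _ e] := @cfubini_haar F (fun y => J * cn (g y * th y)) mF2.
- by apply: intZ; exact: cintegrable_cn.
- move=> y y0; have [i _] := cin y y0.
  have [j ej] := Rint_mul S y0 (cintegrable_cn ciq).
  have E : (fun t => cn (F y t)) =
      (fun t => cn (g y) * (cn (q y))^-1 * cn (fourier mu f (y * t) * q (y * t))).
    apply/funext => t; rewrite /F cnM; have /(congr1 (fun u => u t)) -> := inner y y0.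
    by rewrite [cn (_^-1 * _)]cnM cnV mulrA.
  rewrite E; split; first exact: intZ.
  rewrite RintegralZl// ej -/J thE// !cnM cnV cn_real ger0_norm ?invr_ge0//.
  by rewrite le_eqVlt; apply/orP; left; apply/eqP; ring.
transitivity (Int (fun y => D * (g y * th y))); first exact: (esym (cintegralZ D cth)).
transitivity (Int (fun y => Int (F y))).
  apply: cintegral_eq0.
  - by apply: cintegrable_meas (cintegrableZ D cth).
  - exact: (cintegrable_meas ci).
  move=> y y0; have [i ei] := cin y y0.
  rewrite (_ : Int (F y) = g y * Int (fun t => fourier mu f (y * t) * q t)); last exact: cintegralZ.
  exact: (etrans (mulrC D _) (esym ei)).
rewrite e; congr (cintegral mu _); apply/funext => t.
apply: etrans (cintegralZ (q t) (fourier_mul_int t cf cg mF)).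
by congr (cintegral mu _); apply/funext => y; rewrite /F; ring.
Qed.

Theorem functional_equation f g : cint f -> cint g ->
  kmeas (fourier mu f) -> kmeas (fourier mu g) ->
  cint (fun y => fourier mu f y * q y) -> cint (fun y => fourier mu g y * q y) ->
  cint (fun y => f y * th y) -> cint (fun y => g y * th y) ->
  Int (fun y => fourier mu f y * q y) * Int (fun y => g y * th y) =
  Int (fun y => fourier mu g y * q y) * Int (fun y => f y * th y).
Proof.
move=> cf cg mf mg fq gq fth gth; apply: (etrans (fourier_kernel_int cf cg mf fq gth)).
apply: (etrans _ (esym (fourier_kernel_int cg cf mg gq fth))).
have E : (fun t => Int (fun y => g y * fourier mu f (y * t))) =
    (fun t => Int (fun y => f y * fourier mu g (y * t))).
  by apply/funext => t; exact: fourier_mul_swap.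
exact: (congr1 (fun P : K -> R[i] => Int (fun t => q t * P t)) E).
Qed.

End Kernels.
End FunctionalEquation.

Section Kernel.
Variables (R : realType) (K : completeValuedFieldType R).
Variable mu : {measure set (borel K) -> \bar R}.
Variable md : K -> R.
Variable S : haar_data mu md.
Implicit Types (x y a b t h : K) (f g psi : K -> R[i]) (z w : R[i]).
Local Notation int u := (mu.-integrable setT (EFin \o (u : borel K -> R))).
Local Notation cint f := (cintegrable mu (f : borel K -> R[i])).
Local Notation kmeas f := (cmeas (f : borel K -> R[i])).
Local Notation Int f := (cintegral mu (f : borel K -> R[i])).
Hint Extern 0 (is_true (0 <= md _)) => exact: (md_ge0 S) : core.

Lemma cpowE (r : R) z : cpow r z = cexp (z * (ln r)%:C).
Proof. by case: z => u v; rewrite /cpow /cexp/= !mulr0 subr0 add0r. Qed.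

Lemma cpowD (r : R) z w : cpow r (z + w) = cpow r z * cpow r w.
Proof. by rewrite !cpowE mulrDl cexpD. Qed.

Lemma cpow0 (r : R) : cpow r 0 = 1.
Proof. by rewrite cpowE mul0r cexp0. Qed.

Lemma cpow1 (r : R) : 0 < r -> cpow r 1 = r%:C.
Proof. by move=> r0; rewrite cpowE mul1r /cexp/= expi0 mulr1 lnK. Qed.

Lemma cpowM (r s : R) z : 0 < r -> 0 < s -> cpow (r * s) z = cpow r z * cpow s z.
Proof. by move=> r0 s0; rewrite !cpowE lnM// rmorphD/= mulrDr cexpD. Qed.

Lemma cn_cpow (r : R) z : 0 < r -> cn (cpow r z) = r `^ complex.Re z.
Proof.
move=> r0; rewrite cpowE cn_cexp /powR gt_eqF//; congr expR.
by case: z => u v /=; rewrite mulr0 subr0.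
Qed.

Lemma ln_dist1 (u : R) : `|u - 1| <= 2^-1 -> `|ln u| <= 2 * `|u - 1|.
Proof.
move=> h; have : - 2^-1 <= u - 1 by move: h; rewrite ler_norml => /andP[].
move=> h1; have u0 : 0 < u by lra.
have l1 : ln u <= u - 1.
  by rewrite -[in leLHS](subrKC 1 u); apply: le_ln1Dx; lra.
have l2 : - ln u <= 2 * `|u - 1|.
  have -> : - ln u = ln (1 + (u^-1 - 1)) by rewrite addrCA subrr addr0 lnV.
  have v0 : 0 < u^-1 by rewrite invr_gt0.
  apply: (@le_trans _ _ (u^-1 - 1)); first by apply: le_ln1Dx; lra.
  have -> : u^-1 - 1 = (1 - u) / u by field; rewrite gt_eqF.
  rewrite ler_pdivrMr//; have := ler_norm (1 - u); rewrite distrC => h2.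
  by have := normr_ge0 (u - 1); nra.
rewrite ler_norml; apply/andP; split; first lra.
by have := ler_norm (u - 1); have := normr_ge0 (u - 1); lra.
Qed.

Lemma cexpB1_le w : cn w <= 1 -> cn (cexp w - 1) <= (1 + 6 * expR 1) * cn w.
Proof.
move=> w1; have -> : cexp w - 1 = (cexp w - 1 - w) + w by rewrite subrK.
apply: (le_trans (cnD _ _)); rewrite mulrDl mul1r [leRHS]addrC lerD2r.
apply: (le_trans (cexpB1B_le w)); rewrite -mulrA -[leRHS]mulrA ler_wpM2l//.
rewrite expr2 -mulrA mulrC ler_wpM2r//.
by rewrite -[leRHS]mul1r ler_pM ?expR_ge0 ?ler_expR.
Qed.

Definition kpow psi z x : R[i] := if x == 0 then 0 else psi x * cpow (md x) z.

Section Character.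
Variable psi : K -> R[i].
Hypothesis hpsi : unitary_character psi.

Lemma cn_char x : x != 0 -> cn (psi x) = 1.
Proof. by move=> x0; have [_ H _] := hpsi; apply: cn_inj; exact: H. Qed.

Lemma char_neq0 x : x != 0 -> psi x != 0.
Proof. by move=> x0; rewrite -cn_gt0 cn_char. Qed.

Lemma char1 : psi 1 = 1.
Proof.
have [H _ _] := hpsi; have n0 := oner_neq0 K.
by apply: (mulfI (char_neq0 n0)); rewrite -H// !mulr1.
Qed.

Lemma unitary_characterV : unitary_character (fun x => (psi x)^-1).
Proof.
have [H1 H2 H3] := hpsi; split.
- by move=> x y x0 y0; rewrite H1// invfM.
- by move=> x x0; rewrite normfV H2// invr1.
move=> x x0; apply/continuous_cnP => e e0.
have /continuous_cnP H := H3 x x0; have [d d0 Hd] := H e e0.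
exists (Num.min d (absv x)); first by rewrite lt_min d0 absv_gt0.
move=> y; rewrite lt_min => /andP[yd yx].
have y0 : y != 0 by apply: contraTneq yx => ->; rewrite sub0r absvN ltxx.
have -> : (psi y)^-1 - (psi x)^-1 = (psi x - psi y) / (psi x * psi y).
  by field; rewrite !char_neq0.
by rewrite cnM cnV cnM !cn_char// mulr1 invr1 mulr1 cnC Hd.
Qed.

Lemma kpow0 z : kpow psi z 0 = 0. Proof. by rewrite /kpow eqxx. Qed.

Lemma kpowE z x : x != 0 -> kpow psi z x = psi x * cpow (md x) z.
Proof. by move=> x0; rewrite /kpow (negPf x0). Qed.

Lemma kpowM z x y : kpow psi z (x * y) = kpow psi z x * kpow psi z y.
Proof.
have [->|x0] := eqVneq x 0; first by rewrite mul0r kpow0 mul0r.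
have [->|y0] := eqVneq y 0; first by rewrite mulr0 kpow0 mulr0.
have [H _ _] := hpsi; rewrite !kpowE ?mulf_neq0// H// (mdM S) cpowM ?(md_gt0 S)//.
by rewrite mulrACA.
Qed.

Lemma cn_kpow z x : x != 0 -> cn (kpow psi z x) = md x `^ complex.Re z.
Proof. by move=> x0; rewrite kpowE// cnM cn_char// mul1r cn_cpow// (md_gt0 S). Qed.

Lemma kpow_neq0 z x : x != 0 -> kpow psi z x != 0.
Proof. by move=> x0; rewrite -cn_gt0 cn_kpow// powR_gt0// (md_gt0 S). Qed.

Lemma kpow_near1 z (e : R) : 0 < e ->
  exists2 d : R, 0 < d & forall t, absv t < d -> cn (kpow psi z (1 + t) - 1) < e.
Proof.
move=> e0; have [c c0 Hc] := mdE S.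
have [_ _ /(_ 1 (oner_neq0 K))/continuous_cnP H] := hpsi.
have e2 : 0 < e / 2 by rewrite divr_gt0.
have [d1 d10 Hd1] := H _ e2.
set E := 1 + 6 * expR 1 : R; have E0 : 0 < E by rewrite addr_gt0// mulr_gt0// expR_gt0.
set A := 2 * c * (cn z + 1); have A0 : 0 < A by rewrite !mulr_gt0// ltr_wpDl.
set d2 := Num.min 2^-1 (Num.min A^-1 (e / 2 / (E * A))).
have EA : 0 < e / 2 / (E * A) by rewrite divr_gt0 ?(mulr_gt0 E0).
have i2 : (0 : R) < 2^-1 by rewrite invr_gt0.
have d20 : 0 < d2 by rewrite /d2 !lt_min EA i2 invr_gt0 A0.
have [d2a d2b d2c] : [/\ d2 <= 2^-1, d2 <= A^-1 & d2 <= e / 2 / (E * A)].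
  by rewrite /d2 !ge_min !lexx !orbT.
exists (Num.min d1 d2) => [|t]; first by rewrite lt_min d10.
rewrite lt_min => /andP[td1 td2].
have t1 : absv t < 1 by lra.
have n0 : 1 + t != 0.
  by apply: contraTneq t1 => /(canRL (addKr _)) ->; rewrite addr0 absvN absv1 ltxx.
rewrite kpowE//.
have -> : psi (1 + t) * cpow (md (1 + t)) z - 1 =
   psi (1 + t) * (cpow (md (1 + t)) z - 1) + (psi (1 + t) - psi 1) by rewrite char1; ring.
apply: (le_lt_trans (cnD _ _)).
have h1 : cn (psi (1 + t) - psi 1) < e / 2 by apply: Hd1; rewrite addrAC subrr add0r.
suff h2 : cn (psi (1 + t) * (cpow (md (1 + t)) z - 1)) <= e / 2 by lra.
rewrite cnM cn_char// mul1r cpowE.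
set L := ln (md (1 + t)).
have Lb : cn (z * L%:C) <= A * d2.
  rewrite cnM cn_real /L Hc ln_powR normrM (gtr0_norm c0).
  have b1 : `|absv (1 + t) - 1| <= d2.
    have := absv_dist (1 + t) 1; rewrite absv1 [1 + t - 1]addrAC subrr add0r => h.
    by apply: (le_trans h); exact: ltW.
  have := ln_dist1 (le_trans b1 d2a) => b2.
  have b3 : `|ln (absv (1 + t))| <= 2 * d2 by lra.
  rewrite mulrCA (_ : A * d2 = c * ((cn z + 1) * (2 * d2))); last by rewrite /A; ring.
  by rewrite ler_wpM2l ?(ltW c0)// ler_pM// lerDl.
have L1 : A * d2 <= 1 by rewrite -ler_pdivlMl// mulr1.
apply: (le_trans (cexpB1_le (le_trans Lb L1))); rewrite -/E.
apply: (@le_trans _ _ (E * (A * d2))); first by rewrite ler_wpM2l// ltW.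
by rewrite mulrA [E * A * _]mulrC -ler_pdivlMr ?(mulr_gt0 E0 A0).
Qed.

Lemma kmeas_kpow z : kmeas (kpow psi z).
Proof.
apply: cmeas_continuous_neq0 => x x0; apply/continuous_cnP => e e0.
have k0 : 0 < cn (kpow psi z x) by rewrite cn_gt0 kpow_neq0.
have [d d0 Hd] := kpow_near1 z (divr_gt0 e0 k0).
have ax : 0 < absv x by rewrite absv_gt0.
exists (d * absv x) => [|y]; first by rewrite mulr_gt0.
move=> yx; have -> : y = x * (1 + (y - x) / x) by field.
have -> : kpow psi z (x * (1 + (y - x) / x)) - kpow psi z x =
  kpow psi z x * (kpow psi z (1 + (y - x) / x) - 1) by rewrite kpowM; ring.
rewrite cnM mulrC -ltr_pdivlMr//; apply: Hd.
by rewrite absvM absvV ltr_pdivrMr.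
Qed.

Lemma cint_kpow f z : kmeas f -> (forall a : R, 0 <= a < 1 -> int (fun x => cn (f x) * md x `^ (- a))) ->
  -1 < complex.Re z <= 0 -> cint (fun x => f x * kpow psi z x).
Proof.
move=> mf df hz; have a01 : 0 <= - complex.Re z < 1 by lra.
apply: (cintegrable_le0 S) (df _ a01) _.
  by apply: cmeasM => //; exact: kmeas_kpow.
by move=> x x0; rewrite cnM cn_kpow// opprK.
Qed.

End Character.

Lemma int_decays0 f (a : R) : kmeas f -> decays f -> 0 <= a < 1 ->
  int (fun x => cn (f x) * md x `^ (- a)).
Proof.
move=> mf df ha; have := int_decays S 0 mf df ha.
by under eq_fun do rewrite expr0 mul1r.
Qed.

Lemma kpow_dual psi s x : unitary_character psi -> x != 0 ->
  kpow (fun x => (psi x)^-1) (- s) x * (md x)%:C * kpow psi (s - 1) x = 1.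
Proof.
move=> hpsi x0; have m0 := md_gt0 S x0.
have E : cpow (md x) (- s) * (md x)%:C * cpow (md x) (s - 1) = 1.
  by rewrite -(cpow1 m0) -!cpowD (_ : - s + 1 + (s - 1) = 0) ?cpow0//; ring.
rewrite !kpowE//; have c0 : psi x != 0 by exact: char_neq0.
move: E c0; move: (cpow _ _) (cpow _ _) (psi x) (_%:C) => u v c m E c0.
rewrite -E; set f := (X in X = _).
by rewrite /f -!mulrA [_^-1 * _]mulrCA [c^-1 * _]mulrCA; congr (_ * (_ * _)); rewrite mulKf.
Qed.

End Kernel.

Section Nonvanishing.
Variables (R : realType) (K : completeValuedFieldType R).
Variable mu : {measure set (borel K) -> \bar R}.
Variable md : K -> R.
Variable S : haar_data mu md.
Implicit Types (x y a b t h : K) (f g psi : K -> R[i]) (z w : R[i]).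
Local Notation int u := (mu.-integrable setT (EFin \o (u : borel K -> R))).
Local Notation cint f := (cintegrable mu (f : borel K -> R[i])).
Local Notation kmeas f := (cmeas (f : borel K -> R[i])).
Local Notation Int f := (cintegral mu (f : borel K -> R[i])).
Hint Extern 0 (is_true (0 <= md _)) => exact: (md_ge0 S) : core.

Lemma RintD (u v : K -> R) : int u -> int v ->
  \int[mu]_(x in setT) (u x + v x) = \int[mu]_(x in setT) u x + \int[mu]_(x in setT) v x.
Proof. by move=> iu iv; exact: RintegralD. Qed.

Lemma RintZ (r : R) (u : K -> R) : int u ->
  \int[mu]_(x in setT) (r * u x) = r * \int[mu]_(x in setT) u x.
Proof. by move=> iu; exact: RintegralZl. Qed.

Lemma sb_int_neq0 f x0 : schwartz_bruhat f -> f x0 != 0 ->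
  exists2 g, schwartz_bruhat g & Int g != 0.
Proof.
move=> sf fx0; pose g x := f x * (f x)^*%C.
have sg : schwartz_bruhat g by apply: sbM => //; exact: sb_conj.
exists g => //; have ig := sb_cint S sg.
have gE x : complex.Re (g x) = cn (f x) ^+ 2.
  have : (cn (f x) ^+ 2)%:C = g x by rewrite rmorphXn/= -normE normCK.
  by move=> <-.
have p0 : 0 < cn (f x0) by rewrite cn_gt0.
have p2 : 0 < cn (f x0) / 2 by rewrite divr_gt0.
have cf := sb_continuous sf.
have /continuous_cnP H := cf x0; have [d d0 Hd] := H _ p2.
pose U : set K := [set x | absv (x - x0) < d].
have oU : open U by exact: open_absv_lt.
have mU : measurable (U : set (borel K)) := open_meas oU.
have muU : (0 < mu U)%E.
  by have [_ _ HU] := hd_haar S; apply: HU => //; exists x0; rewrite /U/= subrr absv0.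
have fU : (mu U < +oo)%E.
  apply: le_lt_trans (mu_oball_lty S (absv x0 + d)); apply: le_measure; rewrite ?inE//.
    exact: meas_oball.
  move=> x; rewrite /U/oball/= => xU.
  by have := absvD_le (x - x0) x0; rewrite subrK; lra.
set e := (cn (f x0) / 2) ^+ 2; have e0 : 0 < e by rewrite exprn_gt0.
have EU : (\int[mu]_x ((\1_U : borel K -> R) x)%:E = mu U)%E.
  by rewrite integral_indic// setIT.
have iU : int (fun x => e * \1_U x).
  apply: intZ; apply/integrableP; split.
    by apply/measurable_EFinP; exact: measurable_indic.
  suff -> : (\int[mu]_x `|(EFin \o (\1_U : borel K -> R)) x| = mu U)%E by [].
  rewrite -EU; apply: eq_integral => x _ /=.
  by rewrite ger0_norm// indicE.
have LB : e * fine (mu U) <= \int[mu]_(x in setT) complex.Re (g x).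
  have <- : \int[mu]_(x in setT) (e * \1_U x) = e * fine (mu U).
    rewrite /Rintegral; under eq_integral do rewrite EFinM.
    rewrite ge0_integralZl ?lee_fin ?(ltW e0)//.
    - by rewrite [X in (_ * X)%E]EU -[X in (_ * X)%E]fineK// ge0_fin_numE.
    - by apply/measurable_EFinP; exact: measurable_indic.
  apply: cintegral_ge0_le => //; first exact: ig.1.
  move=> x; rewrite gE indicE; case: (boolP (x \in U)) => [|_]; last by rewrite mulr0 sqr_ge0.
  rewrite inE mulr1 => /Hd; rewrite cnC => h.
  rewrite lerXn2r ?nnegrE ?(ltW p2)//.
  by have := cnD (f x0 - f x) (f x); rewrite subrK; lra.
apply/eqP => I0; move: LB; apply/negP; rewrite -ltNge.
have -> : \int[mu]_(x in setT) complex.Re (g x) = complex.Re (Int g) by [].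
by rewrite I0 /= mulr_gt0// fine_gt0// muU.
Qed.

Lemma kpow_neq0_test psi z f : unitary_character psi -> -1 < complex.Re z <= 0 ->
  schwartz_bruhat f -> Int f != 0 ->
  exists2 g, schwartz_bruhat g & Int (fun x => g x * kpow md psi z x) != 0.
Proof.
move=> hpsi hz sf If; apply: contrapT => nex.
have ig g : schwartz_bruhat g -> cint (fun x => g x * kpow md psi z x).
  move=> sg; apply: (cint_kpow S hpsi) hz; first exact: sb_kmeas.
  move=> a ha; apply: (int_decays0 S) ha; first exact: sb_kmeas.
  exact: sb_decays sg.
have zero g : schwartz_bruhat g -> Int (fun x => g x * kpow md psi z x) = 0.
  by move=> sg; apply/eqP/negPn/negP => h; apply: nex; exists g.
have cf := sb_cint S sf; have mf := sb_kmeas sf; have df := sb_decays sf.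
set k := kpow md psi z.
have mk : kmeas k by exact: (kmeas_kpow S hpsi).
have kM x y : k (x * y) = k x * k y := kpowM S hpsi z x y.
set a := - complex.Re z; have a01 : 0 <= a < 1 by rewrite /a; lra.
have zero1 x0 : x0 != 0 -> cint (fun v : K => f v * k (1 + v / x0)) /\
    Int (fun v : K => f v * k (1 + v / x0)) = 0.
  move=> x00; have sg := sb_trans (- x0) sf.
  have [i e] := cint_add S x0 (ig _ sg); rewrite zero// in e.
  have E : (fun v : K => f v * k (1 + v / x0)) =
     (fun v : K => (k x0)^-1 * (f (v + x0 - x0) * k (v + x0))).
    apply/funext => v; rewrite addrK mulrCA; congr (_ * _).
    have -> : v + x0 = x0 * (1 + v / x0) by field.
    by rewrite kM mulKf// (kpow_neq0 S hpsi).
  rewrite E; split; first exact: cintegrableZ.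
  by rewrite cintegralZ// e mulr0.
have [M M0 HM] := absv1_powR S.
set N := M.+1.
have iN : int (fun x => (1 + absv x) ^+ N * cn (f x)).
  have := int_decays S N mf df (ltac:(by rewrite lexx ltr01) : 0 <= (0 : R) < 1).
  by rewrite (_ : (fun x => _) = (fun x => (1 + absv x) ^+ N * cn (f x)))//; apply/funext => x; rewrite oppr0 powRr0 mulr1.
have [C C0 HC] := df N.
pose sm x : R := if md x <= 1 then md x `^ (- a) else 0.
have ism : int sm by exact: (int_md_small S a01).
set I0 := \int[mu]_(x in setT) cn (f x).
set IN := \int[mu]_(x in setT) ((1 + absv x) ^+ N * cn (f x)).
set Is := \int[mu]_(x in setT) sm x.
have I00 : 0 <= I0 by exact: Rintegral_ge0.
have IN0 : 0 <= IN.
  by apply: Rintegral_ge0 => x _; rewrite mulr_ge0// ltW// absv1X_gt0.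
have sm0 x : 0 <= sm x by rewrite /sm; case: ifP => // _; exact: powR_ge0.
have Is0 : 0 <= Is by exact: Rintegral_ge0.
have kbd x : x != 0 -> cn (k x) <= sm x + 1.
  move=> x0; rewrite /k (cn_kpow S hpsi)// /sm; case: (leP (md x) 1) => m1.
    by rewrite /a opprK lerDl.
  rewrite add0r -[complex.Re z]opprK -/a powRN invf_le1 ?powR_gt0 ?(md_gt0 S)//.
  by rewrite -(powR_1 a) ge0_ler_powR ?nnegrE//; [case/andP: a01|exact: ltW].
have nI : 0 < cn (Int f) by rewrite cn_gt0.
set e := cn (Int f) / (4 * (I0 + 1)).
have e0 : 0 < e by rewrite divr_gt0// mulr_gt0// ltr_wpDl.
have [d d0 Hd] := kpow_near1 S hpsi z e0.
set B := C * Is + IN; have B0 : 0 <= B by rewrite addr_ge0// mulr_ge0.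
(* a contradiction for [x0] far enough out and [e] as chosen *)
have key x0 : 1 <= absv x0 -> cn (Int f) <= 2 * (e * I0 + (d * absv x0) ^- N * (IN + (1 + absv x0) ^+ M * B)).
  move=> x01; have x0p : 0 < absv x0 by lra.
  have x00 : x0 != 0 by rewrite -absv_gt0.
  have [ic z0] := zero1 x0 x00.
  have -> : Int f = Int (fun v : K => f v - f v * k (1 + v / x0)) by rewrite cintegralB// z0 subr0.
  clear z0.
  have [ish _] := Rint_add S x0 ism.
  pose u (v : K) := e * cn (f v) + (d * absv x0) ^- N * ((1 + absv v) ^+ N * cn (f v) +
     (1 + absv x0) ^+ M * (C * sm (v + x0) + (1 + absv v) ^+ N * cn (f v))).
  have iu : int u.
    apply: intD; first by apply: intZ; exact: cintegrable_cn.
    by do 2!(apply: intZ; apply: intD => //); do ?apply: intZ.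
  pose Nf (v : K) := (1 + absv v) ^+ N * cn (f v).
  set D := (d * absv x0) ^- N; set P := (1 + absv x0) ^+ M.
  have dx0 : 0 < d * absv x0 by rewrite mulr_gt0.
  have D0 : 0 <= D by rewrite invr_ge0 exprn_ge0// ltW.
  have P0 : 0 <= P by rewrite ltW// absv1X_gt0.
  have i1 := cintegrable_cn cf.
  have i4 : int (fun v : K => C * sm (v + x0) + Nf v) by apply: intD => //; exact: intZ.
  have i5 : int (fun v : K => Nf v + P * (C * sm (v + x0) + Nf v)) by apply: intD => //; exact: intZ.
  have -> : e * I0 + D * (IN + P * B) = \int[mu]_(x in setT) u x.
    have i6 := intZ C ish.
    have e6 : \int[mu]_(x in setT) (C * sm (x + x0)) = C * Is by rewrite (RintZ _ ish) (Rint_add S x0 ism).2.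
    have e4 : \int[mu]_(x in setT) (C * sm (x + x0) + Nf x) = B by rewrite (RintD i6 iN) e6.
    have e5 : \int[mu]_(x in setT) (Nf x + P * (C * sm (x + x0) + Nf x)) = IN + P * B.
      by rewrite (RintD iN (intZ P i4)) (RintZ _ i4) e4.
    by rewrite /u (RintD (intZ e i1) (intZ D i5)) (RintZ _ i1) (RintZ _ i5) e5.
  apply: cintegral_le => //; first exact: cmeasB mf (cintegrable_meas ic).
  move=> v; set Q := v / x0.
  have Nf0 : 0 <= Nf v by rewrite mulr_ge0// ltW// absv1X_gt0.
  have DN0 : 0 <= D * (Nf v + P * (C * sm (v + x0) + Nf v)).
    by rewrite mulr_ge0// addr_ge0// mulr_ge0// addr_ge0// mulr_ge0.
  have -> : f v - f v * k (1 + Q) = f v * (1 - k (1 + Q)) by ring.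
  rewrite cnM.
  have [vd|vd] := ltP (absv Q) d.
    have := Hd _ vd; rewrite cnC => /ltW h.
    apply: le_trans (_ : cn (f v) * e <= _); first by rewrite ler_wpM2l.
    by rewrite /u mulrC lerDl.
  have fN : cn (f v) <= D * Nf v.
    rewrite mulrC ler_pdivlMr ?exprn_gt0// mulrC ler_wpM2r//.
    rewrite lerXn2r ?nnegrE ?(ltW dx0) ?addr_ge0//.
    move: vd; rewrite /Q absvM absvV ler_pdivlMr// => h; apply: (le_trans h).
    by rewrite lerDr.
  have kx0 : (cn (k x0))^-1 <= P.
    rewrite /k (cn_kpow S hpsi)// -powRN -/a; have /andP[a0 a1] := a01.
    case: (leP (md x0) 1) => m1.
      apply: (@le_trans _ _ 1); last by rewrite exprn_ege1// lerDl.
      by rewrite -(powR_1 a) ge0_ler_powR ?nnegrE.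
    apply: le_trans (HM x0); rewrite -[leRHS]powRr1//.
    by apply: ler_powR; exact: ltW.
  have k1 : cn (k (1 + Q)) <= P * (sm (v + x0) + 1).
    have [->|n0] := eqVneq (1 + Q) 0; first by rewrite /k kpow0 cn0 mulr_ge0// addr_ge0.
    have E : v + x0 = x0 * (1 + Q) by rewrite /Q; field.
    have vn : v + x0 != 0 by rewrite E mulf_neq0.
    have -> : k (1 + Q) = (k x0)^-1 * k (v + x0) by rewrite E kM mulKf// (kpow_neq0 S hpsi).
    by rewrite cnM cnV ler_pM ?invr_ge0// kbd.
  have h1 : cn (1 - k (1 + Q)) <= 1 + P * (sm (v + x0) + 1).
    by apply: (le_trans (cnB _ _)); rewrite cn1 lerD2l.
  apply: le_trans (_ : D * (Nf v + P * (C * sm (v + x0) + Nf v)) <= _); last first.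
    by rewrite /u lerDr mulr_ge0// ltW.
  apply: le_trans (ler_pM (cn_ge0 _) (cn_ge0 _) fN h1) _.
  rewrite -mulrA ler_wpM2l// mulrDr mulr1 lerD2l mulrCA ler_wpM2l//.
  by rewrite mulrDr mulr1 lerD2r ler_wpM2r// HC.
set Q := d ^- N * 2 ^+ M * (IN + B) + 1.
have Q0 : 0 < Q.
  by rewrite ltr_wpDl// mulr_ge0 ?addr_ge0// mulr_ge0 ?exprn_ge0// invr_ge0 exprn_ge0// ltW.
have t0 : 0 < Num.min 1 (cn (Int f) / (8 * Q)).
  by rewrite lt_min ltr01 divr_gt0// mulr_gt0.
have [p p0] := exists_absv_lt (hd_nt S) t0; rewrite lt_min => /andP[p1 p2].
have ap : 0 < absv p by rewrite absv_gt0.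
have X1 : 1 <= absv p^-1 by rewrite absvV invf_ge1// ltW.
have := key _ X1; rewrite absvV in X1 *; set X := (absv p)^-1 in X1 *.
apply/negP; rewrite -ltNge.
have X0 : 0 < X by rewrite invr_gt0.
have hI : e * I0 <= cn (Int f) / 4.
  have -> : cn (Int f) / 4 = e * (I0 + 1) by rewrite /e; field; rewrite gt_eqF// ltr_wpDl.
  by rewrite ler_wpM2l ?(ltW e0)// lerDl.
have h1 : (d * X) ^- N * (IN + (1 + X) ^+ M * B) <= Q * absv p.
  have hX : IN + (1 + X) ^+ M * B <= (2 * X) ^+ M * (IN + B).
    have X2 : 1 + X <= 2 * X by lra.
    rewrite [leRHS]mulrDr lerD//; first by rewrite ler_peMl// exprn_ege1//; lra.
    by rewrite ler_wpM2r// lerXn2r ?nnegrE//; lra.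
  have dX : 0 <= (d * X) ^- N by rewrite invr_ge0 exprn_ge0// mulr_ge0// ltW.
  apply: (le_trans (ler_wpM2l dX hX)).
  have -> : (d * X) ^- N * ((2 * X) ^+ M * (IN + B)) = (d ^- N * 2 ^+ M * (IN + B)) * absv p.
    rewrite !exprMn invfM -[absv p]invrK -/X /N [X ^+ M.+1]exprS.
    by field; rewrite !expf_neq0 ?gt_eqF.
  by rewrite ler_wpM2r ?(ltW ap)// /Q lerDl.
have h2 : Q * absv p < cn (Int f) / 8.
  by move: p2; rewrite ltr_pdivlMr ?mulr_gt0// => h; rewrite ltr_pdivlMr//; lra.
by lra.
Qed.

End Nonvanishing.

(** * Derivatives in the exponent *)

Section ComplexDerivative.
Variable R : realType.
Implicit Types (z w D g b : R[i]) (A B G Z : R[i] -> R[i]).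

Definition qderiv Z z D := exists2 C : R, 0 <= C & exists2 e : R, 0 < e &
  forall w, cn w <= e -> cn (Z (z + w) - Z z - w * D) <= C * cn w ^+ 2.

Lemma qderiv_ext A B z D (e : R) : 0 < e -> (forall w, cn w <= e -> A (z + w) = B (z + w)) ->
  qderiv A z D -> qderiv B z D.
Proof.
move=> e0 AB [C C0 [e1 e10 H]]; exists C => //; exists (Num.min e e1); first by rewrite lt_min e0.
have AB0 : A z = B z by rewrite -[z]addr0 AB// cn0 ltW.
by move=> w; rewrite le_min => /andP[we we1]; rewrite -AB// -AB0; exact: H.
Qed.

Lemma qderivN Z z D : qderiv Z (- z) D -> qderiv (fun s => Z (- s)) z (- D).
Proof.
move=> [C C0 [e e0 H]]; exists C => //; exists e => // w we.
have := H (- w); rewrite cnN => /(_ we).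
by rewrite -opprD mulrN mulNr.
Qed.

Lemma qderiv_shift Z z D a : qderiv Z (z + a) D -> qderiv (fun s => Z (s + a)) z D.
Proof.
move=> [C C0 [e e0 H]]; exists C => //; exists e => // w we.
by have := H _ we; rewrite [z + w + a]addrAC.
Qed.

Lemma qderiv_uniq Z z D1 D2 : qderiv Z z D1 -> qderiv Z z D2 -> D1 = D2.
Proof.
move=> [C1 C10 [e1 e10 H1]] [C2 C20 [e2 e20 H2]]; apply/eqP; rewrite -subr_eq0 -cn_eq0.
apply/negPn/negP => n0; set d := cn (D1 - D2) in n0.
have d0 : 0 < d by rewrite lt_def n0 cn_ge0.
set C := C1 + C2 + 1; have C0 : 0 < C by rewrite ltr_wpDl ?addr_ge0.
set t := Num.min e1 (Num.min e2 (d / (2 * C))).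
have t0 : 0 < t by rewrite /t !lt_min e10 e20 divr_gt0// mulr_gt0.
have [t1 t2 t3] : [/\ t <= e1, t <= e2 & t <= d / (2 * C)] by rewrite /t !ge_min !lexx !orbT.
have ct : cn t%:C = t by rewrite cn_real gtr0_norm.
have := H1 t%:C; have := H2 t%:C; rewrite ct => /(_ t2) h2 /(_ t1) h1.
have : t * d <= (C1 + C2) * t ^+ 2.
  rewrite /d -{1}ct -cnM.
  have -> : t%:C * (D1 - D2) = (Z (z + t%:C) - Z z - t%:C * D2) - (Z (z + t%:C) - Z z - t%:C * D1) by ring.
  by apply: (le_trans (cnB _ _)); rewrite mulrDl addrC lerD.
move: t3; rewrite ler_pdivlMr ?mulr_gt0// /C => t3 h.
have h3 : t * (t * (2 * (C1 + C2 + 1))) <= t * d by rewrite ler_wpM2l// ltW.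
have : 0 < t * t by rewrite mulr_gt0.
have : 0 <= (C1 + C2) * (t * t) by rewrite mulr_ge0 ?addr_ge0// mulr_ge0// ltW.
move: h h3; rewrite expr2; move: (C1 + C2) => C3; nra.
Qed.

Lemma qderiv_expand Z z D : qderiv Z z D -> exists2 C : R, 0 <= C & exists2 e : R, 0 < e <= 1 &
  forall w, cn w <= e -> exists2 r, Z (z + w) = Z z + w * D + r & cn r <= C * cn w ^+ 2.
Proof.
move=> [C C0 [e e0 H]]; exists C => //; exists (Num.min e 1).
  by rewrite lt_min e0 ltr01 ge_min lexx orbT.
move=> w; rewrite le_min => /andP[we _]; exists (Z (z + w) - Z z - w * D); last exact: H.
by ring.
Qed.

Lemma qderivM A B z D1 D2 : qderiv A z D1 -> qderiv B z D2 ->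
  qderiv (fun s => A s * B s) z (D1 * B z + A z * D2).
Proof.
move=> /qderiv_expand[C1 C10 [e1 /andP[e10 e11] H1]] /qderiv_expand[C2 C20 [e2 /andP[e20 e21] H2]].
set a := A z; set b := B z.
exists ((cn a + cn D1 + C1) * C2 + C1 * (cn b + cn D2) + cn D1 * cn D2).
  by rewrite !addr_ge0 ?mulr_ge0 ?addr_ge0.
exists (Num.min e1 e2) => [|w]; first by rewrite lt_min e10.
rewrite le_min => /andP[w1 w2].
have [r1 -> hr1] := H1 w w1; have [r2 -> hr2] := H2 w w2; rewrite -/a -/b.
have -> : (a + w * D1 + r1) * (b + w * D2 + r2) - a * b - w * (D1 * b + a * D2) =
  (a + w * D1 + r1) * r2 + r1 * (b + w * D2) + w * w * (D1 * D2) by ring.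
move: hr1 hr2; have wl : cn w <= 1 by lra.
have w0 := cn_ge0 w; set q := cn w ^+ 2 => hr1 hr2.
have q0 : 0 <= q by rewrite sqr_ge0.
have q1 : q <= 1 by rewrite expr_le1.
have wD D : cn (w * D) <= cn D by rewrite cnM ler_piMl.
have h1 : cn (a + w * D1 + r1) <= cn a + cn D1 + C1.
  apply: (le_trans (cnD _ _)); apply: lerD.
    by apply: (le_trans (cnD _ _)); rewrite lerD2l.
  by apply: (le_trans hr1); rewrite ler_piMr.
have h2 : cn (b + w * D2) <= cn b + cn D2 by apply: (le_trans (cnD _ _)); rewrite lerD2l.
apply: (le_trans (cnD _ _)); rewrite [leRHS]mulrDl lerD//; last by rewrite !cnM mulrC -expr2.
apply: (le_trans (cnD _ _)); rewrite [leRHS]mulrDl !cnM lerD//.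
  by rewrite -mulrA ler_pM.
by rewrite mulrAC ler_pM.
Qed.

Lemma qderiv_lower B z D : qderiv B z D -> B z != 0 -> exists2 e : R, 0 < e &
  forall w, cn w <= e -> cn (B z) / 2 <= cn (B (z + w)).
Proof.
move=> /qderiv_expand[C C0 [e /andP[e0 e1] H]] b0; set b := B z.
have cb : 0 < cn b by rewrite cn_gt0.
set E := 2 * (cn D + C + 1); have E0 : 0 < E by rewrite mulr_gt0// ltr_wpDl// addr_ge0.
exists (Num.min e (cn b / E)) => [|w]; first by rewrite lt_min e0 divr_gt0.
rewrite le_min ler_pdivlMr// => /andP[we wE]; have [r -> hr] := H w we.
rewrite -/b; have w0 := cn_ge0 w; have D0 := cn_ge0 D.
have hq : cn w ^+ 2 <= cn w by rewrite expr2 ler_piMl//; lra.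
have h1 : cn (w * D + r) <= cn w * (cn D + C).
  apply: (le_trans (cnD _ _)); rewrite cnM mulrDr lerD//.
  by apply: (le_trans hr); rewrite mulrC ler_wpM2r.
have h2 : cn b <= cn (b + w * D + r) + cn (w * D + r).
  apply: le_trans (cnB _ _); rewrite le_eqVlt; apply/orP; left; apply/eqP.
  by congr cn; ring.
by move: wE; rewrite /E; nra.
Qed.

Lemma qderiv_div A B G z D1 D2 (e : R) : 0 < e -> (forall w, cn w <= e -> A (z + w) = G (z + w) * B (z + w)) ->
  qderiv A z D1 -> qderiv B z D2 -> B z != 0 -> qderiv G z ((D1 - G z * D2) / B z).
Proof.
move=> e0 AGB qA qB b0; have [e3 e30 Hlow] := qderiv_lower qB b0.
move: qA qB => /qderiv_expand[C1 C10 [e1 /andP[e10 e11] H1]] /qderiv_expand[C2 C20 [e2 /andP[e20 e21] H2]].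
set b := B z in b0 Hlow *; set g := G z; set D := (D1 - g * D2) / b.
have cb : 0 < cn b by rewrite cn_gt0.
set C := C1 + cn g * C2 + cn D * (cn D2 + C2).
have C0 : 0 <= C by rewrite !addr_ge0 ?mulr_ge0 ?addr_ge0.
exists (C / (cn b / 2)); first by rewrite divr_ge0// divr_ge0.
exists (Num.min e (Num.min e1 (Num.min e2 e3))) => [|w]; first by rewrite !lt_min e0 e10 e20.
rewrite !le_min => /and4P[we w1 w2 w3].
have low := Hlow w w3; have B0 : 0 < cn (B (z + w)) by apply: lt_le_trans low; rewrite divr_gt0.
have Bn0 : B (z + w) != 0 by rewrite -cn_gt0.
have Az : A z = g * b by rewrite -[z]addr0 AGB ?cn0 ?addr0// ltW.
have [r1 E1 hr1] := H1 w w1; have [r2 E2 hr2] := H2 w w2.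
have Gw : G (z + w) = A (z + w) / B (z + w) by rewrite AGB// mulfK.
have w0 := cn_ge0 w; have wl : cn w <= 1 by lra.
set q := cn w ^+ 2 in hr1 hr2 *; have q0 : 0 <= q by rewrite sqr_ge0.
have qw : q <= cn w by rewrite /q expr2 ler_piMl.
have num : G (z + w) - g - w * D = (r1 - g * r2 - w * D * (w * D2 + r2)) / B (z + w).
  apply: (mulIf Bn0); rewrite divfK// Gw !mulrBl divfK// E1 E2 Az -/b.
  have -> : D1 = D * b + g * D2 by rewrite /D divfK// subrK.
  by ring.
rewrite num cnM cnV ler_pdivrMr// .
apply: (@le_trans _ _ (C * q)); last first.
  have -> : C * q = C / (cn b / 2) * q * (cn b / 2) by field; rewrite gt_eqF.
  by rewrite ler_wpM2l// mulr_ge0// divr_ge0// divr_ge0.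
apply: (le_trans (cnB _ _)); rewrite [leRHS]mulrDl lerD//.
  apply: (le_trans (cnB _ _)); rewrite [leRHS]mulrDl cnM lerD//.
  by rewrite -mulrA ler_wpM2l.
rewrite cnM [cn (w * D)]cnM; apply: (@le_trans _ _ (cn w * cn D * (cn w * (cn D2 + C2)))).
  rewrite ler_wpM2l ?mulr_ge0//; apply: (le_trans (cnD _ _)).
  by rewrite cnM mulrDr lerD// (le_trans hr2)// mulrC ler_wpM2r.
by rewrite le_eqVlt; apply/orP; left; apply/eqP; rewrite /q; ring.
Qed.

Lemma derive1_qderiv Z z D : qderiv Z z D -> derive1 Z z = D.
Proof.
move=> [C C0 [e e0 H]]; rewrite /derive1; apply: ccvg_lim.
apply/cvg_cnP => d d0.
set dd := Num.min e (d / (C + 1)).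
have dd0 : 0 < dd by rewrite /dd lt_min e0 divr_gt0// ltr_wpDl.
change (nbhs (0 : R[i]) (fun t : R[i] => t != 0 -> cn (t^-1 *: (Z (t + z) - Z z) - D) < d)).
apply/nbhs_ballP; exists dd%:C; first by rewrite /= ltcR.
move=> t; rewrite /ball/= sub0r normrN normE ltcR lt_min => /andP[te td] t0.
have ct : 0 < cn t by rewrite cn_gt0.
have -> : t^-1 *: (Z (t + z) - Z z) - D = t^-1 * (Z (z + t) - Z z - t * D).
  by rewrite [in RHS]mulrBr mulKf// [t + z]addrC.
rewrite cnM cnV ltr_pdivrMl//; apply: (le_lt_trans (H t (ltW te))).
rewrite expr2 mulrCA ltr_pM2l//; move: td; rewrite ltr_pdivlMr ?ltr_wpDl// => td.
by apply: le_lt_trans td; rewrite mulrC ler_wpM2l ?(ltW ct)// lerDl.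
Qed.

End ComplexDerivative.

Section KernelDerivative.
Variables (R : realType) (K : completeValuedFieldType R).
Variable mu : {measure set (borel K) -> \bar R}.
Variable md : K -> R.
Variable S : haar_data mu md.
Implicit Types (x y a b t h : K) (f g psi : K -> R[i]) (z w : R[i]).
Local Notation int u := (mu.-integrable setT (EFin \o (u : borel K -> R))).
Local Notation cint f := (cintegrable mu (f : borel K -> R[i])).
Local Notation kmeas f := (cmeas (f : borel K -> R[i])).
Local Notation Int f := (cintegral mu (f : borel K -> R[i])).
Hint Extern 0 (is_true (0 <= md _)) => exact: (md_ge0 S) : core.

Lemma le_expR_abs (e L : R) : 0 < e -> `|L| <= e^-1 * expR (e * `|L|).
Proof.
move=> e0; rewrite ler_pdivlMl//; have := expR_ge1Dx (e * `|L|); lra.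
Qed.

Lemma sqr_le_expR_abs (e L : R) : 0 < e -> L ^+ 2 <= (4 / e ^+ 2) * expR (e * `|L|).
Proof.
move=> e0; have e2 : 0 < e / 2 by rewrite divr_gt0.
have := le_expR_abs L e2; set E := expR _ => h.
have -> : expR (e * `|L|) = E * E by rewrite /E -expRD; congr expR; field.
have -> : 4 / e ^+ 2 * (E * E) = ((e / 2)^-1 * E) ^+ 2 by field; rewrite gt_eqF.
by rewrite -[L ^+ 2]real_normK ?num_real// lerXn2r ?nnegrE// mulr_ge0 ?invr_ge0 ?expR_ge0// ltW.
Qed.

Lemma expR_ln_abs (e r : R) : 0 < r -> 0 < e -> expR (e * `|ln r|) <= r `^ e + r `^ (- e).
Proof.
move=> r0 e0; rewrite /powR gt_eqF//; case: (lerP 0 (ln r)) => h.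
  by rewrite ger0_norm// lerDl expR_ge0.
by rewrite ltr0_norm// mulNr mulrN lerDr expR_ge0.
Qed.

Section Character.
Variable psi : K -> R[i].
Hypothesis hpsi : unitary_character psi.
Variable f : K -> R[i].
Hypothesis mf : kmeas f.
Hypothesis intf : forall a : R, 0 <= a < 1 -> int (fun x => cn (f x) * md x `^ (- a)).

Lemma meas_ln_md : measurable_fun setT (fun x : borel K => ln (md x)).
Proof. by apply: (measurableT_comp (f := @ln R)) (meas_md S); exact: measurable_ln. Qed.

Lemma kpow_majorant z : -1 < complex.Re z < 0 -> exists2 e : R, 0 < e &
  exists2 u : K -> R, int u /\ (forall x, 0 <= u x) & forall x, x != 0 ->
    cn (f x) * md x `^ complex.Re z * expR (2 * e * `|ln (md x)|) <= u x.
Proof.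
move=> hz; set a := - complex.Re z; have ha : 0 < a < 1 by rewrite /a; lra.
set e := Num.min (a / 4) ((1 - a) / 4).
have e0 : 0 < e by rewrite lt_min !divr_gt0//; lra.
have [e1 e2] : e <= a / 4 /\ e <= (1 - a) / 4 by rewrite /e !ge_min !lexx orbT.
clearbody e.
exists e => //; exists (fun x => cn (f x) * md x `^ (- (a - 2 * e)) + cn (f x) * md x `^ (- (a + 2 * e))).
  split; first by apply: intD; apply: intf; lra.
  by move=> x; rewrite addr_ge0// mulr_ge0// powR_ge0.
move=> x x0; have m0 := md_gt0 S x0.
have ee : 0 < 2 * e by lra.
apply: le_trans (ler_wpM2l _ (expR_ln_abs m0 ee)) _; first by rewrite mulr_ge0 ?powR_ge0.
rewrite -[leRHS]mulrDr -mulrA ler_wpM2l// mulrDr.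
rewrite -!powRD ?(gt_eqF m0) ?implybT//.
by rewrite le_eqVlt; apply/orP; left; apply/eqP; congr (_ `^ _ + _ `^ _); rewrite /a; ring.
Qed.

Lemma cint_ln_kpow z : -1 < complex.Re z < 0 ->
  cint (fun x => (ln (md x))%:C * f x * kpow md psi z x).
Proof.
move=> hz; have [e e0 [u [iu up] hu]] := kpow_majorant hz.
have ee : 0 < 2 * e by rewrite mulr_gt0.
apply: (cintegrable_le0 S) (intZ (2 * e)^-1 iu) _.
  apply: cmeasM; last exact: (kmeas_kpow S hpsi).
  by apply: cmeasM => //; apply: cmeas_real; exact: meas_ln_md.
move=> x x0; rewrite !cnM cn_real (cn_kpow S hpsi)//.
apply: (@le_trans _ _ ((2 * e)^-1 * expR (2 * e * `|ln (md x)|) * cn (f x) * md x `^ complex.Re z)).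
  by rewrite !ler_wpM2r ?powR_ge0// le_expR_abs.
have := hu x x0; set E := expR _ => h.
rewrite (_ : _ * _ = (2 * e)^-1 * (cn (f x) * md x `^ complex.Re z * E)); last by ring.
by rewrite ler_wpM2l// invr_ge0 ltW.
Qed.

Lemma qderiv_kpow z : -1 < complex.Re z < 0 ->
  qderiv (fun z => Int (fun x => f x * kpow md psi z x)) z
    (Int (fun x => (ln (md x))%:C * f x * kpow md psi z x)).
Proof.
move=> hz; have [e e0 [u [iu up] hu]] := kpow_majorant hz.
set e1 := Num.min e (Num.min (- complex.Re z) (1 + complex.Re z) / 2).
have e10 : 0 < e1 by rewrite lt_min e0 divr_gt0// lt_min; lra.
have [e1e [e1a e1b]] : e1 <= e /\ (e1 <= - complex.Re z / 2 /\ e1 <= (1 + complex.Re z) / 2).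
  by rewrite /e1 !ge_min !lexx ?minr_pMl// !ge_min !lexx !orbT.
clearbody e1.
have u0 : 0 <= \int[mu]_(x in setT) u x.
  by apply: Rintegral_ge0.
set A := 6 * (4 / e ^+ 2).
have A0 : 0 <= A by rewrite mulr_ge0// divr_ge0// exprn_ge0// ltW.
exists (2 * (A * \int[mu]_(x in setT) u x)); first by rewrite mulr_ge0// mulr_ge0.
exists e1 => // w we1.
have we : cn w <= e by lra.
have rw := cn_Re w; have hzw : -1 < complex.Re (z + w) < 0.
  have -> : complex.Re (z + w) = complex.Re z + complex.Re w by case: z w {hz hu e1a e1b we1 we rw} => ? ? [].
  by move: rw; rewrite ler_norml; lra.
have [i0 i1] : cint (fun x => f x * kpow md psi z x) /\ cint (fun x => f x * kpow md psi (z + w) x).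
  by split; apply: (cint_kpow S hpsi) => //; lra.
have i2 := cint_ln_kpow hz.
rewrite -cintegralB// -cintegralZ// -cintegralB//; last 2 first.
- exact: cintegrableB.
- exact: cintegrableZ.
have -> : 2 * (A * \int[mu]_(x in setT) u x) * cn w ^+ 2 = 2 * \int[mu]_(x in setT) (A * cn w ^+ 2 * u x).
  by rewrite (RintZ _ iu); ring.
apply: cintegral_le.
- by apply: cintegrable_meas; apply: cintegrableB; [exact: cintegrableB i1 i0|exact: cintegrableZ].
- exact: intZ.
move=> x; have [->|x0] := eqVneq x 0.
  by rewrite !kpow0 !mulr0 subr0 subr0 cn0 mulr_ge0// mulr_ge0// sqr_ge0.
set L := ln (md x).
have -> : f x * kpow md psi (z + w) x - f x * kpow md psi z x - w * (L%:C * f x * kpow md psi z x) =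
    f x * kpow md psi z x * (cexp (w * L%:C) - 1 - w * L%:C).
  by rewrite !kpowE// cpowD -(cpowE (md x) w); ring.
rewrite !cnM (cn_kpow S hpsi)//.
have wL : cn (w * L%:C) <= e * `|L| by rewrite cnM cn_real ler_wpM2r.
have h1 : cn (cexp (w * L%:C) - 1 - w * L%:C) <= A * cn w ^+ 2 * expR (2 * e * `|L|).
  apply: (le_trans (cexpB1B_le _)).
  have -> : expR (2 * e * `|L|) = expR (e * `|L|) * expR (e * `|L|) by rewrite -expRD; congr expR; ring.
  apply: (@le_trans _ _ (6 * cn (w * L%:C) ^+ 2 * expR (e * `|L|))).
    by rewrite ler_wpM2l ?mulr_ge0 ?sqr_ge0// ler_expR.
  rewrite cnM cn_real exprMn real_normK ?num_real//.
  have := sqr_le_expR_abs L e0; set E := expR _ => h2.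
  have -> : A * cn w ^+ 2 * (E * E) = 6 * (cn w ^+ 2 * (4 / e ^+ 2 * E)) * E by rewrite /A; ring.
  by rewrite ler_wpM2r ?expR_ge0// ler_wpM2l// ler_wpM2l ?sqr_ge0.
apply: le_trans (ler_wpM2l _ h1) _; first by rewrite mulr_ge0 ?powR_ge0.
rewrite mulrCA ler_wpM2l//; first by rewrite mulr_ge0// sqr_ge0.
exact: hu.
Qed.

End Character.
End KernelDerivative.

(** * Fourier transforms with a logarithmic factor *)

Section LogarithmicIntegral.
Variables (R : realType) (K : completeValuedFieldType R).
Variable mu : {measure set (borel K) -> \bar R}.
Variable md : K -> R.
Variable S : haar_data mu md.
Implicit Types (x y z a b t h v w : K) (f g psi : K -> R[i]).
Local Notation int u := (mu.-integrable setT (EFin \o (u : borel K -> R))).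
Local Notation cint f := (cintegrable mu (f : borel K -> R[i])).
Local Notation kmeas f := (cmeas (f : borel K -> R[i])).
Local Notation Int f := (cintegral mu (f : borel K -> R[i])).
Local Notation K2 := (borel K * borel K)%type.
Hint Extern 0 (is_true (0 <= md _)) => exact: (md_ge0 S) : core.

Definition ind (r : R) t : R := if md t <= r then 1 else 0.

Lemma meas_ind (r : R) : measurable_fun setT (ind r : borel K -> R).
Proof.
apply: measurable_fun_ifT; [|exact: measurable_cst|exact: measurable_cst].
by apply: measurable_fun_ler; [exact: (meas_md S)|exact: measurable_cst].
Qed.

Lemma meas_mdV : measurable_fun setT (fun t : borel K => (md t)^-1).
Proof.
rewrite (_ : (fun t => _) = (fun t : borel K => md t `^ (-1))); first exact: (meas_md_powR S).
by apply/funext => t; rewrite powR_inv1.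
Qed.

Definition logker y t : R := (ind (md y) t - ind 1 t) / md t.

Lemma meas_logker y : measurable_fun setT (logker y : borel K -> R).
Proof.
by apply: measurable_funM; [apply: measurable_funB; exact: meas_ind|exact: meas_mdV].
Qed.

Lemma int_logker y : y != 0 -> int (logker y).
Proof.
move=> y0; have my := md_gt0 S y0.
have iw : int (wt md 0 2) by apply: (int_wt S); lra.
apply: (@le_int_ae R _ (borel K) mu _ (fun t => (md y + (md y)^-1) * wt md 0 2 t) [set 0]).
- exact: meas0.
- exact: (mu_set0 S).
- exact: meas_logker.
- exact: intZ.
move=> t /eqP t0; have mt := md_gt0 S t0.
have Vy : 0 < (md y)^-1 by rewrite invr_gt0.
have Vt : 0 < (md t)^-1 by rewrite invr_gt0.
have tt : md t * (md t)^-1 = 1 by rewrite divff// gt_eqF.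
have yy : md y * (md y)^-1 = 1 by rewrite divff// gt_eqF.
rewrite /logker /wt /ind oppr0 powRr0 powRN (@powR_mulrn R (md t) 2)//.
rewrite normrM (gtr0_norm Vt).
case: (leP (md t) 1) => t1; case: (leP (md t) (md y)) => ty.
- by rewrite subrr normr0 mul0r addr0 mulr1 addr_ge0// ltW.
- rewrite sub0r normrN normr1 mul1r addr0 mulr1.
  by apply: (@le_trans _ _ (md y)^-1); rewrite ?lerDr// lef_pV2 ?posrE// ltW.
- rewrite subr0 normr1 mul1r add0r expr2 invfM mulrA ler_peMl ?(ltW Vt)//.
  by rewrite -tt ler_wpM2r ?(ltW Vt)//; apply: (le_trans ty); rewrite lerDl ltW.
- by rewrite subrr normr0 mul0r add0r mulr_ge0 ?addr_ge0 ?(ltW my) ?(ltW Vy)// invr_ge0 sqr_ge0.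
Qed.

Definition logint y : R := \int[mu]_(t in setT) logker y t.

Lemma logker_mul y z t : y != 0 -> z != 0 ->
  logker (y * z) t = logker y t + (md y)^-1 * logker z (y^-1 * t).
Proof.
move=> y0 z0; have my := md_gt0 S y0.
have E (r : R) : ind r (y^-1 * t) = ind (md y * r) t.
  by rewrite /ind (mdM S) (mdV S) ler_pdivrMl.
rewrite /logker !E (mdM S y z) (mdM S y^-1 t) (mdV S) mulr1 invfM invrK.
by move: (md t)^-1 => T; field; rewrite gt_eqF.
Qed.

Lemma logintM y z : y != 0 -> z != 0 -> logint (y * z) = logint y + logint z.
Proof.
move=> y0 z0; have my := md_gt0 S y0.
have yV : y^-1 != 0 by rewrite invr_eq0.
have [i e] := Rint_mul S yV (int_logker z0).
rewrite /logint; under eq_Rintegral do rewrite logker_mul//.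
rewrite (RintD (int_logker y0) (intZ _ i)) (RintZ _ i) e (mdV S) invrK.
by rewrite mulrA mulVf ?mul1r// gt_eqF.
Qed.

Lemma logker_ge0 y t : 1 <= md y -> 0 <= logker y t.
Proof.
move=> y1; rewrite /logker mulr_ge0 ?invr_ge0// subr_ge0 /ind.
case: ifP => t1; last by case: ifP.
by rewrite (le_trans t1 y1).
Qed.

Lemma logker_le0 y t : md y <= 1 -> logker y t <= 0.
Proof.
move=> y1; rewrite /logker mulr_le0_ge0 ?invr_ge0// subr_le0 /ind.
case: ifP => t1; last by case: ifP.
by rewrite (le_trans t1 y1).
Qed.

Lemma Rint_ind y : y != 0 -> exists2 V : R, 0 < V & int (ind (md y)) /\
  forall y, y != 0 -> \int[mu]_(t in setT) ind (md y) t = md y * V.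
Proof.
move=> y0; have [V V0 HV] := mu_mdball S; exists V => //.
have E (r : R) : ind r = \1_(mdball md r) :> (K -> R).
  by apply/funext => t; rewrite /ind indicE/= /mdball; case: ifPn => h; [rewrite mem_set|rewrite memNset//; exact/negP].
have EI x : x != 0 -> (\int[mu]_t ((\1_(mdball md (md x)) : borel K -> R) t)%:E = (md x * V)%:E)%E.
  by move=> x0; rewrite integral_indic ?setIT ?HV//; exact: (meas_mdball S).
split; last by move=> x x0; rewrite /Rintegral E EI.
apply/integrableP; split; first by apply/measurable_EFinP; exact: meas_ind.
have -> : (\int[mu]_t `|(EFin \o (ind (md y) : borel K -> R)) t| = (md y * V)%:E)%E.
  rewrite -EI//; apply: eq_integral => t _ /=; rewrite E ger0_norm// indicE//.
exact: ltry.
Qed.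

Lemma logint_ln : exists2 k : R, 0 < k & forall y, y != 0 -> logint y = k * ln (md y).
Proof.
have [] := @monotone_hom_powR R K md (fun y => expR (logint y)).
- by move=> y y0; exact: md_gt0 S _ y0.
- by move=> y _; exact: expR_gt0.
- by move=> x y _ _; exact: (mdM S).
- by move=> x y x0 y0; rewrite logintM// expRD.
- move=> y y0 y1; rewrite -expR0 ler_expR -oppr_ge0 /logint -mulN1r -(RintZ _ (int_logker y0)).
  by apply: Rintegral_ge0 => t _; rewrite mulN1r oppr_ge0 logker_le0.
- have [p /andP[p0 p1]] := exists_md_lt1 S; exists p; last by rewrite lt_eqF.
  by apply: contraTneq p0 => ->; rewrite (md0 S) ltxx.
move=> k k0 Hk; have Hl y : y != 0 -> logint y = k * ln (md y).
  by move=> y0; apply: (@expR_inj R); rewrite Hk// /powR gt_eqF// (md_gt0 S).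
exists k => //; rewrite lt_def k0 andbT; apply/eqP => kE.
have [p /andP[p0 p1]] := exists_md_lt1 S.
have pn0 : p^-1 != 0 by rewrite invr_eq0; apply: contraTneq p0 => ->; rewrite (md0 S) ltxx.
have m1 : 1 < md p^-1 by rewrite (mdV S) invf_gt1.
have mp : 0 < md p^-1 by lra.
have [V V0 [i1 H1]] := Rint_ind pn0.
have [_ _ [i2 _]] := Rint_ind (oner_neq0 K); rewrite (md1 S) in i2.
have : (md p^-1)^-1 * (md p^-1 * V - V) <= logint p^-1.
  have <- : \int[mu]_(t in setT) ((md p^-1)^-1 * (ind (md p^-1) t + (-1) * ind 1 t)) =
      (md p^-1)^-1 * (md p^-1 * V - V).
    rewrite (RintZ _ (intD i1 (intZ (-1) i2))) (RintD i1 (intZ (-1) i2)) (RintZ _ i2) H1//.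
    have := H1 1 (oner_neq0 K); rewrite (md1 S) mul1r => ->.
    by rewrite mulN1r.
  apply: cintegral_ge0_le.
  - exact: (intZ _ (intD i1 (intZ (-1) i2))).
  - exact: int_logker.
  move=> t; rewrite /logker mulN1r [leRHS]mulrC /ind.
  case: (leP (md t) 1) => t1.
    by rewrite (le_trans t1 (ltW m1)) subrr !mulr0.
  rewrite !subr0; case: (leP (md t) (md p^-1)) => tp; last by rewrite !mulr0.
  by rewrite !mulr1 lef_pV2 ?posrE//; lra.
rewrite Hl// kE mul0r; apply/negP; rewrite -ltNge mulr_gt0 ?invr_gt0//; nra.
Qed.

End LogarithmicIntegral.

Section LogarithmicTransform.
Variables (R : realType) (K : completeValuedFieldType R).
Variable mu : {measure set (borel K) -> \bar R}.
Variable md : K -> R.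
Variable S : haar_data mu md.
Implicit Types (x y z a b t h v w : K) (f g psi : K -> R[i]).
Local Notation int u := (mu.-integrable setT (EFin \o (u : borel K -> R))).
Local Notation cint f := (cintegrable mu (f : borel K -> R[i])).
Local Notation kmeas f := (cmeas (f : borel K -> R[i])).
Local Notation Int f := (cintegral mu (f : borel K -> R[i])).
Local Notation K2 := (borel K * borel K)%type.
Hint Extern 0 (is_true (0 <= md _)) => exact: (md_ge0 S) : core.

Lemma eq_cintegral f g : (forall x, f x = g x) -> Int f = Int g.
Proof. by move=> /funext ->. Qed.

Lemma absv_le_md_powR : exists2 e : R, 0 < e <= 1 & forall t, md t <= 1 -> absv t <= md t `^ e.
Proof.
have [c c0 Hc] := mdE S; exists (Num.min 1 c^-1).
  by rewrite lt_min ltr01 invr_gt0 c0 ge_min lexx.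
move=> t; rewrite Hc => t1; rewrite -powRrM.
have a1 : absv t <= 1.
  rewrite leNgt; apply/negP => x1; move: t1; apply/negP; rewrite -ltNge -(powR_1 c).
  by rewrite gt0_ltr_powR// nnegrE.
have [->|t0] := eqVneq (absv t) 0; first exact: powR_ge0.
have tp : 0 < absv t by rewrite lt_def t0 absv_ge0.
have cm1 : c * Num.min 1 c^-1 <= 1 by rewrite -ler_pdivlMl// mulr1 ge_min lexx orbT.
rewrite -[leLHS]powRr1//.
rewrite /powR gt_eqF// ler_expR mul1r -subr_ge0.
have -> : c * Num.min 1 c^-1 * ln (absv t) - ln (absv t) = (1 - c * Num.min 1 c^-1) * (- ln (absv t)) by ring.
by rewrite mulr_ge0 ?subr_ge0// oppr_ge0 ln_le0.
Qed.

Lemma int_ln_decays f N : kmeas f -> decays f ->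
  int (fun x => (1 + absv x) ^+ N * cn (f x) * `|ln (md x)|).
Proof.
move=> mf df; have [M M0 HM] := absv1_powR S.
have h2 : (0 : R) < 2^-1 by rewrite invr_gt0.
have i1 : int (fun x => (1 + absv x) ^+ (N + M) * cn (f x)).
  have := int_decays S (N + M) mf df (ltac:(by rewrite lexx ltr01) : 0 <= (0 : R) < 1).
  by rewrite (_ : (fun x => _) = (fun x => (1 + absv x) ^+ (N + M) * cn (f x)))//;
    apply/funext => x; rewrite oppr0 powRr0 mulr1.
have i2 : int (fun x => (1 + absv x) ^+ N * cn (f x) * md x `^ (- 2^-1)).
  by apply: (int_decays S) => //; rewrite (ltW h2) invf_lt1// ltr1n.
have i3 := intZ 2 (intD (intZ 2 i1) i2).
apply: (@le_int_ae R _ (borel K) mu _ _ [set 0] (@meas0 R K) (mu_set0 S) _ i3).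
  apply: measurable_funM.
    apply: measurable_funM; last exact: cmeas_cn.
    by apply: measurable_funX; apply: measurable_funD; [exact: measurable_cst|exact: meas_absv].
  by apply: measurableT_comp => //; exact: (meas_ln_md S).
move=> x /eqP x0; have mx := md_gt0 S x0; have p1 n := absv1X_gt0 x n.
set A := (1 + absv x) ^+ N * cn (f x).
have A0 : 0 <= A by rewrite mulr_ge0// ltW.
rewrite [leLHS]ger0_norm; last by rewrite mulr_ge0.
rewrite exprD.
have hl : `|ln (md x)| <= 2 * (md x `^ 2^-1 + md x `^ (- 2^-1)).
  apply: (le_trans (le_expR_abs (ln (md x)) h2)); rewrite invrK ler_wpM2l//.
  exact: expR_ln_abs.
have hm : md x `^ 2^-1 <= 2 * (1 + absv x) ^+ M.
  have P1 : 1 <= (1 + absv x) ^+ M by rewrite exprn_ege1// lerDl.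
  have [m1|m1] := leP (md x) 1.
    apply: (@le_trans _ _ 1); last lra.
    by rewrite -[leRHS](powR_1 2^-1); apply: ge0_ler_powR; rewrite ?nnegrE//; exact: ltW.
  apply: (@le_trans _ _ (md x)); last by have := HM x; lra.
  by rewrite -[leRHS]powRr1// ler_powR ?(ltW m1)// invf_le1// ler1n.
apply: le_trans (ler_wpM2l A0 hl) _.
have -> : (1 + absv x) ^+ N * (1 + absv x) ^+ M * cn (f x) = A * (1 + absv x) ^+ M by rewrite /A; ring.
rewrite mulrCA ler_wpM2l// mulrDr lerD2r mulrCA.
by rewrite ler_wpM2l.
Qed.

Lemma al_diff_bound f M : decays f -> diff_decays f -> exists2 C : R, 0 <= C &
  forall x u : K, (1 + absv x) ^+ M * cn (f x - f (x + u)) <= C * (absv u * (1 + absv u) ^+ M).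
Proof.
move=> df ddf; have [C1 C10 H1] := df M; have [C2 C20 H2] := ddf 1 M.
exists (C2 + 2 * C1) => [|x u]; first by rewrite addr_ge0// mulr_ge0.
have pu : 1 <= (1 + absv u) ^+ M by rewrite exprn_ege1// lerDl.
have px := absv1X_gt0 x M.
have [u1|u1] := leP (absv u) 1.
  rewrite cnC; apply: (le_trans (H2 u x u1)); rewrite expr1.
  apply: (@le_trans _ _ (C2 * (absv u * (1 + absv u) ^+ M))).
    by rewrite ler_wpM2l// ler_peMr.
  by rewrite ler_wpM2r ?mulr_ge0 ?(le_trans ler01 pu)// lerDl mulr_ge0.
apply: (@le_trans _ _ ((1 + absv x) ^+ M * (cn (f x) + cn (f (x + u))))).
  by rewrite ler_wpM2l ?cnB// ltW.
have h2 : (1 + absv x) ^+ M * cn (f (x + u)) <= C1 * (1 + absv u) ^+ M.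
  have xu : absv (x - (x + u)) <= absv u by rewrite opprD addrA subrr sub0r absvN.
  apply: (le_trans (ler_wpM2r (cn_ge0 _) (absv1X_shift M xu))).
  by rewrite -mulrA mulrC ler_wpM2r ?H1// (le_trans ler01 pu).
have h1 := H1 x.
have h3 : C1 <= C1 * (1 + absv u) ^+ M by rewrite ler_peMr.
have h4 : 2 * (C1 * (1 + absv u) ^+ M) <= 2 * C1 * (absv u * (1 + absv u) ^+ M).
  rewrite -mulrA ler_wpM2l// ler_wpM2l// ler_peMl ?(ltW u1)// (le_trans ler01 pu)//.
have h5 : 0 <= C2 * (absv u * (1 + absv u) ^+ M).
  by rewrite mulr_ge0// mulr_ge0// (le_trans ler01 pu).
rewrite mulrDr mulrDl; lra.
Qed.

Lemma int_inverse_weight (M : nat) :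
  (forall x, md x <= (1 + absv x) ^+ M) ->
  int (fun u => (md u `^ 2)^-1 * (1 + absv u^-1) ^- (M + M)).
Proof.
move=> HM; have iw : int (wt md 0 2) by apply: (int_wt S); lra.
apply: (@le_int_ae R _ (borel K) mu _ (wt md 0 2) [set 0] (@meas0 R K) (mu_set0 S) _ iw).
  apply: measurable_funM.
    rewrite (_ : (fun u => _) = (fun u : borel K => md u `^ (- 2))); first exact: (meas_md_powR S).
    by apply/funext => u; rewrite powRN.
  have mi : measurable_fun setT (fun u : borel K => absv (u : K)^-1).
    rewrite (_ : (fun u => _) = (@powR R ^~ (-1)) \o (fun u : borel K => absv (u : K))).
      by apply: measurableT_comp; [exact: measurable_powR|exact: meas_absv].
    by apply/funext => u /=; rewrite powR_inv1// absvV.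
  rewrite (_ : (fun u => _) = (@powR R ^~ (- (M + M)%:R)) \o (fun u : borel K => 1 + absv (u : K)^-1)).
    apply: measurableT_comp; first exact: measurable_powR.
    by apply: measurable_funD; [exact: measurable_cst|exact: mi].
  by apply/funext => u /=; rewrite powRN powR_mulrn// addr_ge0.
move=> u /eqP u0; have mu0 := md_gt0 S u0; have p1 := absv1X_gt0 u^-1 (M + M).
have q0 : 0 < md u `^ 2 by rewrite powR_gt0.
rewrite ger0_norm; last by rewrite mulr_ge0// invr_ge0 ltW.
rewrite /wt; case: (leP (md u) 1) => u1; rewrite ?addr0 ?add0r ?oppr0 ?powRr0.
  rewrite -invfM invf_le1 ?mulr_gt0//.
  have h : (md u)^-1 <= (1 + absv u^-1) ^+ M by rewrite -(mdV S).
  rewrite [leLHS](_ : 1 = md u `^ 2 * ((md u)^-1 * (md u)^-1)); last first.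
    by rewrite (@powR_mulrn R (md u) 2)//; field; rewrite gt_eqF.
  by rewrite ler_wpM2l ?(ltW q0)// exprD ler_pM ?invr_ge0.
by rewrite powRN ler_piMr ?invr_ge0 ?(ltW q0)// invf_le1// exprn_ege1// lerDl.
Qed.

Variable eta : K -> R[i].
Hypotheses (meta : kmeas eta) (deta : decays eta) (dom : decays (fourier mu eta)).
(* [Int eta = 1], stated so that [done] does not try to discriminate it *)
Hypothesis ieta : forall c, c * Int eta = c.
Local Notation om := (fourier mu eta).

Let ceta : cint eta. Proof. exact: (cint_decays S). Qed.

Lemma om0 c : c * om 0 = c.
Proof.
rewrite -[RHS]ieta; congr (_ * _); rewrite /fourier.
by under eq_fun do rewrite mulr0 oppr0 (addchar0 (hd_rat S)) mulr1.
Qed.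

Lemma om_lip : exists2 C : R, 0 <= C & forall y, cn (1 - om y) <= C * absv y.
Proof.
have [C C0 HC] := fourier_lip S ceta (int_absv_decays S meta deta).
exists C => // y; rewrite -[1](om0 1) mul1r; apply: (le_trans (HC _ _)).
by rewrite sub0r absvN.
Qed.

Lemma om_kmeas : kmeas om.
Proof.
apply: cmeas_continuous; apply: (fourier_continuous S) => //.
exact: (int_absv_decays S).
Qed.

Definition cutdiff y t : R[i] := ((ind md 1 t)%:C - om (y * t)) * ((md t)^-1)%:C.

Lemma kmeas_cutdiff y : kmeas (cutdiff y).
Proof.
apply: cmeasM; last by apply: cmeas_real; exact: (meas_mdV S).
apply: cmeasB; first by apply: cmeas_real; exact: (meas_ind S).
by apply: (cmeas_comp (f := (om : borel K -> R[i]))); [exact: om_kmeas|exact: meas_mull].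
Qed.

Lemma cint_cutdiff1 : cint (cutdiff 1).
Proof.
have [e /andP[e0 e1] He] := absv_le_md_powR; have [C C0 HC] := om_lip.
have [M M0 HM] := absv1_powR S; have [D D0 HD] := dom M.
have iw : int (wt md (1 - e) 2) by apply: (int_wt S); lra.
apply: (cintegrable_le0 S) (intZ (C + D) iw) _; first exact: kmeas_cutdiff.
move=> t t0; have mt := md_gt0 S t0; rewrite /cutdiff /wt /ind mul1r cnM cn_real.
have Vt : 0 < (md t)^-1 by rewrite invr_gt0.
rewrite (gtr0_norm Vt).
case: (leP (md t) 1) => t1; rewrite ?addr0 ?add0r.
  rewrite opprB powRD ?(gt_eqF mt) ?implybT// powR_inv1//.
  rewrite mulrA ler_wpM2r ?(ltW Vt)//.
  apply: (le_trans (HC t)); rewrite mulrDl.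
  apply: (@le_trans _ _ (C * md t `^ e)); first by rewrite ler_wpM2l// He.
  by rewrite lerDl mulr_ge0// powR_ge0.
rewrite ?sub0r cnN powRN (@powR_mulrn R (md t) 2)// expr2 invfM mulrA ler_wpM2r ?(ltW Vt)//.
rewrite ler_pdivlMr// mulrC.
apply: (@le_trans _ _ ((1 + absv t) ^+ M * cn (om t))); first by rewrite ler_wpM2r// HM.
by apply: (le_trans (HD t)); rewrite lerDr.
Qed.

(* The rescaling [t -> y t] turns the integral of [cutdiff y] into that of
   [cutdiff 1] plus [logint y], which is a multiple of [ln (md y)]. *)
Lemma cutdiff_int : exists k : R, exists c : R[i], exists B : R, [/\ 0 < k, 0 <= B &
  forall y, y != 0 -> [/\ cint (cutdiff y), Int (cutdiff y) = (k * ln (md y))%:C + c &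
    \int[mu]_(t in setT) cn (cutdiff y t) <= B + k * `|ln (md y)|]].
Proof.
have [k k0 Hk] := logint_ln S.
exists k; exists (Int (cutdiff 1)); exists (\int[mu]_(t in setT) cn (cutdiff 1 t)).
have i1 := cint_cutdiff1.
split; [exact: k0|exact: Rintegral_ge0|].
move=> y y0; have my := md_gt0 S y0.
pose H t := cutdiff 1 t + (logker md y t)%:C.
have il := int_logker S y0.
have cl : cint (fun t => (logker md y t)%:C).
  apply: (@cintegrable_le R _ (borel K) mu _ (fun t => `|logker md y t|)).
  - by apply: cmeas_real; exact: (meas_logker S).
  - exact: (integrable_norm il).
  - by move=> t; rewrite cn_real.
have iH : cint H by exact: cintegrableD.
have [iH2 _] := cint_mul S y0 iH; have [iHn _] := Rint_mul S y0 (cintegrable_cn iH).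
have E t : cutdiff y t = (md y)%:C * H (y * t).
  rewrite /H /cutdiff /logker mul1r (mdM S) invfM !rmorphM/= !rmorphB/=.
  have -> : ind md (md y) (y * t) = ind md 1 t.
    by rewrite /ind (mdM S) -[X in _ <= X]mulr1 ler_pM2l.
  have yy : (md y)%:C * ((md y)^-1)%:C = 1 :> R[i] by rewrite -rmorphM/= divff ?gt_eqF.
  set i1' := (ind md 1 t)%:C; set i2 := (ind md 1 (y * t))%:C.
  set p := om (y * t); set r := ((md t)^-1)%:C; set V := ((md y)^-1)%:C in yy *.
  by transitivity (((md y)%:C * V) * ((i1' - p) * r)); [rewrite yy mul1r|ring].
split.
- by rewrite (funext E); exact: cintegrableZ.
- rewrite (funext E) (cintegralZ _ iH2) (cint_mul S y0 iH).2 mulrA -rmorphM/= divff ?gt_eqF// mul1r.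
  rewrite (cintegralD i1 cl) addrC; congr (_ + _).
  by rewrite -Hk// /logint cintegral_real.
have h1 : \int[mu]_(t in setT) cn (cutdiff y t) <= \int[mu]_(t in setT) cn (H t).
  rewrite le_eqVlt; apply/orP; left; apply/eqP.
  transitivity (\int[mu]_(t in setT) (md y * cn (H (y * t)))).
    by apply: eq_Rintegral => t _; rewrite E cnM cn_real gtr0_norm.
  by rewrite (RintZ _ iHn) (Rint_mul S y0 (cintegrable_cn iH)).2 mulrA divff ?gt_eqF// mul1r.
apply: (le_trans h1).
have -> : k * `|ln (md y)| = \int[mu]_(t in setT) `|logker md y t|.
  rewrite -(gtr0_norm k0) -normrM -Hk// /logint.
  have [y1|y1] := leP 1 (md y).
    rewrite [LHS]ger0_norm; last by apply: Rintegral_ge0 => t _; exact: (logker_ge0 S).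
    by apply: eq_Rintegral => t _; rewrite ger0_norm// (logker_ge0 S).
  rewrite -normrN -mulN1r -(RintZ _ il) [LHS]ger0_norm; last first.
    by apply: Rintegral_ge0 => t _; rewrite mulN1r oppr_ge0 (logker_le0 S)// ltW.
  by apply: eq_Rintegral => t _; rewrite mulN1r ler0_norm// (logker_le0 S)// ltW.
have iln : int (fun t => `|logker md y t|) by exact: (integrable_norm il).
rewrite -(RintD (cintegrable_cn i1) iln).
apply: cintegral_ge0_le.
- exact: cintegrable_cn.
- exact: (intD (cintegrable_cn i1) iln).
by move=> t; rewrite /H -[`|logker _ _ _|]cn_real cnD.
Qed.

Section Bound.
Variable beta : K -> R[i].
Hypotheses (mbeta : kmeas beta) (dbeta : decays beta).
Local Notation al := (fourier mu beta).
Hypotheses (dal : decays al) (ddal : diff_decays al).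

Let cbeta : cint beta. Proof. exact: (cint_decays S). Qed.

Definition smoothed t x : R[i] := Int (fun v => eta v * al (x + v * t)).

Lemma al_kmeas : kmeas al.
Proof.
apply: cmeas_continuous; apply: (fourier_continuous S) => //.
exact: (int_absv_decays S).
Qed.

Lemma fourierE f x : Int (fun y => f y * addchar (- (y * x))) = fourier mu f x.
Proof. by []. Qed.

Lemma fourier_modulation x w : fourier mu (fun y => beta y * addchar (- (y * x))) w = al (x + w).
Proof.
rewrite /fourier; congr (cintegral mu _); apply/funext => y.
by rewrite -mulrA -addcharD ?mulrDr ?opprD//; exact: (hd_rat S).
Qed.

Opaque fourier.

Lemma smoothedE t x :
  Int (fun y => beta y * addchar (- (y * x)) * om (y * t)) = smoothed t x.
Proof.
have cg : cint (fun y => beta y * addchar (- (y * x))) by exact: (cint_fourier S).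
apply: etrans (fourier_mul_swap S t ceta cg) _; rewrite /smoothed.
apply: eq_cintegral => v.
by rewrite (fourier_modulation x (v * t)).
Qed.

Lemma kmeas_al_shift t x : kmeas (fun v => al (x + v * t)).
Proof.
apply: (cmeas_comp (f := (al : borel K -> R[i]))); first exact: al_kmeas.
apply: (meas_map (h := fun v => x + v * t)) => y e e0.
exists (e / (absv t + 1)) => [|y']; first by rewrite divr_gt0// ltr_wpDl.
have -> : x + y' * t - (x + y * t) = (y' - y) * t by ring.
rewrite absvM ltr_pdivlMr ?ltr_wpDl// => h; apply: le_lt_trans h.
by rewrite ler_wpM2l// lerDl.
Qed.

Lemma cint_smoothed t x : cint (fun v => eta v * al (x + v * t)).
Proof.
set J := \int[mu]_(y in setT) cn (beta y).
apply: (cintegrable_le _ (intZ (2 * J) (cintegrable_cn ceta))) => [|v].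
  by apply: cmeasM => //; exact: kmeas_al_shift.
by rewrite cnM mulrC ler_wpM2r// (fourier_le S).
Qed.

Lemma smoothed_small M : exists2 C : R, 0 <= C & forall t x, absv t <= 1 ->
  (1 + absv x) ^+ M * cn (al x - smoothed t x) <= C * absv t.
Proof.
have [C C0 HC] := al_diff_bound M dal ddal.
have iJ : int (fun v => (1 + absv v) ^+ M.+1 * cn (eta v)).
  have := int_decays S M.+1 meta deta (ltac:(by rewrite lexx ltr01) : 0 <= (0 : R) < 1).
  by rewrite (_ : (fun x => _) = (fun x => (1 + absv x) ^+ M.+1 * cn (eta x)))//;
    apply/funext => x; rewrite oppr0 powRr0 mulr1.
set J := \int[mu]_(v in setT) ((1 + absv v) ^+ M.+1 * cn (eta v)).
have J0 : 0 <= J by apply: Rintegral_ge0 => v _; rewrite mulr_ge0// ltW// absv1X_gt0.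
exists (2 * (C * J)) => [|t x t1]; first by rewrite mulr_ge0// mulr_ge0.
have px := absv1X_gt0 x M.
rewrite mulrC -ler_pdivlMr//.
have -> : 2 * (C * J) * absv t / (1 + absv x) ^+ M =
   2 * \int[mu]_(v in setT) (C * absv t / (1 + absv x) ^+ M * ((1 + absv v) ^+ M.+1 * cn (eta v))).
  by rewrite (RintZ _ iJ) -/J; ring.
have -> : al x - smoothed t x = Int (fun v => al x * eta v - eta v * al (x + v * t)).
  rewrite (cintegralB (cintegrableZ _ ceta) (cint_smoothed t x)).
  by rewrite (cintegralZ _ ceta) ieta.
apply: cintegral_le.
- by apply: cintegrable_meas (cintegrableB (cintegrableZ _ ceta) (cint_smoothed t x)).
- exact: intZ.
move=> v; rewrite [eta v * _]mulrC -mulrBl.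
rewrite cnM mulrA ler_wpM2r// mulrAC ler_pdivlMr// mulrC.
apply: (le_trans (HC x (v * t))); rewrite -mulrA ler_wpM2l// absvM.
rewrite mulrAC mulrC ler_wpM2l// exprS ler_pM ?exprn_ge0 ?addr_ge0 ?mulr_ge0//.
  by rewrite lerDr.
by rewrite lerXn2r ?nnegrE ?addr_ge0 ?mulr_ge0// lerD2l ler_piMr.
Qed.

Lemma smoothed_large M : exists2 C : R, 0 <= C & forall t x, 1 <= absv t ->
  md t * (1 + absv (x / t)) ^+ M * cn (smoothed t x) <= C.
Proof.
have [C C0 HC] := deta M.
have iJ : int (fun w => (1 + absv w) ^+ M * cn (al w)).
  have := int_decays S M al_kmeas dal (ltac:(by rewrite lexx ltr01) : 0 <= (0 : R) < 1).
  by rewrite (_ : (fun x => _) = (fun x => (1 + absv x) ^+ M * cn (al x)))//;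
    apply/funext => x; rewrite oppr0 powRr0 mulr1.
set J := \int[mu]_(w in setT) ((1 + absv w) ^+ M * cn (al w)).
have J0 : 0 <= J by apply: Rintegral_ge0 => v _; rewrite mulr_ge0// ltW// absv1X_gt0.
exists (2 * (C * J)) => [|t x t1]; first by rewrite mulr_ge0// mulr_ge0.
have t0 : t != 0 by rewrite -absv_gt0 (lt_le_trans ltr01).
have mt := md_gt0 S t0.
pose k w := eta ((w - x) / t) * al w.
have pxt := absv1X_gt0 (x / t) M.
have kb w : cn (k w) <= C / (1 + absv (x / t)) ^+ M * ((1 + absv w) ^+ M * cn (al w)).
  rewrite /k cnM mulrA ler_wpM2r// mulrAC ler_pdivlMr// mulrC.
  have h1 : (1 + absv (x / t)) ^+ M <= (1 + absv ((w - x) / t)) ^+ M * (1 + absv w) ^+ M.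
    apply: (le_trans (absv1X_peetre (x / t) (w / t) M)).
    have -> : absv (x / t - w / t) = absv ((w - x) / t) by rewrite -mulrBl absvM absvC -absvM.
    rewrite ler_wpM2l ?(ltW (absv1X_gt0 _ _))//.
    rewrite lerXn2r ?nnegrE ?addr_ge0// lerD2l absvM absvV ler_pdivrMr ?(lt_le_trans ltr01 t1)//.
    by rewrite ler_peMr.
  apply: (le_trans (ler_wpM2r (cn_ge0 _) h1)).
  by rewrite mulrAC ler_wpM2r ?HC// ltW// absv1X_gt0.
have mk : kmeas k.
  apply: cmeasM; last exact: al_kmeas.
  apply: (cmeas_comp (f := (eta : borel K -> R[i]))) => //.
  apply: (meas_map (h := fun w => (w - x) / t)) => y e e0.
  exists (e * absv t) => [|y']; first by rewrite mulr_gt0// absv_gt0.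
  have -> : (y' - x) / t - (y - x) / t = (y' - y) / t by ring.
  by rewrite absvM absvV ltr_pdivrMr// absv_gt0.
have ck : cint k by exact: (cintegrable_le mk (intZ _ iJ) kb).
have [ck2 _] := cint_add S x ck.
have A : smoothed t x = Int (fun v => k (t * v + x)).
  apply: eq_cintegral => v; have e1 : (t * v + x - x) / t = v by field.
  have e2 : t * v + x = x + v * t by ring.
  by rewrite /k e1 e2.
rewrite (etrans (etrans A (cint_mul S t0 ck2).2) (congr1 _ (cint_add S x ck).2)); clear A.
rewrite cnM cn_real ger0_norm ?invr_ge0//.
have -> : md t * (1 + absv (x / t)) ^+ M * ((md t)^-1 * cn (Int k)) = (1 + absv (x / t)) ^+ M * cn (Int k).
  by field; rewrite gt_eqF.
rewrite mulrC -ler_pdivlMr//.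
have -> : 2 * (C * J) / (1 + absv (x / t)) ^+ M = 2 * \int[mu]_(w in setT) (C / (1 + absv (x / t)) ^+ M * ((1 + absv w) ^+ M * cn (al w))).
  by rewrite (RintZ _ iJ) -/J; ring.
by apply: cintegral_le => //; exact: intZ.
Qed.

Lemma fourier_log_bound : exists2 C : R, 0 <= C & forall x, x != 0 ->
  md x * cn (fourier mu (fun y => (ln (md y))%:C * beta y) x) <= C.
Proof.
have [k [c [B [k0 B0 Hcut]]]] := cutdiff_int.
have [M M0 HM] := absv1_powR S.
have [e /andP[e0 e1] He] := absv_le_md_powR.
have [C1 C10 H1] := smoothed_small M; have [C2 C20 H2] := smoothed_large (M + M).
have [C3 C30 H3] := dal M.
pose sm t : R := if md t <= 1 then md t `^ (- (1 - e)) else 0.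
have ism : int sm by apply: (int_md_small S); lra.
pose rho u := (md u `^ 2)^-1 * (1 + absv u^-1) ^- (M + M).
have irho : int rho := int_inverse_weight HM.
set I1 := \int[mu]_(t in setT) sm t; set I2 := \int[mu]_(t in setT) rho t.
have I10 : 0 <= I1 by apply: Rintegral_ge0 => t _; rewrite /sm; case: ifP => // _; exact: powR_ge0.
have rho0 u : 0 <= rho u by rewrite mulr_ge0 ?invr_ge0 ?powR_ge0// exprn_ge0// addr_ge0.
have I20 : 0 <= I2 by exact: Rintegral_ge0.
exists (k^-1 * (2 * (C1 * I1 + C2 * I2) + cn c * C3)) => [|x x0].
  by rewrite mulr_ge0 ?invr_ge0 ?(ltW k0)// addr_ge0 ?mulr_ge0// addr_ge0// mulr_ge0.
have mx := md_gt0 S x0.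
pose F y t := beta y * addchar (- (y * x)) * cutdiff y t.
have cg : cint (fun y => beta y * addchar (- (y * x))) by exact: (cint_fourier S).
have mF : cmeas (fun z : K2 => F z.1 z.2).
  apply: cmeasM; first exact: (cmeas_fst (cintegrable_meas cg)).
  apply: cmeasM; last first.
    by apply: (cmeas_snd (f := fun t => ((md t)^-1)%:C)); apply: cmeas_real; exact: (meas_mdV S).
  apply: cmeasB; last exact: (cmeas_mul S om_kmeas).
  by apply: (cmeas_snd (f := fun t => (ind md 1 t)%:C)); apply: cmeas_real; exact: (meas_ind S).
have iln : int (fun y => cn (beta y) * `|ln (md y)|).
  have := int_ln_decays 0 mbeta dbeta.
  by rewrite (_ : (fun y => _) = (fun y => cn (beta y) * `|ln (md y)|))//; apply/funext => y; rewrite expr0 mul1r.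
have ib := cintegrable_cn cbeta.
pose u y := B * cn (beta y) + k * (cn (beta y) * `|ln (md y)|).
have iu : int u := intD (intZ B ib) (intZ k iln).
have mln : kmeas (fun y => (ln (md y))%:C * beta y).
  by apply: cmeasM => //; apply: cmeas_real; exact: (meas_ln_md S).
have clb : cint (fun y => (ln (md y))%:C * beta y).
  apply: (cintegrable_le mln iln) => y.
  by rewrite cnM cn_real mulrC.
have fub : [/\ cint (fun y => Int (F y)), cint (fun t => Int (F^~ t)) &
    Int (fun y => Int (F y)) = Int (fun t => Int (F^~ t))].
  apply: (cfubini_haar S mF iu) => y y0; have [ci _ hc] := Hcut y y0.
  have -> : (fun t => cn (F y t)) = (fun t => cn (beta y) * cn (cutdiff y t)).
    by apply/funext => t; rewrite /F !cnM cn_addchar mulr1.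
  split; first exact: intZ (cintegrable_cn ci).
  rewrite (RintZ _ (cintegrable_cn ci)); apply: (le_trans (ler_wpM2l (cn_ge0 _) hc)).
  by rewrite /u le_eqVlt; apply/orP; left; apply/eqP; ring.
pose W t := ((ind md 1 t)%:C * al x - smoothed t x) * ((md t)^-1)%:C.
have eW t : Int (F^~ t) = W t.
  set T := ((md t)^-1)%:C; set I := (ind md 1 t)%:C.
  have cgo : cint (fun y => beta y * addchar (- (y * x)) * om (y * t)).
    exact: (fourier_mul_int S t ceta cg om_kmeas).
  transitivity (Int (fun y => T * (I * (beta y * addchar (- (y * x))) - beta y * addchar (- (y * x)) * om (y * t)))).
    apply: eq_cintegral => y; rewrite /F /cutdiff -/T -/I.
    by move: (beta y * _) (om _) => p q; ring.
  rewrite (cintegralZ _ (cintegrableB (cintegrableZ I cg) cgo)) (cintegralB (cintegrableZ I cg) cgo).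
  by rewrite (cintegralZ _ cg) fourierE smoothedE mulrC.
have mW : kmeas W.
  by rewrite (_ : W = fun t => Int (F^~ t)); [case: fub => _ /cintegrable_meas|apply/funext => t; rewrite eW].
have bW : cn (Int W) <= 2 * ((md x)^-1 * (C1 * I1 + C2 * I2)).
  have xV : x^-1 != 0 by rewrite invr_eq0.
  have [ir _] := Rint_mul S xV irho.
  pose m t := (md x)^-1 * (C1 * sm t) + C2 * ((md x `^ 2)^-1 * rho (x^-1 * t)).
  have im : int m := intD (intZ _ (intZ _ ism)) (intZ _ (intZ _ ir)).
  have -> : (md x)^-1 * (C1 * I1 + C2 * I2) = \int[mu]_(t in setT) m t.
    rewrite (RintD (intZ _ (intZ _ ism)) (intZ _ (intZ _ ir))) !(RintZ _ (intZ _ ism)) (RintZ _ (intZ _ ir)).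
    rewrite (RintZ _ ism) (RintZ _ ir) (Rint_mul S xV irho).2 (mdV S) invrK.
    by rewrite (@powR_mulrn R (md x) 2)// -/I1 -/I2; field; rewrite gt_eqF.
  apply: cintegral_le => // t.
  have sm0 : 0 <= sm t by rewrite /sm; case: ifP => // _; exact: powR_ge0.
  have m1 : 0 <= (md x)^-1 * (C1 * sm t) by rewrite mulr_ge0 ?invr_ge0// mulr_ge0.
  have m2 : 0 <= C2 * ((md x `^ 2)^-1 * rho (x^-1 * t)).
    by rewrite mulr_ge0// mulr_ge0// invr_ge0 powR_ge0.
  have [t0|t0] := eqVneq t 0.
    have -> : W t = 0 by rewrite t0 /W (md0 S) invr0 mulr0.
    by rewrite cn0 addr_ge0.
  have mt := md_gt0 S t0; have Vt : 0 < (md t)^-1 by rewrite invr_gt0.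
  rewrite /W cnM cn_real (gtr0_norm Vt) /ind; case: (leP (md t) 1) => t1.
    have te : md t `^ e <= 1.
      by rewrite -[leRHS](powR_1 e); apply: ge0_ler_powR; rewrite ?nnegrE//; exact: ltW.
    have ht := le_trans (He t t1) te.
    apply: (@le_trans _ _ ((md x)^-1 * (C1 * sm t))); last by rewrite /m lerDl.
    have -> : sm t = md t `^ e * (md t)^-1.
      by rewrite /sm t1 opprB powRD ?(gt_eqF mt) ?implybT// powR_inv1.
    rewrite !mulrA ler_wpM2r ?(ltW Vt)// mul1r.
    rewrite -mulrA ler_pdivlMl//.
    apply: (@le_trans _ _ ((1 + absv x) ^+ M * cn (al x - smoothed t x))).
      by rewrite ler_wpM2r.
    by apply: (le_trans (H1 t x ht)); rewrite ler_wpM2l// He.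
  have ht : 1 <= absv t.
    by rewrite leNgt; apply/negP => /ltW/(md_le1 S t0); rewrite leNgt t1.
  apply: (@le_trans _ _ (C2 * ((md x `^ 2)^-1 * rho (x^-1 * t)))); last by rewrite /m lerDr.
  have px := absv1X_gt0 (x / t) (M + M).
  have -> : (md x `^ 2)^-1 * rho (x^-1 * t) = (md t * (1 + absv (x / t)) ^+ (M + M))^-1 * (md t)^-1.
    rewrite /rho (mdM S) (mdV S) !(@powR_mulrn R _ 2) ?mulr_ge0 ?invr_ge0//.
    have -> : (x^-1 * t)^-1 = x / t by rewrite invfM invrK.
    move: px; move: (_ ^+ (M + M)) => P px.
    by field; rewrite !gt_eqF.
  rewrite mulrA ler_wpM2r ?(ltW Vt)// mul0r sub0r cnN ler_pdivlMr ?mulr_gt0// mulrC.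
  exact: H2.
have eL : cn (k%:C * fourier mu (fun y => (ln (md y))%:C * beta y) x + c * al x) <= cn (Int W).
  rewrite le_eqVlt; apply/orP; left; apply/eqP; congr cn.
  have cl2 := cint_fourier S x clb.
  transitivity (Int (fun y => Int (F y))); last first.
    by case: fub => _ _ ->; apply: eq_cintegral => t; exact: eW.
  transitivity (Int (fun y => k%:C * ((ln (md y))%:C * beta y * addchar (- (y * x))) + c * (beta y * addchar (- (y * x))))).
    rewrite (cintegralD (cintegrableZ _ cl2) (cintegrableZ _ cg)) (cintegralZ _ cl2) (cintegralZ _ cg).
    by rewrite !fourierE.
  apply: (cintegral_eq0 S).
  - exact: (cintegrable_meas (cintegrableD (cintegrableZ _ cl2) (cintegrableZ _ cg))).
  - by case: fub => /cintegrable_meas.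
  move=> y y0; have := Hcut y y0; case=> ci ei _.
  rewrite /F (cintegralZ _ ci) ei rmorphM/=; clear ei.
  by move: (beta y) (addchar _) (ln _)%:C => p q r; ring.
have hal : md x * cn (al x) <= C3.
  by apply: le_trans (H3 x); rewrite ler_wpM2r.
rewrite ler_pdivlMl// mulrCA.
set Fx := fourier mu _ x in eL *.
have kF : k * cn Fx <= cn (Int W) + cn c * cn (al x).
  have -> : k * cn Fx = cn (k%:C * Fx) by rewrite cnM cn_real gtr0_norm.
  have -> : k%:C * Fx = (k%:C * Fx + c * al x) - c * al x by rewrite addrK.
  by apply: (le_trans (cnB _ _)); rewrite cnM lerD2r.
apply: (le_trans (ler_wpM2l (ltW mx) kF)); rewrite mulrDr lerD//.
  rewrite mulrC -ler_pdivlMr//; apply: (le_trans bW).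
  by rewrite le_eqVlt; apply/orP; left; apply/eqP; ring.
by rewrite mulrCA ler_wpM2l.
Qed.

End Bound.
End LogarithmicTransform.

(** * The Gamma factor and the conductor operator *)

Section GammaFactor.
Variables (R : realType) (K : completeValuedFieldType R).
Variable mu : {measure set (borel K) -> \bar R}.
Variable md : K -> R.
Variable S : haar_data mu md.
Variable chi : K -> R[i].
Hypothesis hchi : unitary_character chi.
Implicit Types (x y a b t h : K) (f g psi : K -> R[i]) (z w s : R[i]).
Local Notation int u := (mu.-integrable setT (EFin \o (u : borel K -> R))).
Local Notation cint f := (cintegrable mu (f : borel K -> R[i])).
Local Notation kmeas f := (cmeas (f : borel K -> R[i])).
Local Notation Int f := (cintegral mu (f : borel K -> R[i])).
Local Notation chiV := (fun x => (chi x)^-1).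
Local Notation F := (fourier mu).
Hint Extern 0 (is_true (0 <= md _)) => exact: (md_ge0 S) : core.

Let hchiV : unitary_character chiV. Proof. exact: unitary_characterV. Qed.

Definition mellin psi f z : R[i] := Int (fun x => f x * kpow md psi z x).

Lemma cintegral_off0 f g : cint g -> (forall x, x != 0 -> f x = g x) -> cint f /\ Int f = Int g.
Proof.
move=> ig fg; have mg := cintegrable_meas ig.
have mf : kmeas f.
  have -> : f = fun x => g x + (f 0 - g 0) * (\1_([set 0] : set K) x)%:C.
    apply/funext => x; rewrite indicE; have [->|x0] := eqVneq x 0.
      by rewrite mem_set// mulr1 subrKC.
    by rewrite memNset ?mulr0 ?addr0 ?fg//; exact/eqP.
  apply: cmeasD => //; apply: cmeasM; first exact: cmeas_cst.
  by apply: cmeas_real; apply: measurable_indic; exact: meas0.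
split; last exact: (cintegral_eq0 S).
by apply: (cintegrable_le0 S mf (cintegrable_cn ig)) => x /fg ->.
Qed.

Definition schwartzlike f := kmeas f /\ decays f.

Lemma sl_int f (a : R) : schwartzlike f -> 0 <= a < 1 -> int (fun x => cn (f x) * md x `^ (- a)).
Proof. by move=> [mf df]; exact: (int_decays0 S). Qed.

Lemma sl_cint f : schwartzlike f -> cint f.
Proof. by move=> [mf df]; exact: (cint_decays S). Qed.

Lemma sl_sb f : schwartz_bruhat f -> schwartzlike f.
Proof. by move=> sf; split; [exact: sb_kmeas|exact: sb_decays]. Qed.

Lemma sl_fourier f : schwartz_bruhat f -> schwartzlike (F f).
Proof.
move=> sf; split; last exact: (sb_fourier_decays S).
by apply: cmeas_continuous; exact: (sb_fourier_continuous S).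
Qed.

Lemma sl_opp f : schwartzlike f -> schwartzlike (fun x => f (- x)).
Proof.
move=> [mf df]; split.
  by apply: (cmeas_comp (f := (f : borel K -> R[i]))) => //; exact: meas_oppK.
by move=> M; have [C C0 HC] := df M; exists C => // x; rewrite -absvN.
Qed.

Lemma inv_fourier_opp f : inv_fourier mu f = fun x => F f (- x).
Proof. by apply/funext => x; exact: inv_fourierE. Qed.

Lemma sl_inv_fourier f : schwartz_bruhat f -> schwartzlike (inv_fourier mu f).
Proof. by move=> sf; rewrite inv_fourier_opp; apply: sl_opp; exact: sl_fourier. Qed.

Lemma mellin_cint psi f z : unitary_character psi -> schwartzlike f -> -1 < complex.Re z <= 0 ->
  cint (fun x => f x * kpow md psi z x).
Proof.
move=> hpsi sf hz; apply: (cint_kpow S hpsi) => //; first exact: sf.1.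
by move=> a; exact: sl_int.
Qed.

Lemma mellin_opp psi f z : unitary_character psi -> cint (fun x => f x * kpow md psi z x) ->
  mellin psi (fun x => f (- x)) z = kpow md psi z (-1) * mellin psi f z.
Proof.
move=> hpsi ci.
rewrite /mellin -(cintegralZ _ ci) -(cint_opp S (cintegrableZ _ ci)).2.
apply: eq_cintegral => x; rewrite mulrCA -(kpowM S hpsi).
by rewrite mulN1r opprK.
Qed.

Section Strip.
Variable s : R[i].
Hypothesis hs : 0 < complex.Re s < 1.

Lemma Re_sub1 : -1 < complex.Re (s - 1) < 0.
Proof. by case: s hs => a b /=; lra. Qed.

Lemma Re_opp : -1 < complex.Re (- s) < 0.
Proof. by case: s hs => a b /=; lra. Qed.

Lemma strip_le z : -1 < complex.Re z < 0 -> -1 < complex.Re z <= 0.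
Proof. by move=> /andP[-> /ltW ->]. Qed.

Lemma quasichar_mellin f : schwartzlike f ->
  Int (fun x => f x * quasichar md chi s x) = mellin chi f (s - 1).
Proof.
move=> sf; have ci := mellin_cint hchi sf (strip_le Re_sub1).
by apply: (cintegral_off0 ci _).2 => x x0; rewrite kpowE.
Qed.

Lemma dual_quasichar_mellin f : cint (fun x => f x * kpow md chiV (- s) x) ->
  cint (fun x => f x * dual_quasichar md chi s x) /\
  Int (fun x => f x * dual_quasichar md chi s x) = mellin chiV f (- s).
Proof. by move=> ci; apply: cintegral_off0 => // x x0; rewrite kpowE. Qed.

Lemma kpow_relation y : y != 0 -> kpow md chiV (- s) y * (md y)%:C * kpow md chi (s - 1) y = 1.
Proof. by move=> y0; exact: (kpow_dual S s hchi y0). Qed.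

Lemma mellin_fourier f g : schwartzlike f -> schwartzlike g -> schwartzlike (F f) -> schwartzlike (F g) ->
  mellin chi (F f) (s - 1) * mellin chiV g (- s) = mellin chi (F g) (s - 1) * mellin chiV f (- s).
Proof.
move=> sf sg sFf sFg.
apply: (functional_equation S (q := kpow md chi (s - 1)) (th := kpow md chiV (- s))).
- exact: (kmeas_kpow S hchi).
- exact: (kpowM S hchi).
- exact: kpow_relation.
- exact: sl_cint.
- exact: sl_cint.
- exact: sFf.1.
- exact: sFg.1.
- exact: mellin_cint (strip_le Re_sub1).
- exact: mellin_cint (strip_le Re_sub1).
- exact: mellin_cint (strip_le Re_opp).
- exact: mellin_cint (strip_le Re_opp).
Qed.

Lemma gamma_test f : schwartz_bruhat f -> Int f != 0 -> exists2 g, schwartz_bruhat g &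
  mellin chiV g (- s) != 0 /\ mellin chi (F g) (s - 1) != 0.
Proof.
move=> sf If; have [g sg gn] := kpow_neq0_test S hchiV (strip_le Re_opp) sf If.
have [h sh hn] := kpow_neq0_test S hchi (strip_le Re_sub1) sf If.
exists g => //; split => //.
have E := fourier_inv_fourier S sh.
have sE : schwartzlike (F (inv_fourier mu h)) by rewrite E; exact: sl_sb.
have := mellin_fourier (sl_inv_fourier sh) (sl_sb sg) sE (sl_fourier sg).
rewrite E => e; apply: contra_neq (mulf_neq0 hn gn) => g0.
by apply: (etrans e); rewrite g0 mul0r.
Qed.

Lemma is_gammaP g c : schwartz_bruhat g -> mellin chiV g (- s) != 0 ->
  is_gamma mu md chi s c <-> c = mellin chi (F g) (s - 1) / mellin chiV g (- s).
Proof.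
move=> sg gn.
have EL f : schwartz_bruhat f ->
    Int (fun x => F f x * quasichar md chi s x) = mellin chi (F f) (s - 1).
  by move=> sf; exact: (quasichar_mellin (sl_fourier sf)).
have ER f : schwartz_bruhat f ->
    Int (fun x => f x * dual_quasichar md chi s x) = mellin chiV f (- s).
  by move=> sf; apply: (dual_quasichar_mellin _).2; exact: mellin_cint (sl_sb sf) (strip_le Re_opp).
split=> [H|-> f sf].
  have := H g sg; rewrite (EL g sg) (ER g sg) => ->.
  by rewrite mulfK.
rewrite (EL f sf) (ER f sf) mulrAC.
apply: (mulIf gn); rewrite divfK//.
exact: (mellin_fourier (sl_sb sf) (sl_sb sg) (sl_fourier sf) (sl_fourier sg)).
Qed.

Lemma GammaE g : schwartz_bruhat g -> mellin chiV g (- s) != 0 ->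
  Gamma mu md chi s = mellin chi (F g) (s - 1) / mellin chiV g (- s).
Proof.
move=> sg gn; apply: xget_unique; first exact/(is_gammaP _ sg gn).
by move=> c /(is_gammaP _ sg gn).
Qed.

Lemma mellin_Gamma g f : schwartz_bruhat g -> mellin chiV g (- s) != 0 -> schwartz_bruhat f ->
  mellin chi (F f) (s - 1) = Gamma mu md chi s * mellin chiV f (- s).
Proof.
move=> sg gn sf; rewrite (GammaE sg gn) mulrAC; apply: (mulIf gn); rewrite divfK//.
exact: (mellin_fourier (sl_sb sf) (sl_sb sg) (sl_fourier sf) (sl_fourier sg)).
Qed.

Lemma qderiv_A f : schwartzlike f -> qderiv (fun s => mellin chi f (s - 1)) s
  (mellin chi (fun x => (ln (md x))%:C * f x) (s - 1)).
Proof.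
move=> sf; apply: (@qderiv_shift R (mellin chi f) s _ (-1)).
by apply: (qderiv_kpow S hchi sf.1 _ Re_sub1) => a; exact: sl_int.
Qed.

Lemma qderiv_B f : schwartzlike f -> qderiv (fun s => mellin chiV f (- s)) s
  (- mellin chiV (fun x => (ln (md x))%:C * f x) (- s)).
Proof.
move=> sf; apply: (@qderivN R (mellin chiV f)).
by apply: (qderiv_kpow S hchiV sf.1 _ Re_opp) => a; exact: sl_int.
Qed.

End Strip.
Section LogDerivative.
Variable s : R[i].
Hypothesis hs : 0 < complex.Re s < 1.
Variable g : K -> R[i].
Hypotheses (sg : schwartz_bruhat g) (gn : mellin chiV g (- s) != 0).
Local Notation L f := (fun x => (ln (md x))%:C * f x).

Lemma strip_near : exists2 e : R, 0 < e & forall w, cn w <= e -> 0 < complex.Re (s + w) < 1.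
Proof.
exists (Num.min (complex.Re s) (1 - complex.Re s) / 2).
  by rewrite divr_gt0// lt_min; move: hs; lra.
move=> w we; have hw := le_trans (cn_Re w) we.
have h1 : Num.min (complex.Re s) (1 - complex.Re s) <= complex.Re s by rewrite ge_min lexx.
have h2 : Num.min (complex.Re s) (1 - complex.Re s) <= 1 - complex.Re s by rewrite ge_min lexx orbT.
have -> : complex.Re (s + w) = complex.Re s + complex.Re w by case: s w {hw we} => ? ? [].
by move: hw hs; rewrite ler_norml; move: h1 h2; set m := Num.min _ _; lra.
Qed.

Lemma qderiv_Gamma : qderiv (Gamma mu md chi) s
  ((mellin chi (L (F g)) (s - 1) - Gamma mu md chi s * - mellin chiV (L g) (- s)) / mellin chiV g (- s)).
Proof.
have qA := qderiv_A hs (sl_fourier sg); have qB := qderiv_B hs (sl_sb sg).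
have [e1 e10 H1] := strip_near; have [e2 e20 H2] := qderiv_lower qB gn.
have m0 : 0 < Num.min e1 e2 by rewrite lt_min e10.
apply: (qderiv_div m0 _ qA qB gn) => w; rewrite le_min => /andP[/H1 hw /H2 lw].
apply: (mellin_Gamma hw sg _ sg); rewrite -cn_gt0; apply: lt_le_trans lw.
by rewrite divr_gt0// cn_gt0.
Qed.

Lemma derive1_Gamma f : schwartz_bruhat f ->
  mellin chi (L (F f)) (s - 1) =
  derive1 (Gamma mu md chi) s * mellin chiV f (- s) + Gamma mu md chi s * - mellin chiV (L f) (- s).
Proof.
move=> sf; have qG := qderiv_Gamma; have dG := derive1_qderiv qG.
rewrite -dG in qG; clear dG.
have qA := qderiv_A hs (sl_fourier sf); have qB := qderiv_B hs (sl_sb sf).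
have qP := qderivM qG qB; have [e1 e10 H1] := strip_near.
have [e2 e20 H2] := qderiv_lower (qderiv_B hs (sl_sb sg)) gn.
have m0 : 0 < Num.min e1 e2 by rewrite lt_min e10.
apply: (qderiv_uniq qA); apply: (qderiv_ext m0 _ qP) => w.
rewrite le_min => /andP[/H1 hw /H2 lw].
apply: esym; apply: (mellin_Gamma hw sg _ sf); rewrite -cn_gt0; apply: lt_le_trans lw.
by rewrite divr_gt0// cn_gt0.
Qed.

End LogDerivative.

Section Conductor.
Variable s : R[i].
Hypothesis hs : 0 < complex.Re s < 1.
Local Notation L f := (fun x => (ln (md x))%:C * f x).

Lemma sl_cint_ln f : schwartzlike f -> cint (L f) /\ int (fun x => absv x * cn ((ln (md x))%:C * f x)).
Proof.
move=> [mf df]; have i0 := int_ln_decays S 0 mf df; have i1 := int_ln_decays S 1 mf df.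
have mL : kmeas (L f) by apply: cmeasM => //; apply: cmeas_real; exact: (meas_ln_md S).
split.
  by apply: (cintegrable_le mL i0) => x; rewrite cnM cn_real expr0 mul1r mulrC.
apply: le_int i1 _.
  by apply: measurable_funM; [exact: meas_absv|exact: cmeas_cn].
move=> x; rewrite ger0_norm ?mulr_ge0// cnM cn_real expr1 [`|_| * _]mulrC mulrA.
by rewrite ler_wpM2r// ler_wpM2r// lerDr.
Qed.

Lemma fourier_ln_bound f : schwartz_bruhat f -> Int f != 0 ->
  forall al : K -> R[i], schwartz_bruhat al -> exists2 C : R, 0 <= C & forall x, x != 0 ->
    md x * cn (F (L (inv_fourier mu al)) x) <= C.
Proof.
move=> sf If al sal; set c := Int f in If.
pose eta x := c^-1 * f x; have cf := sb_cint S sf.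
have Fe : F eta = fun y => c^-1 * F f y.
  apply/funext => y; rewrite /fourier -(cintegralZ _ (cint_fourier S y cf)).
  by apply: eq_cintegral => x; rewrite mulrA.
have scale (h : K -> R[i]) : decays h -> decays (fun x => c^-1 * h x).
  move=> dh M; have [C C0 HC] := dh M; exists (cn c^-1 * C); first by rewrite mulr_ge0.
  by move=> x; rewrite cnM mulrCA ler_wpM2l.
have sa : schwartzlike (inv_fourier mu al) := sl_inv_fourier sal.
have Fa := fourier_inv_fourier S sal.
apply: (fourier_log_bound S (eta := eta)).
- by apply: cmeasM; [exact: cmeas_cst|exact: sb_kmeas].
- by apply: scale; exact: sb_decays.
- by rewrite Fe; apply: scale; exact: (sb_fourier_decays S).
- by move=> d; rewrite (cintegralZ _ cf) mulVf// mulr1.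
- exact: sa.1.
- exact: sa.2.
- by rewrite Fa; exact: sb_decays.
- by rewrite Fa; apply: (sb_diff_decays (hd_rat S)) sal; exact: (hd_char S).
Qed.

Lemma fourier_ln_kmeas f : schwartzlike f -> kmeas (F (L f)).
Proof.
by move=> /sl_cint_ln[ci xi]; apply: cmeas_continuous; exact: (fourier_continuous S).
Qed.

Lemma fourier_ln_cint f (al : K -> R[i]) : schwartz_bruhat f -> Int f != 0 -> schwartz_bruhat al ->
  cint (fun x => F (L (inv_fourier mu al)) x * kpow md chiV (- s) x).
Proof.
move=> sf If sal; have [C C0 HC] := fourier_ln_bound sf If sal.
have sa := sl_inv_fourier sal; have [ci xi] := sl_cint_ln sa.
set phi := L (inv_fourier mu al) in HC ci xi *.
set D := 2 * \int[mu]_(x in setT) cn (phi x).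
have D0 : 0 <= D by rewrite mulr_ge0//; exact: Rintegral_ge0.
have HD y : cn (F phi y) <= D by exact: (fourier_le S).
have iw : int (wt md (complex.Re s) (1 + complex.Re s)) by apply: (int_wt S); move: hs; lra.
apply: (cintegrable_le0 S) (intZ (D + C) iw) _.
  by apply: cmeasM; [exact: fourier_ln_kmeas|exact: (kmeas_kpow S hchiV)].
move=> x x0; have mx := md_gt0 S x0; rewrite cnM (cn_kpow S hchiV)//.
have -> : complex.Re (- s) = - complex.Re s by case: (s).
have p0 : 0 <= md x `^ (- complex.Re s) by exact: powR_ge0.
rewrite /wt; case: (leP (md x) 1) => x1; rewrite ?addr0 ?add0r.
  by rewrite ler_wpM2r//; apply: (le_trans (HD x)); rewrite lerDl.
rewrite opprD powRD ?(gt_eqF mx) ?implybT// powR_inv1// mulrA ler_wpM2r//.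
rewrite ler_pdivlMr// mulrC; apply: (le_trans (HC x x0)).
by rewrite lerDr.
Qed.

Lemma mellin_fourier_ln g (al : K -> R[i]) : schwartz_bruhat g -> Int g != 0 -> schwartz_bruhat al ->
  forall h : K -> R[i], schwartz_bruhat h ->
  mellin chiV (F (L (inv_fourier mu al))) (- s) * mellin chi (F h) (s - 1) =
  mellin chiV h (- s) * mellin chi (L (F al)) (s - 1).
Proof.
move=> sg Ig sal h sh; have sa := sl_inv_fourier sal; have [ci xi] := sl_cint_ln sa.
have FF : F (F h) = fun x => h (- x).
  by apply/funext => x; rewrite -[x in LHS]opprK -inv_fourierE (hd_inv S sh).
have sFh := sl_fourier sh; have sho := sl_opp (sl_sb sh).
have sFF : schwartzlike (F (F h)) by rewrite FF.
have rel y : y != 0 -> kpow md chi (s - 1) y * (md y)%:C * kpow md chiV (- s) y = 1.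
  have E (p q r : R[i]) : p * q * r = r * q * p by ring.
  by move=> y0; rewrite E kpow_relation.
have e : mellin chiV (F (L (inv_fourier mu al))) (- s) * mellin chi (F h) (s - 1) =
    mellin chiV (F (F h)) (- s) * mellin chi (L (inv_fourier mu al)) (s - 1) :=
  functional_equation S (q := kpow md chiV (- s)) (th := kpow md chi (s - 1))
    (kmeas_kpow S hchiV _) (kpowM S hchiV _) rel ci (sl_cint sFh)
    (fourier_ln_kmeas sa) sFF.1 (fourier_ln_cint sg Ig sal)
    (mellin_cint hchiV sFF (strip_le (Re_opp hs)))
    (cint_ln_kpow S hchi sa.1 (fun a : R => sl_int sa) (Re_sub1 hs))
    (mellin_cint hchi sFh (strip_le (Re_sub1 hs))).
have e1 : mellin chiV (F (F h)) (- s) = kpow md chiV (- s) (-1) * mellin chiV h (- s).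
  rewrite FF; apply: (mellin_opp hchiV).
  exact: (mellin_cint hchiV (sl_sb sh) (strip_le (Re_opp hs))).
have e2 : mellin chi (L (inv_fourier mu al)) (s - 1) = kpow md chi (s - 1) (-1) * mellin chi (L (F al)) (s - 1).
  have ci2 := cint_ln_kpow S hchi (sl_fourier sal).1 (fun a : R => sl_int (sl_fourier sal)) (Re_sub1 hs).
  apply: (etrans _ (mellin_opp (f := L (F al)) hchi ci2)).
  apply: (congr1 (fun f => mellin chi f (s - 1))); apply/funext => x.
  by rewrite inv_fourierE (mdN S).
apply: (etrans e); apply: (etrans (congr2 (fun p q => p * q) e1 e2)); clear e e1 e2.
have k1 : kpow md chiV (- s) (-1) * kpow md chi (s - 1) (-1) = 1.
  have n1 : (-1 : K) != 0 by rewrite oppr_eq0 oner_neq0.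
  by have := kpow_relation s n1; rewrite (mdN1 S) mulr1.
by rewrite mulrACA k1 mul1r.
Qed.

End Conductor.
End GammaFactor.

Transparent cintegral.

Section HaarData.
Variables (R : realType) (K : completeValuedFieldType R).
Variable mu : {measure set (borel K) -> \bar R}.
Local Notation Int f := (cintegral mu (f : borel K -> R[i])).
Implicit Types (f g : K -> R[i]).

Lemma exists_dense_seq (F : fieldExtType rat) (iota : {rmorphism F -> K}) : dense (range iota) ->
  exists q : nat -> K, forall x (e : R), 0 < e -> exists n, absv (q n - x) < e.
Proof.
move=> hd.
exists (fun n => if unpickle n is Some v then iota (VectorInternalTheory.r2v (v : 'rV[rat]_(dim F))) else 0).
move=> x e e0; have [|w [/= xe [a _ ax]]] := hd [set y | absv (y - x) < e] _ (open_absv_lt x e).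
  by exists x; rewrite /= subrr absv0.
by exists (pickle (VectorInternalTheory.v2r a)); rewrite pickleK VectorInternalTheory.v2rK ax.
Qed.

Lemma fine_integral_neq0 (u : K -> R) : measurable_fun setT (u : borel K -> R) ->
  \int[mu]_(x in setT) u x != 0 -> mu.-integrable setT (EFin \o (u : borel K -> R)).
Proof.
move=> mu' h; apply/integrableP; split; first exact/measurable_EFinP.
pose v : borel K -> \bar R := EFin \o u.
have m' : measurable_fun setT v by exact/measurable_EFinP.
have mp := measurable_funepos m'; have mn := measurable_funeneg m'.
have p0 : (0 <= \int[mu]_x (v^\+ x))%E by apply: integral_ge0.
have n0 : (0 <= \int[mu]_x (v^\- x))%E by apply: integral_ge0.
have E : (\int[mu]_x `|v x| = \int[mu]_x v^\+ x + \int[mu]_x v^\- x)%E.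
  rewrite -ge0_integralD//; apply: eq_integral => x _.
  exact: (congr1 (fun w => w x) (fune_abse v)).
have E2 : fine (\int[mu]_x v^\+ x - \int[mu]_x v^\- x)%E != 0 by rewrite -integralE.
rewrite -/v E; move: E2 p0 n0; clear.
by case: (\int[mu]_x v^\+ x)%E => [p| |]; case: (\int[mu]_x v^\- x)%E => [n| |] //=;
  rewrite ?eqxx//= => *; exact: ltry.
Qed.

Hypothesis hh : haar mu.

Lemma finite_ball_of_fourier (phi : {rmorphism rat -> K}) f y : continuous f -> fourier mu f y != 0 ->
  exists2 r : R, 0 < r & (mu (@oball R K r) < +oo)%E.
Proof.
move=> cf Fy; pose g x := f x * addchar (- (x * y)).
have cl : continuous (fun x : K => addchar (- (x * y))).
  have [C C0 HC] := addchar_dist phi.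
  move=> x; apply/continuous_cnP => e e0; exists (e / (C * (absv y + 1))) => [|x'].
    by rewrite divr_gt0// mulr_gt0// ltr_wpDl.
  rewrite ltr_pdivlMr ?mulr_gt0 ?ltr_wpDl// => h; apply: (le_lt_trans (HC _ _)).
  apply: le_lt_trans h; rewrite mulrCA ler_wpM2l ?(ltW C0)//.
  have -> : - (x' * y) - - (x * y) = - ((x' - x) * y) by ring.
  by rewrite absvN absvM ler_wpM2l// lerDl.
have cg : continuous g by move=> x; apply: ccvgM; [exact: cf|exact: cl].
have [m1 m2] := cmeas_continuous cg.
have key (p : R[i] -> R) : (forall z, `|p z| <= cn z) -> (forall z z', p (z - z') = p z - p z') ->
    measurable_fun setT (fun x : borel K => p (g x)) ->
    \int[mu]_(x in setT) p (g x) != 0 -> exists2 r : R, 0 < r & (mu (@oball R K r) < +oo)%E.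
  move=> pc pB mp pn; have ip := fine_integral_neq0 mp pn.
  have [x0 px0] : exists x0, p (g x0) != 0.
    apply: contrapT => nx; move/negP: pn; apply; apply/eqP.
    rewrite /Rintegral (eq_integral (fun=> 0%E)) ?integral0// => x _; congr EFin.
    by apply/eqP/negPn/negP => h; apply: nx; exists x.
  have e0 : 0 < `|p (g x0)| / 2 by rewrite divr_gt0// normr_gt0.
  have /continuous_cnP/(_ _ e0)[d d0 Hd] := cg x0.
  exists d => //; set U := @oball R K d.
  have mU : measurable (U : set (borel K)) := open_meas (open_oball K d).
  have tU : mu [set x0 + x | x in U] = mu U by have [H _ _] := hh; exact: H.
  rewrite -tU; set V := [set x0 + x | x in U].
  have mV : measurable (V : set (borel K)).
    rewrite (_ : V = [set x | absv (x - x0) < d]); first exact: open_meas (open_absv_lt x0 d).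
    apply/seteqP; split => [_ [x xU <-]|x xd] /=; first by rewrite addrAC subrr add0r.
    by exists (x - x0) => //; rewrite addrC subrK.
  set e := `|p (g x0)| / 2 in e0 Hd *.
  have /integrableP[_ fin] := ip.
  have EV : (\int[mu]_x ((\1_V : borel K -> R) x)%:E = mu V)%E by rewrite integral_indic// setIT.
  have : (e%:E * mu V < +oo)%E.
    apply: le_lt_trans fin; rewrite -EV -ge0_integralZl//; last first.
    - by rewrite lee_fin ltW.
    - by apply/measurable_EFinP; exact: measurable_indic.
    apply: ge0_le_integral => //.
    - by move=> x _; rewrite mule_ge0 ?lee_fin ?(ltW e0).
    - by apply: measurable_funeM; apply/measurable_EFinP; exact: measurable_indic.
    - by apply: measurableT_comp => //; exact/measurable_EFinP.
    move=> x _; rewrite indicE; case: (boolP (x \in V)) => [|_]; last by rewrite mule0 abse_ge0.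
    rewrite inE mule1 lee_fin => -[w wU xE].
    have xd : absv (x - x0) < d by rewrite -xE addrAC subrr add0r.
    have := Hd x xd; have := pc (g x - g x0); rewrite pB => h1 h2.
    have := lerB_dist (p (g x0)) (p (g x)); rewrite distrC; rewrite /e in h2 *; lra.
  case: (mu V) => [r| |]//=; first by move=> _; exact: ltry.
  by rewrite mulry gtr0_sg// mul1e ltxx.
have : complex.Re (fourier mu f y) != 0 \/ complex.Im (fourier mu f y) != 0.
  move: Fy; case: (fourier mu f y) => a b; rewrite eq_complex/= negb_and.
  by case/orP; [left|right].
case=> h; [apply: (key (@complex.Re R)) => //|apply: (key (@complex.Im R)) => //].
- exact: cn_Re.
- by move=> [? ?] [? ?].
- exact: cn_Im.
- by move=> [? ?] [? ?].
Qed.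

End HaarData.

Section Construction.
Variables (R : realType) (F : fieldExtType rat) (K : completeValuedFieldType R).
Variable iota : {rmorphism F -> K}.
Hypothesis hK : is_completion iota.
Variable mu : {measure set (borel K) -> \bar R}.
Hypothesis hmu : self_dual_haar mu.
Variable md : K -> R.
Hypothesis hmd : is_module mu md.

Lemma haar_data_of_sb (alpha : K -> R[i]) x0 : schwartz_bruhat alpha -> alpha x0 != 0 ->
  inhabited (haar_data mu md).
Proof.
move=> sa ax0; have [hd hnt] := hK; have [hh hinv] := hmu.
have [q hq] := exists_dense_seq hd.
pose phi : {rmorphism rat -> K} := iota \o in_alg F.
have [y Fy] : exists y, fourier mu alpha y != 0.
  apply: contrapT => nex; move/eqP: ax0; apply; rewrite -(hinv _ sa) /inv_fourier.
  have F0 : fourier mu alpha = fun=> 0.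
    by apply/funext => y; apply/eqP/negPn/negP => h; apply: nex; exists y.
  apply: etrans (cintegral0 mu).2; congr (cintegral mu _).
  by apply/funext => x; rewrite F0 mul0r.
have hfin := finite_ball_of_fourier hh phi (sb_continuous sa) Fy.
have hchar : exists x : K, addchar x != 1.
  apply: contrapT => nex.
  have l1 (x : K) : addchar x = 1 :> R[i].
    by apply/eqP/negPn/negP => h; apply: nex; exists x.
  have cst x : alpha x = alpha x0.
    rewrite -(hinv _ sa) /inv_fourier; congr (cintegral mu _).
    by apply/funext => z; rewrite !l1.
  have a0 : 0 < cn (alpha x0) by rewrite cn_gt0.
  have [C C0 HC] := sb_decays sa 1%N.
  have e0 : 0 < cn (alpha x0) / (C + 1) by rewrite divr_gt0// ltr_wpDl.
  have [p p0 pe] := exists_absv_lt hnt e0.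
  have ap : 0 < absv p by rewrite absv_gt0.
  have := HC p^-1; rewrite cst expr1 absvV; apply/negP; rewrite -ltNge.
  move: pe; rewrite ltr_pdivlMr ?ltr_wpDl// => pe.
  have h : (absv p)^-1 * (absv p * (C + 1)) < (absv p)^-1 * cn (alpha x0).
    by rewrite ltr_pM2l ?invr_gt0.
  rewrite mulKf ?gt_eqF// in h; lra.
exact: (inhabits (HaarData phi hnt hq hh hmd hfin hchar hinv)).
Qed.

End Construction.

Lemma log_deriv_identity (R : realType) (A' B BL D G G' Ag Bg : R[i]) : Ag != 0 -> Ag = G * Bg ->
  D * Ag = Bg * A' -> A' = G' * B + G * - BL -> BL + D = G' / G * B.
Proof.
move=> An E1 E2 E3; have [G0 Bn] : G != 0 /\ Bg != 0.
  by move: An; rewrite E1 mulf_eq0 negb_or => /andP.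
have -> : D = A' / G.
  by apply: (mulIf An); rewrite E2 E1; field.
by rewrite E3; field.
Qed.

Unset Implicit Arguments.
Theorem mainTheorem5 (R : realType) (F : fieldExtType rat)
    (K : completeValuedFieldType R) (iota : {rmorphism F -> K})
    (hK : is_completion iota)
    (mu : {measure set (borel K) -> \bar R}) (hmu : self_dual_haar mu)
    (md : K -> R) (hmd : is_module mu md)
    (chi : K -> R[i]) (hchi : unitary_character chi)
    (s : R[i]) (hs : 0 < complex.Re s < 1)
    (alpha : K -> R[i]) (halpha : schwartz_bruhat alpha) :
  cintegrable mu (fun x : borel K =>
    conductor mu md alpha x * dual_quasichar md chi s x) /\
  cintegral mu (fun x : borel K =>
    conductor mu md alpha x * dual_quasichar md chi s x) =
  dlog_Gamma mu md chi s *
  cintegral mu (fun x : borel K => alpha x * dual_quasichar md chi s x).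
Proof.
have [[x0 ax0]|az] := pselect (exists x0, alpha x0 != 0); last first.
  have a0 : alpha = fun=> 0.
    by apply/funext => x; apply/eqP/negPn/negP => h; apply: az; exists x.
  have c0 x : conductor mu md alpha x = 0.
    rewrite /conductor a0 mulr0 add0r; apply: etrans (cintegral0 mu).2.
    apply: eq_cintegral => y; have -> : inv_fourier mu (fun=> 0 : R[i]) y = 0.
      by apply: etrans (cintegral0 mu).2; apply: eq_cintegral => z; rewrite mul0r.
    by rewrite mulr0 mul0r.
  have -> : (fun x : borel K => conductor mu md alpha x * dual_quasichar md chi s x) = fun=> 0.
    by apply/funext => x; rewrite c0 mul0r.
  have -> : (fun x : borel K => alpha x * dual_quasichar md chi s x) = fun=> 0.
    by apply/funext => x; rewrite a0 mul0r.
  have [i0 ->] := cintegral0 mu.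
  by rewrite mulr0.
have [S] := haar_data_of_sb hK hmu hmd halpha ax0.
have [f sf If] := sb_int_neq0 S halpha ax0.
have [g sg [gn Fgn]] := gamma_test S hchi hs sf If.
have sa := sl_sb halpha.
pose L := fun x : K => (ln (md x))%:C * alpha x.
pose V := fourier mu (fun y : K => (ln (md y))%:C * inv_fourier mu alpha y).
have i1 : cintegrable mu (fun x : borel K => L x * kpow md (fun x => (chi x)^-1) (- s) x).
  exact: (cint_ln_kpow S (unitary_characterV hchi) sa.1 (fun a : R => sl_int S sa) (Re_opp hs)).
have i2 : cintegrable mu (fun x : borel K => V x * kpow md (fun x => (chi x)^-1) (- s) x).
  exact: (fourier_ln_cint S hchi hs sf If halpha).
have i3 : cintegrable mu (fun x : borel K => conductor mu md alpha x * kpow md (fun x => (chi x)^-1) (- s) x).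
  rewrite (_ : (fun x : borel K => _) = fun x : borel K =>
     L x * kpow md (fun x => (chi x)^-1) (- s) x + V x * kpow md (fun x => (chi x)^-1) (- s) x).
    exact: cintegrableD.
  by apply/funext => x; rewrite -mulrDl.
have [j3 e3] := dual_quasichar_mellin S i3; split; first exact: j3.
have i4 := mellin_cint S (unitary_characterV hchi) sa (strip_le (Re_opp hs)).
have [_ e4] := dual_quasichar_mellin S i4.
apply: (etrans e3); apply: (etrans _ (congr1 (fun z => dlog_Gamma mu md chi s * z) (esym e4))).
clear e3 e4.
have e5 : mellin mu md (fun x => (chi x)^-1) (conductor mu md alpha) (- s) =
   mellin mu md (fun x => (chi x)^-1) L (- s) + mellin mu md (fun x => (chi x)^-1) V (- s).
  apply: (etrans _ (cintegralD i1 i2)); apply: eq_cintegral => x.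
  by rewrite -mulrDl.
apply: (etrans e5); clear e5.
exact: (log_deriv_identity Fgn (mellin_Gamma S hchi hs sg gn sg)
  (mellin_fourier_ln S hchi hs sf If halpha sg) (derive1_Gamma S hchi hs sg gn halpha)).
Qed.
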